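(* For a double category $\mathbb B$ there is an equivalence of categories $$\mathcal F_3: q_3\text{-}\mathrm{Ps}^{st}_{vst}(\mathbb B\times\mathbb B\times\mathbb B,\mathbb B)\to \mathrm{Ps}_{vst}(\mathbb B\times\mathbb B\times\mathbb B,\mathbb B)$$ from the category of ternary pseudodouble quasi-functors (with trivial vertical-vertical 2-cells) and their vertical strict transformations to the category of pseudodouble functors $\mathbb B\times\mathbb B\times\mathbb B\to\mathbb B$ and their vertical strict transformations. Similarly, there is an equivalence of categories $$\mathcal F_4: q_4\text{-}\mathrm{Ps}^{st}_{vst}(\mathbb B\times\mathbb B\times\mathbb B\times\mathbb B,\mathbb B)\to \mathrm{Ps}_{vst}(\mathbb B\times\mathbb B\times\mathbb B\times\mathbb B,\mathbb B).$$
   Context: Double categories are strict: objects, 1h-cells (horizontal), 1v-cells (vertical), squares (2-cells). $[a|b]$: horizontal composition ($a$ left); $a/b$: vertical composition ($a$ on top), also for 1v-cells; $a/b/c$ read downwards. $1_A,1^A$: horizontal/vertical identities. A pseudodouble functor $F$ preserves vertical structure strictly and horizontal composition up to coherent natural invertible horizontally globular 2-cells $F_{gf}:F(g)F(f)\Rightarrow F(gf)$, $F_A:1_{F(A)}\Rightarrow F(1_A)$. A vertical strict transformation $\alpha:F\Rightarrow G$: 1v-cells $\alpha(A)$ natural in 1v-cells, squares $\alpha_f$ (top $F(f)$, bottom $G(f)$, left $\alpha(A)$, right $\alpha(B)$) compatible with compositors and unitors, with $F(a)/\alpha_g=\alpha_f/G(a)$ for 2-cells $a$ with top $f$ and bottom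 $g$. Binary pseudodouble quasi-functor with trivial vertical-vertical cells, $H:\mathbb A\times\mathbb B\to\mathbb C$: pseudodouble functors $H(A,-)$, $H(-,B)$ agreeing on objects; for 1h-cells $K:A\to A'$, $k:B\to B'$ and 1v-cells $U:A\to\tilde A$, $u:B\to\tilde B$: invertible horizontally globular $H(K,k):H(K,B')H(A,k)\Rightarrow H(A',k)H(K,B)$; squares $H(K,u)$ (top $H(K,B)$, bottom $H(K,\tilde B)$, left $H(A,u)$, right $H(A',u)$) and $H(U,k)$ (top $H(A,k)$, bottom $H(\tilde A,k)$, left $H(U,B)$, right $H(U,B')$); and $H(U,B)/H(\tilde A,u)=H(A,u)/H(U,\tilde B)$ (trivial cell $H(U,u)$); with axioms: $[H(A,-)_B|\mathrm{Id}]/H(K,1_B)=[\mathrm{Id}|H(A',-)_B]$; $[\mathrm{Id}|H(-,B')_A]/H(1_A,k)=[H(-,B)_A|\mathrm{Id}]$; $H(-,B)_A/H(1_A,u)=\mathrm{Id}^{H(A,u)}/H(-,\tilde B)_A$; $H(A,-)_B/H(U,1_B)=\mathrm{Id}^{H(U,B)}/H(\tilde A,-)_B$; $H(K,1^B)$, $H(1^A,k)$ identities; $[\mathrm{Id}_{H(A,k)}|H(K,k')]/[H(K,k)|\mathrm{Id}]/[\mathrm{Id}|H(A',-)_{k'k}]=[H(A,-)_{k'k}|\mathrm{Id}]/H(K,k'k)$; $[\mathrm{Id}|H(-,B')_{K'K}]/H(K'K,k)=[H(K,k)|\mathrm{Id}]/[\mathrm{Id}|H(K',k)]/[H(-,B)_{K'K}|\mathrm{Id}]$;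 $H(-,B)_{K'K}/H(K'K,u)=[H(K,u)|H(K',u)]/H(-,\tilde B)_{K'K}$; $H(A,-)_{k'k}/H(U,k'k)=[H(U,k)|H(U,k')]/H(\tilde A,-)_{k'k}$; $H(K,u/u')=H(K,u)/H(K,u')$; $H(U/U',k)=H(U,k)/H(U',k)$; and for 2-cells $\omega\in\mathbb B$ (top $k$, bottom $l$, left $u$, right $v$), $\zeta\in\mathbb A$ (top $K$, bottom $L$, left $U$, right $V$): $H(K,k)/[H(K,u)|H(A',\omega)]=[H(A,\omega)|H(K,v)]/H(K,l)$; $H(K,k)/[H(\zeta,B)|H(V,k)]=[H(U,k)|H(\zeta,B')]/H(L,k)$; $H(A,\omega)/H(U,l)=H(U,k)/H(\tilde A,\omega)$; $H(K,u)/H(\zeta,\tilde B)=H(\zeta,B)/H(L,u)$. Ternary: $H:\mathbb A\times\mathbb B\times\mathbb C\to\mathbb E$ consists of binary ones $H(A,-,-)$, $H(-,B,-)$, $H(-,-,C)$ which agree on the underlying one-variable pseudodouble functors $(A,B,-)$, $(A,-,C)$, $(-,B,C)$, and whose cells, written $(f,g,C)$, $(f,B,z)$, etc., satisfy for 1h-cells $f:A\to A'$, $g:B\to B'$, $h:C\to C'$ and 1v-cells $u:A\to\tilde A$, $v:B\to\tilde B$, $z:C\to\tilde C$: $[\mathrm{Id}_{(A,B,h)}|(f,g,C')]/[(f,B,h)|\mathrm{Id}_{(A',g,C')}]/[\mathrm{Id}_{(f,B,C)}|(A',g,h)]=[(A,g,h)|\mathrm{Id}_{(f,B',C')}]/[\mathrm{Id}_{(A,g,C)}|(f,B',h)]/[(f,g,C)|\mathrm{Id}_{(A',B',h)}]$;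 $(f,B,h)/[(f,v,C)|(A',v,h)]=[(A,v,h)|(f,v,C')]/(f,\tilde B,h)$; $(f,g,C)/[(f,B,z)|(A',g,z)]=[(A,g,z)|(f,B',z)]/(f,g,\tilde C)$; $(A,g,h)/[(u,g,C)|(u,B',h)]=[(u,B,h)|(u,g,C')]/(\tilde A,g,h)$; $(u,B,h)/(\tilde A,v,h)=(A,v,h)/(u,\tilde B,h)$; $(u,g,C)/(\tilde A,g,z)=(A,g,z)/(u,g,\tilde C)$; $(f,v,C)/(f,\tilde B,z)=(f,B,z)/(f,v,\tilde C)$. A vertical strict transformation $\theta:H_1\Rightarrow H_2$ of ternary quasi-functors: vertical strict transformations of the one-variable functors $(-,B,C)$, $(A,-,C)$, $(A,B,-)$ agreeing on objects (components $\theta_{f,B,C},\theta_{A,g,C},\theta_{A,B,h}$ at 1h-cells), such that for the pair of slots $(1,2)$: $(f,g,C)^1/[\theta_{f,B,C}|\theta_{A',g,C}]=[\theta_{A,g,C}|\theta_{f,B',C}]/(f,g,C)^2$, $(f,v,C)^1/\theta_{f,\tilde B,C}=\theta_{f,B,C}/(f,v,C)^2$, $(u,g,C)^1/\theta_{\tilde A,g,C}=\theta_{A,g,C}/(u,g,C)^2$, and analogously for the pairs of slots $(1,3)$ and $(2,3)$ (superscripts $1,2$ refer to $H_1,H_2$). Quasi-functors of four variables and their vertical strict transformations consist of such data for every choice of three variables (the fourth being fixed at an object). *)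

(* Defs.v *)
From mathcomp Require Import ssreflect.
From Stdlib Require Import ProofIrrelevance FunctionalExtensionality.

Set Implicit Arguments.
Unset Strict Implicit.
Unset Printing Implicit Defensive.

Declare Scope dbl_scope.
Delimit Scope dbl_scope with dbl.
Local Open Scope dbl_scope.

Record category := Category {
  cob : Type;
  chom : cob -> cob -> Type;
  cid : forall X, chom X X;
  ccomp : forall X Y Z, chom X Y -> chom Y Z -> chom X Z;
  ccomp1l : forall X Y (f : chom X Y), ccomp (cid X) f = f;
  ccomp1r : forall X Y (f : chom X Y), ccomp f (cid Y) = f;
  ccompA : forall X Y Z W (f : chom X Y) (g : chom Y Z) (h : chom Z W),
    ccomp (ccomp f g) h = ccomp f (ccomp g h)
}.
Arguments cid {c} X.
Arguments ccomp {c X Y Z} f g.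

Record functor (C D : category) := Functor {
  fun_ob :> cob C -> cob D;
  fun_hom : forall X Y, chom X Y -> chom (fun_ob X) (fun_ob Y);
  fun_id : forall X, fun_hom (cid X) = cid (fun_ob X);
  fun_comp : forall X Y Z (f : chom X Y) (g : chom Y Z),
    fun_hom (ccomp f g) = ccomp (fun_hom f) (fun_hom g)
}.

Definition id_functor (C : category) : functor C C :=
  @Functor C C (fun X => X) (fun X Y f => f)
    (fun X => eq_refl) (fun X Y Z f g => eq_refl).

Definition comp_functor (C D E : category) (F : functor C D) (G : functor D E) :
  functor C E.
Proof.
refine (@Functor C E (fun X => G (F X)) (fun X Y f => fun_hom G (fun_hom F f)) _ _).
- by move=> X; rewrite !fun_id.
- by move=> X Y Z f g; rewrite !fun_comp.
Defined.

Definition is_iso (C : category) (X Y : cob C) (f : chom X Y) : Prop :=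
  exists g : chom Y X, ccomp f g = cid X /\ ccomp g f = cid Y.

Definition naturally_isomorphic (C D : category) (F G : functor C D) : Prop :=
  exists t : forall X, chom (F X) (G X),
    (forall X Y (f : chom X Y),
       ccomp (fun_hom F f) (t Y) = ccomp (t X) (fun_hom G f)) /\
    (forall X, is_iso (t X)).

Definition is_equivalence (C D : category) (F : functor C D) : Prop :=
  exists G : functor D C,
    naturally_isomorphic (id_functor C) (comp_functor F G) /\
    naturally_isomorphic (comp_functor G F) (id_functor D).

(* The 1-cells and the squares each form a single type, with boundary maps, so
   that pastings whose boundaries agree only up to the strict associativity and
   unit laws can be compared by plain equality. Compositions are total functions
   whose values matter only on composable cells: every law assumes
   composability.  Both compositions are written in diagrammatic order:
   [f ;h g] is "f, then g", [a <|> b] is [a|b] and [a </> b] is a/b.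
   [sq_id1h f] is the vertical identity Id_f of a 1h-cell, and [sq_id1v u] the
   horizontal identity Id^u of a 1v-cell. *)
Record double_category := DoubleCategory {
  ob : Type;
  hcell : Type;
  vcell : Type;
  sq : Type;
  hsrc : hcell -> ob;
  htgt : hcell -> ob;
  vsrc : vcell -> ob;
  vtgt : vcell -> ob;
  top : sq -> hcell;
  bot : sq -> hcell;
  lft : sq -> vcell;
  rgt : sq -> vcell;
  hid : ob -> hcell;
  vid : ob -> vcell;
  hcomp : hcell -> hcell -> hcell;
  vcomp : vcell -> vcell -> vcell;
  sq_id1h : hcell -> sq;
  sq_id1v : vcell -> sq;
  sq_hcomp : sq -> sq -> sq;
  sq_vcomp : sq -> sq -> sq;

  hsrc_hid : forall x, hsrc (hid x) = x;
  htgt_hid : forall x, htgt (hid x) = x;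
  hsrc_hcomp : forall f g, htgt f = hsrc g -> hsrc (hcomp f g) = hsrc f;
  htgt_hcomp : forall f g, htgt f = hsrc g -> htgt (hcomp f g) = htgt g;
  hcomp1l : forall f, hcomp (hid (hsrc f)) f = f;
  hcomp1r : forall f, hcomp f (hid (htgt f)) = f;
  hcompA : forall f g h, htgt f = hsrc g -> htgt g = hsrc h ->
    hcomp (hcomp f g) h = hcomp f (hcomp g h);

  vsrc_vid : forall x, vsrc (vid x) = x;
  vtgt_vid : forall x, vtgt (vid x) = x;
  vsrc_vcomp : forall u v, vtgt u = vsrc v -> vsrc (vcomp u v) = vsrc u;
  vtgt_vcomp : forall u v, vtgt u = vsrc v -> vtgt (vcomp u v) = vtgt v;
  vcomp1l : forall u, vcomp (vid (vsrc u)) u = u;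
  vcomp1r : forall u, vcomp u (vid (vtgt u)) = u;
  vcompA : forall u v w, vtgt u = vsrc v -> vtgt v = vsrc w ->
    vcomp (vcomp u v) w = vcomp u (vcomp v w);

  hsrc_top : forall a, hsrc (top a) = vsrc (lft a);
  htgt_top : forall a, htgt (top a) = vsrc (rgt a);
  hsrc_bot : forall a, hsrc (bot a) = vtgt (lft a);
  htgt_bot : forall a, htgt (bot a) = vtgt (rgt a);

  top_id1h : forall f, top (sq_id1h f) = f;
  bot_id1h : forall f, bot (sq_id1h f) = f;
  lft_id1h : forall f, lft (sq_id1h f) = vid (hsrc f);
  rgt_id1h : forall f, rgt (sq_id1h f) = vid (htgt f);
  top_id1v : forall u, top (sq_id1v u) = hid (vsrc u);
  bot_id1v : forall u, bot (sq_id1v u) = hid (vtgt u);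
  lft_id1v : forall u, lft (sq_id1v u) = u;
  rgt_id1v : forall u, rgt (sq_id1v u) = u;

  top_sqh : forall a b, rgt a = lft b -> top (sq_hcomp a b) = hcomp (top a) (top b);
  bot_sqh : forall a b, rgt a = lft b -> bot (sq_hcomp a b) = hcomp (bot a) (bot b);
  lft_sqh : forall a b, rgt a = lft b -> lft (sq_hcomp a b) = lft a;
  rgt_sqh : forall a b, rgt a = lft b -> rgt (sq_hcomp a b) = rgt b;
  sqh1l : forall a, sq_hcomp (sq_id1v (lft a)) a = a;
  sqh1r : forall a, sq_hcomp a (sq_id1v (rgt a)) = a;
  sqhA : forall a b c, rgt a = lft b -> rgt b = lft c ->
    sq_hcomp (sq_hcomp a b) c = sq_hcomp a (sq_hcomp b c);

  top_sqv : forall a b, bot a = top b -> top (sq_vcomp a b) = top a;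
  bot_sqv : forall a b, bot a = top b -> bot (sq_vcomp a b) = bot b;
  lft_sqv : forall a b, bot a = top b -> lft (sq_vcomp a b) = vcomp (lft a) (lft b);
  rgt_sqv : forall a b, bot a = top b -> rgt (sq_vcomp a b) = vcomp (rgt a) (rgt b);
  sqv1l : forall a, sq_vcomp (sq_id1h (top a)) a = a;
  sqv1r : forall a, sq_vcomp a (sq_id1h (bot a)) = a;
  sqvA : forall a b c, bot a = top b -> bot b = top c ->
    sq_vcomp (sq_vcomp a b) c = sq_vcomp a (sq_vcomp b c);

  interchange : forall a b c d,
    rgt a = lft b -> rgt c = lft d -> bot a = top c -> bot b = top d ->
    sq_vcomp (sq_hcomp a b) (sq_hcomp c d) = sq_hcomp (sq_vcomp a c) (sq_vcomp b d);
  sq_id1h_hcomp : forall f g, htgt f = hsrc g ->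
    sq_id1h (hcomp f g) = sq_hcomp (sq_id1h f) (sq_id1h g);
  sq_id1v_vcomp : forall u v, vtgt u = vsrc v ->
    sq_id1v (vcomp u v) = sq_vcomp (sq_id1v u) (sq_id1v v);
  sq_id1v_vid : forall x, sq_id1v (vid x) = sq_id1h (hid x)
}.


Notation "f ;h g" := (hcomp f g) (at level 40, left associativity) : dbl_scope.
Notation "u ;v v" := (vcomp u v) (at level 40, left associativity) : dbl_scope.
Notation "a <|> b" := (sq_hcomp a b) (at level 45, left associativity) : dbl_scope.
Notation "a </> b" := (sq_vcomp a b) (at level 50, left associativity) : dbl_scope.
Notation "'Idh' f" := (sq_id1h f) (at level 10, f at level 9) : dbl_scope.
Notation "'Idv' u" := (sq_id1v u) (at level 10, u at level 9) : dbl_scope.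

(* A square from the 1h-cell [f] to the 1h-cell [g] whose vertical sides are
   identities and which is invertible for vertical composition.  *)
Record inv_globular (D : double_category) (f g : hcell D) (a : sq D) : Prop :=
  InvGlobular {
    ig_top : top a = f;
    ig_bot : bot a = g;
    ig_lft : lft a = vid (hsrc f);
    ig_rgt : rgt a = vid (htgt f);
    ig_inv : exists b, bot a = top b /\ bot b = top a /\
                       a </> b = Idh (top a) /\ b </> a = Idh (bot a)
}.

Definition prod_map2 (S T S' T' S'' T'' : Type) (p : S -> S' -> S'') (q : T -> T' -> T'')
  (x : S * T) (y : S' * T') : S'' * T'' := (p (fst x) (fst y), q (snd x) (snd y)).

Definition prod_map (S T S' T' : Type) (p : S -> S') (q : T -> T')
  (x : S * T) : S' * T' := (p (fst x), q (snd x)).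

Definition prod_dbl (A B : double_category) : double_category.
Proof.
refine (@DoubleCategory (ob A * ob B) (hcell A * hcell B) (vcell A * vcell B)
  (sq A * sq B)
  (prod_map (@hsrc A) (@hsrc B)) (prod_map (@htgt A) (@htgt B))
  (prod_map (@vsrc A) (@vsrc B)) (prod_map (@vtgt A) (@vtgt B))
  (prod_map (@top A) (@top B)) (prod_map (@bot A) (@bot B))
  (prod_map (@lft A) (@lft B)) (prod_map (@rgt A) (@rgt B))
  (prod_map (@hid A) (@hid B)) (prod_map (@vid A) (@vid B))
  (prod_map2 (@hcomp A) (@hcomp B)) (prod_map2 (@vcomp A) (@vcomp B))
  (prod_map (@sq_id1h A) (@sq_id1h B)) (prod_map (@sq_id1v A) (@sq_id1v B))
  (prod_map2 (@sq_hcomp A) (@sq_hcomp B)) (prod_map2 (@sq_vcomp A) (@sq_vcomp B))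
  _ _ _ _ _ _ _ _ _ _ _ _ _ _ _ _ _ _ _ _ _ _ _ _ _ _ _ _ _ _ _ _ _ _ _ _ _ _ _ _
  _ _ _ _);
  repeat match goal with |- forall x : _ * _, _ => case => ? ? end;
  rewrite /prod_map /prod_map2 /=;
  repeat (case => ? ?); congr pair;
  by [ exact: hsrc_hid | exact: htgt_hid | exact: hsrc_hcomp | exact: htgt_hcomp
     | exact: hcomp1l | exact: hcomp1r | exact: hcompA
     | exact: vsrc_vid | exact: vtgt_vid | exact: vsrc_vcomp | exact: vtgt_vcomp
     | exact: vcomp1l | exact: vcomp1r | exact: vcompA
     | exact: hsrc_top | exact: htgt_top | exact: hsrc_bot | exact: htgt_bot
     | exact: top_id1h | exact: bot_id1h | exact: lft_id1h | exact: rgt_id1h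
     | exact: top_id1v | exact: bot_id1v | exact: lft_id1v | exact: rgt_id1v
     | exact: top_sqh | exact: bot_sqh | exact: lft_sqh | exact: rgt_sqh
     | exact: sqh1l | exact: sqh1r | exact: sqhA
     | exact: top_sqv | exact: bot_sqv | exact: lft_sqv | exact: rgt_sqv
     | exact: sqv1l | exact: sqv1r | exact: sqvA
     | exact: interchange | exact: sq_id1h_hcomp | exact: sq_id1v_vcomp
     | exact: sq_id1v_vid ].
Defined.

Notation "A ** B" := (prod_dbl A B) (at level 40, left associativity) : dbl_scope.

(* The compositor [pcomp F e : F f ;h F g => F (f ;h g)] takes a proof that [f]
   and [g] are composable, so that a functor carries no data on other pairs.
   [punit F x : hid (F x) => F (hid x)] is the unitor. *)
Record psfunctor (A B : double_category) := PsFunctor {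
  pob : ob A -> ob B;
  ph : hcell A -> hcell B;
  pv : vcell A -> vcell B;
  psq : sq A -> sq B;
  pcomp : forall f g : hcell A, htgt f = hsrc g -> sq B;
  punit : ob A -> sq B;

  ph_src : forall f, hsrc (ph f) = pob (hsrc f);
  ph_tgt : forall f, htgt (ph f) = pob (htgt f);
  pv_src : forall u, vsrc (pv u) = pob (vsrc u);
  pv_tgt : forall u, vtgt (pv u) = pob (vtgt u);
  psq_top : forall a, top (psq a) = ph (top a);
  psq_bot : forall a, bot (psq a) = ph (bot a);
  psq_lft : forall a, lft (psq a) = pv (lft a);
  psq_rgt : forall a, rgt (psq a) = pv (rgt a);

  pv_vid : forall x, pv (vid x) = vid (pob x);
  pv_vcomp : forall u v, vtgt u = vsrc v -> pv (u ;v v) = pv u ;v pv v;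
  psq_id1h : forall f, psq (Idh f) = Idh (ph f);
  psq_sqv : forall a b, bot a = top b -> psq (a </> b) = psq a </> psq b;

  pcomp_glob : forall f g (e : htgt f = hsrc g),
    inv_globular (ph f ;h ph g) (ph (f ;h g)) (pcomp e);
  punit_glob : forall x, inv_globular (hid (pob x)) (ph (hid x)) (punit x);
  pcomp_nat : forall a b (e : htgt (top a) = hsrc (top b))
                         (e' : htgt (bot a) = hsrc (bot b)), rgt a = lft b ->
    pcomp e </> psq (a <|> b) = psq a <|> psq b </> pcomp e';
  punit_nat : forall u,
    punit (vsrc u) </> psq (Idv u) = Idv (pv u) </> punit (vtgt u);
  pcompA : forall f g h (e1 : htgt f = hsrc g) (e2 : htgt g = hsrc h)
      (e12 : htgt (f ;h g) = hsrc h) (e21 : htgt f = hsrc (g ;h h)),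
    pcomp e1 <|> Idh (ph h) </> pcomp e12 = Idh (ph f) <|> pcomp e2 </> pcomp e21;
  pcomp1l : forall f (e : htgt (hid (hsrc f)) = hsrc f),
    punit (hsrc f) <|> Idh (ph f) </> pcomp e = Idh (ph f);
  pcomp1r : forall f (e : htgt f = hsrc (hid (htgt f))),
    Idh (ph f) <|> punit (htgt f) </> pcomp e = Idh (ph f)
}.

Arguments pcomp {A B} p {f g} e.

(* A vertical strict transformation, with components [t0] at objects and [t1] at
   1h-cells. *)
Record is_vst (A B : double_category) (F G : psfunctor A B)
    (t0 : ob A -> vcell B) (t1 : hcell A -> sq B) : Prop := IsVst {
  vst_src : forall x, vsrc (t0 x) = pob F x;
  vst_tgt : forall x, vtgt (t0 x) = pob G x;
  vst_top : forall f, top (t1 f) = ph F f;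
  vst_bot : forall f, bot (t1 f) = ph G f;
  vst_lft : forall f, lft (t1 f) = t0 (hsrc f);
  vst_rgt : forall f, rgt (t1 f) = t0 (htgt f);
  vst_nat_v : forall u, pv F u ;v t0 (vtgt u) = t0 (vsrc u) ;v pv G u;
  vst_comp : forall f g (e : htgt f = hsrc g),
    pcomp F e </> t1 (f ;h g) = t1 f <|> t1 g </> pcomp G e;
  vst_unit : forall x, punit F x </> t1 (hid x) = Idv (t0 x) </> punit G x;
  vst_nat_sq : forall a, psq F a </> t1 (bot a) = t1 (top a) </> psq G a
}.

Record vst (A B : double_category) (F G : psfunctor A B) := Vst {
  vst_ob : ob A -> vcell B;
  vst_h : hcell A -> sq B;
  vst_ax : is_vst F G vst_ob vst_h
}.

Lemma paste2 (D : double_category) (a b c x x' y y' : sq D) :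
  bot a = top y -> bot y = top y' -> bot x = top b -> bot b = top y' ->
  bot x = top x' -> bot x' = top c ->
  a </> y = x </> b -> b </> y' = x' </> c -> a </> (y </> y') = x </> x' </> c.
Proof. by move=> ? ? ? ? ? ? e e'; rewrite -sqvA // e sqvA // e' sqvA. Qed.

Lemma vcomp2 (D : double_category) (a b c x x' y y' : vcell D) :
  vtgt a = vsrc y -> vtgt y = vsrc y' -> vtgt x = vsrc b -> vtgt b = vsrc y' ->
  vtgt x = vsrc x' -> vtgt x' = vsrc c ->
  a ;v y = x ;v b -> b ;v y' = x' ;v c -> a ;v (y ;v y') = x ;v x' ;v c.
Proof. by move=> ? ? ? ? ? ? e e'; rewrite -vcompA // e vcompA // e' vcompA. Qed.

Lemma is_vst_id (A B : double_category) (F : psfunctor A B) :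
  is_vst F F (fun x => vid (pob F x)) (fun f => Idh (ph F f)).
Proof.
split; intros; rewrite ?vsrc_vid ?vtgt_vid ?top_id1h ?bot_id1h ?lft_id1h ?rgt_id1h
  ?ph_src ?ph_tgt //.
- by rewrite -pv_src -pv_tgt vcomp1l vcomp1r.
- have [eqt eqb _ _ _] := pcomp_glob F e.
  rewrite -sq_id1h_hcomp ?ph_src ?ph_tgt ?e //.
  by rewrite -{1}eqb -{1}eqt sqv1l sqv1r.
- have [eqt eqb _ _ _] := punit_glob F x.
  by rewrite sq_id1v_vid -{1}eqb -{1}eqt sqv1l sqv1r.
- by rewrite -psq_bot -psq_top sqv1l sqv1r.
Qed.

Lemma is_vst_comp (A B : double_category) (F G H : psfunctor A B) s0 s1 t0 t1 :
  is_vst F G s0 s1 -> is_vst G H t0 t1 ->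
  is_vst F H (fun x => s0 x ;v t0 x) (fun f => s1 f </> t1 f).
Proof.
move=> s t.
have est0 x : vtgt (s0 x) = vsrc (t0 x) by rewrite (vst_tgt s) (vst_src t).
have est1 f : bot (s1 f) = top (t1 f) by rewrite (vst_bot s) (vst_top t).
have es f g : htgt f = hsrc g -> rgt (s1 f) = lft (s1 g)
  by move=> e; rewrite (vst_rgt s) (vst_lft s) e.
have et f g : htgt f = hsrc g -> rgt (t1 f) = lft (t1 g)
  by move=> e; rewrite (vst_rgt t) (vst_lft t) e.
split.
- by move=> x; rewrite vsrc_vcomp // (vst_src s).
- by move=> x; rewrite vtgt_vcomp // (vst_tgt t).
- by move=> f; rewrite top_sqv // (vst_top s).
- by move=> f; rewrite bot_sqv // (vst_bot t).
- by move=> f; rewrite lft_sqv // (vst_lft s) (vst_lft t).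
- by move=> f; rewrite rgt_sqv // (vst_rgt s) (vst_rgt t).
- move=> u; apply: (vcomp2 (b := pv G u)) => //.
  + by rewrite pv_tgt (vst_src s).
  + by rewrite pv_src (vst_tgt s).
  + by rewrite pv_tgt (vst_src t).
  + by rewrite pv_src (vst_tgt t).
  + exact: (vst_nat_v s).
  + exact: (vst_nat_v t).
- move=> f g e; have {}es := es _ _ e; have {}et := et _ _ e.
  rewrite -interchange //.
  have [eFt eFb _ _ _] := pcomp_glob F e.
  have [eGt eGb _ _ _] := pcomp_glob G e.
  have [eHt eHb _ _ _] := pcomp_glob H e.
  apply: (paste2 (b := pcomp G e)) => //.
  + by rewrite eFb (vst_top s).
  + by rewrite bot_sqh ?es // !(vst_bot s) eGt.
  + by rewrite eGb (vst_top t).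
  + by rewrite bot_sqh ?top_sqh ?es ?et // !est1.
  + by rewrite bot_sqh ?et // !(vst_bot t) eHt.
  + exact: (vst_comp s).
  + exact: (vst_comp t).
- move=> x; rewrite sq_id1v_vcomp //.
  have [eFt eFb _ _ _] := punit_glob F x.
  have [eGt eGb _ _ _] := punit_glob G x.
  have [eHt eHb _ _ _] := punit_glob H x.
  apply: (paste2 (b := punit G x)) => //.
  + by rewrite eFb (vst_top s).
  + by rewrite bot_id1v (vst_tgt s) eGt.
  + by rewrite eGb (vst_top t).
  + by rewrite bot_id1v top_id1v est0.
  + by rewrite bot_id1v (vst_tgt t) eHt.
  + exact: (vst_unit s).
  + exact: (vst_unit t).
- move=> a; apply: (paste2 (b := psq G a)) => //.
  + by rewrite psq_bot (vst_top s).
  + by rewrite psq_top (vst_bot s).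
  + by rewrite psq_bot (vst_top t).
  + by rewrite psq_top (vst_bot t).
  + exact: (vst_nat_sq s).
  + exact: (vst_nat_sq t).
Qed.

Lemma is_vst_1l (A B : double_category) (F G : psfunctor A B) t0 t1 :
  is_vst F G t0 t1 -> (forall x, vid (pob F x) ;v t0 x = t0 x) /\
                      (forall f, Idh (ph F f) </> t1 f = t1 f).
Proof. by move=> t; split=> *; rewrite -?(vst_src t) -?(vst_top t) ?vcomp1l ?sqv1l. Qed.

Lemma is_vst_1r (A B : double_category) (F G : psfunctor A B) t0 t1 :
  is_vst F G t0 t1 -> (forall x, t0 x ;v vid (pob G x) = t0 x) /\
                      (forall f, t1 f </> Idh (ph G f) = t1 f).
Proof. by move=> t; split=> *; rewrite -?(vst_tgt t) -?(vst_bot t) ?vcomp1r ?sqv1r. Qed.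

Lemma is_vst_A (A B : double_category) (F G H K : psfunctor A B) r0 r1 s0 s1 t0 t1 :
  is_vst F G r0 r1 -> is_vst G H s0 s1 -> is_vst H K t0 t1 ->
  (forall x, r0 x ;v s0 x ;v t0 x = r0 x ;v (s0 x ;v t0 x)) /\
  (forall f, r1 f </> s1 f </> t1 f = r1 f </> (s1 f </> t1 f)).
Proof.
move=> r s t; split=> *.
- by rewrite vcompA ?(vst_tgt r) ?(vst_src s) ?(vst_tgt s) ?(vst_src t).
- by rewrite sqvA ?(vst_bot r) ?(vst_top s) ?(vst_bot s) ?(vst_top t).
Qed.

Definition vst_id (A B : double_category) (F : psfunctor A B) : vst F F :=
  Vst (is_vst_id F).

Definition vst_vcomp (A B : double_category) (F G H : psfunctor A B)
  (s : vst F G) (t : vst G H) : vst F H := Vst (is_vst_comp (vst_ax s) (vst_ax t)).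

Lemma vst_eq (A B : double_category) (F G : psfunctor A B) (s t : vst F G) :
  (forall x, vst_ob s x = vst_ob t x) -> (forall f, vst_h s f = vst_h t f) -> s = t.
Proof.
case: s t => [s0 s1 s] [t0 t1 t] /= /functional_extensionality e0
  /functional_extensionality e1; subst; congr Vst; exact: proof_irrelevance.
Qed.

Definition Ps_vst (A B : double_category) : category.
Proof.
refine (@Category (psfunctor A B) (@vst A B) (@vst_id A B) (@vst_vcomp A B) _ _ _).
- move=> F G t; have [? ?] := is_vst_1l (vst_ax t); exact: vst_eq.
- move=> F G t; have [? ?] := is_vst_1r (vst_ax t); exact: vst_eq.
- move=> F G H K r s t.
  have [? ?] := is_vst_A (vst_ax r) (vst_ax s) (vst_ax t); exact: vst_eq.
Defined.

(* The structure making the families [F y = H(-, y)] and [G x = H(x, -)] of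
   pseudodouble functors a binary pseudodouble quasi-functor
   [H : A x B -> C] with trivial vertical-vertical cells.  The cells [H(K,k)],
   [H(K,u)] and [H(U,k)] are [qhh K k], [qhv K u] and [qvh U k]. *)
Record quasi2 (A B C : double_category)
    (F : ob B -> psfunctor A C) (G : ob A -> psfunctor B C) := Quasi2 {
  qhh : hcell A -> hcell B -> sq C;
  qhv : hcell A -> vcell B -> sq C;
  qvh : vcell A -> hcell B -> sq C;

  q_ob : forall x y, pob (F y) x = pob (G x) y;

  qhh_glob : forall K k,
    inv_globular (ph (G (hsrc K)) k ;h ph (F (htgt k)) K)
                 (ph (F (hsrc k)) K ;h ph (G (htgt K)) k) (qhh K k);
  qhv_top : forall K u, top (qhv K u) = ph (F (vsrc u)) K;
  qhv_bot : forall K u, bot (qhv K u) = ph (F (vtgt u)) K;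
  qhv_lft : forall K u, lft (qhv K u) = pv (G (hsrc K)) u;
  qhv_rgt : forall K u, rgt (qhv K u) = pv (G (htgt K)) u;
  qvh_top : forall U k, top (qvh U k) = ph (G (vsrc U)) k;
  qvh_bot : forall U k, bot (qvh U k) = ph (G (vtgt U)) k;
  qvh_lft : forall U k, lft (qvh U k) = pv (F (hsrc k)) U;
  qvh_rgt : forall U k, rgt (qvh U k) = pv (F (htgt k)) U;
  qvv : forall U u,
    pv (F (vsrc u)) U ;v pv (G (vtgt U)) u = pv (G (vsrc U)) u ;v pv (F (vtgt u)) U;

  qhh_hid_r : forall K y,
    punit (G (hsrc K)) y <|> Idh (ph (F y) K) </> qhh K (hid y)
    = Idh (ph (F y) K) <|> punit (G (htgt K)) y;
  qhh_hid_l : forall x k,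
    Idh (ph (G x) k) <|> punit (F (htgt k)) x </> qhh (hid x) k
    = punit (F (hsrc k)) x <|> Idh (ph (G x) k);
  qhv_hid : forall x u,
    punit (F (vsrc u)) x </> qhv (hid x) u = Idv (pv (G x) u) </> punit (F (vtgt u)) x;
  qvh_hid : forall U y,
    punit (G (vsrc U)) y </> qvh U (hid y) = Idv (pv (F y) U) </> punit (G (vtgt U)) y;
  qhv_vid : forall K y, qhv K (vid y) = Idh (ph (F y) K);
  qvh_vid : forall x k, qvh (vid x) k = Idh (ph (G x) k);

  qhh_hcomp_r : forall K k k' (e : htgt k = hsrc k'),
    Idh (ph (G (hsrc K)) k) <|> qhh K k'
      </> qhh K k <|> Idh (ph (G (htgt K)) k')
      </> Idh (ph (F (hsrc k)) K) <|> pcomp (G (htgt K)) e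
    = pcomp (G (hsrc K)) e <|> Idh (ph (F (htgt k')) K)
      </> qhh K (k ;h k');
  qhh_hcomp_l : forall K K' k (e : htgt K = hsrc K'),
    Idh (ph (G (hsrc K)) k) <|> pcomp (F (htgt k)) e
      </> qhh (K ;h K') k
    = qhh K k <|> Idh (ph (F (htgt k)) K')
      </> Idh (ph (F (hsrc k)) K) <|> qhh K' k
      </> pcomp (F (hsrc k)) e <|> Idh (ph (G (htgt K')) k);
  qhv_hcomp : forall K K' u (e : htgt K = hsrc K'),
    pcomp (F (vsrc u)) e </> qhv (K ;h K') u
    = qhv K u <|> qhv K' u </> pcomp (F (vtgt u)) e;
  qvh_hcomp : forall U k k' (e : htgt k = hsrc k'),
    pcomp (G (vsrc U)) e </> qvh U (k ;h k')
    = qvh U k <|> qvh U k' </> pcomp (G (vtgt U)) e;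
  qhv_vcomp : forall K u u', vtgt u = vsrc u' ->
    qhv K (u ;v u') = qhv K u </> qhv K u';
  qvh_vcomp : forall U U' k, vtgt U = vsrc U' ->
    qvh (U ;v U') k = qvh U k </> qvh U' k;

  qhh_sq_r : forall K (w : sq B),
    qhh K (top w) </> qhv K (lft w) <|> psq (G (htgt K)) w
    = psq (G (hsrc K)) w <|> qhv K (rgt w) </> qhh K (bot w);
  qhh_sq_l : forall (z : sq A) k,
    qhh (top z) k </> psq (F (hsrc k)) z <|> qvh (rgt z) k
    = qvh (lft z) k <|> psq (F (htgt k)) z </> qhh (bot z) k;
  qvh_sq : forall U (w : sq B),
    psq (G (vsrc U)) w </> qvh U (bot w) = qvh U (top w) </> psq (G (vtgt U)) w;
  qhv_sq : forall (z : sq A) u,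
    qhv (top z) u </> psq (F (vtgt u)) z = psq (F (vsrc u)) z </> qhv (bot z) u
}.

(* Compatibility of two families of one-variable transformations, with
   components [s K y] and [t x k] at 1h-cells, with the cells of two binary
   quasi-functors. *)
Record quasi2_vst (A B C : double_category)
    (F F' : ob B -> psfunctor A C) (G G' : ob A -> psfunctor B C)
    (H : quasi2 F G) (H' : quasi2 F' G')
    (s : hcell A -> ob B -> sq C) (t : ob A -> hcell B -> sq C) : Prop := Quasi2Vst {
  q2v_hh : forall K k,
    qhh H K k </> s K (hsrc k) <|> t (htgt K) k
    = t (hsrc K) k <|> s K (htgt k) </> qhh H' K k;
  q2v_hv : forall K u,
    qhv H K u </> s K (vtgt u) = s K (vsrc u) </> qhv H' K u;
  q2v_vh : forall U k,
    qvh H U k </> t (vtgt U) k = t (vsrc U) k </> qvh H' U k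
}.

Lemma quasi2_vst_id (A B C : double_category)
    (F : ob B -> psfunctor A C) (G : ob A -> psfunctor B C) (H : quasi2 F G) :
  quasi2_vst H H (fun K y => Idh (ph (F y) K)) (fun x k => Idh (ph (G x) k)).
Proof.
split.
- move=> K k; have [eqt eqb _ _ _] := qhh_glob H K k.
  rewrite -!sq_id1h_hcomp ?ph_src ?ph_tgt ?(q_ob H) //.
  by rewrite -{1}eqb -{1}eqt sqv1l sqv1r.
- by move=> K u; rewrite -(qhv_bot H) -(qhv_top H) sqv1l sqv1r.
- by move=> U k; rewrite -(qvh_bot H) -(qvh_top H) sqv1l sqv1r.
Qed.

Lemma quasi2_vst_comp (A B C : double_category)
    (F F' F'' : ob B -> psfunctor A C) (G G' G'' : ob A -> psfunctor B C)
    (H : quasi2 F G) (H' : quasi2 F' G') (H'' : quasi2 F'' G'')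
    (r0 r0' : ob A -> ob B -> vcell C) s t s' t' :
  (forall y, is_vst (F y) (F' y) (fun x => r0 x y) (fun K => s K y)) ->
  (forall x, is_vst (G x) (G' x) (fun y => r0 x y) (fun k => t x k)) ->
  (forall y, is_vst (F' y) (F'' y) (fun x => r0' x y) (fun K => s' K y)) ->
  (forall x, is_vst (G' x) (G'' x) (fun y => r0' x y) (fun k => t' x k)) ->
  quasi2_vst H H' s t -> quasi2_vst H' H'' s' t' ->
  quasi2_vst H H'' (fun K y => s K y </> s' K y) (fun x k => t x k </> t' x k).
Proof.
move=> vs vt vs' vt' [hh hv vh] [hh' hv' vh'].
have ts K y : top (s K y) = ph (F y) K by rewrite (vst_top (vs y)).
have ts' K y : top (s' K y) = ph (F' y) K by rewrite (vst_top (vs' y)).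
have bs K y : bot (s K y) = ph (F' y) K by rewrite (vst_bot (vs y)).
have bs' K y : bot (s' K y) = ph (F'' y) K by rewrite (vst_bot (vs' y)).
have tt x k : top (t x k) = ph (G x) k by rewrite (vst_top (vt x)).
have tt' x k : top (t' x k) = ph (G' x) k by rewrite (vst_top (vt' x)).
have bt x k : bot (t x k) = ph (G' x) k by rewrite (vst_bot (vt x)).
have bt' x k : bot (t' x k) = ph (G'' x) k by rewrite (vst_bot (vt' x)).
have st K k : rgt (s K (hsrc k)) = lft (t (htgt K) k)
  by rewrite (vst_rgt (vs _)) (vst_lft (vt _)).
have ts0 K k : rgt (t (hsrc K) k) = lft (s K (htgt k))
  by rewrite (vst_rgt (vt _)) (vst_lft (vs _)).
have st' K k : rgt (s' K (hsrc k)) = lft (t' (htgt K) k)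
  by rewrite (vst_rgt (vs' _)) (vst_lft (vt' _)).
have ts0' K k : rgt (t' (hsrc K) k) = lft (s' K (htgt k))
  by rewrite (vst_rgt (vt' _)) (vst_lft (vs' _)).
split.
- move=> K k.
  have [e1 e2 _ _ _] := qhh_glob H K k.
  have [e1' e2' _ _ _] := qhh_glob H' K k.
  have [e1'' e2'' _ _ _] := qhh_glob H'' K k.
  rewrite -!interchange ?st ?st' ?ts0 ?ts0' ?bs ?bs' ?bt ?bt' ?tt ?tt' ?ts ?ts' //.
  apply: (paste2 (b := qhh H' K k)) => //;
    rewrite ?(e1, e2, e1', e2', e1'', e2'') ?top_sqh ?bot_sqh ?st ?st' ?ts0 ?ts0' //;
    by rewrite ?bs ?bs' ?bt ?bt' ?tt ?tt' ?ts ?ts'.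
- move=> K u; apply: (paste2 (b := qhv H' K u)) => //;
    by rewrite ?qhv_top ?qhv_bot ?bs ?bs' ?ts ?ts'.
- move=> U k; apply: (paste2 (b := qvh H' U k)) => //;
    by rewrite ?qvh_top ?qvh_bot ?bt ?bt' ?tt ?tt'.
Qed.

(* With [F1 y z = H(-,y,z)], [F2 x z = H(x,-,z)], [F3 x y = H(x,y,-)], and
   binary quasi-functors [H12 z = H(-,-,z)], [H13 y = H(-,y,-)],
   [H23 x = H(x,-,-)]; these share their one-variable functors by typing. *)
Record quasi3_ax (A B C E : double_category)
    (F1 : ob B -> ob C -> psfunctor A E)
    (F2 : ob A -> ob C -> psfunctor B E)
    (F3 : ob A -> ob B -> psfunctor C E)
    (H12 : forall z, quasi2 (fun y => F1 y z) (fun x => F2 x z))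
    (H13 : forall y, quasi2 (fun z => F1 y z) (fun x => F3 x y))
    (H23 : forall x, quasi2 (fun z => F2 x z) (fun y => F3 x y)) : Prop := Quasi3Ax {
  q3_hhh : forall (f : hcell A) (g : hcell B) (h : hcell C),
    Idh (ph (F3 (hsrc f) (hsrc g)) h) <|> qhh (H12 (htgt h)) f g
      </> qhh (H13 (hsrc g)) f h <|> Idh (ph (F2 (htgt f) (htgt h)) g)
      </> Idh (ph (F1 (hsrc g) (hsrc h)) f) <|> qhh (H23 (htgt f)) g h
    = qhh (H23 (hsrc f)) g h <|> Idh (ph (F1 (htgt g) (htgt h)) f)
      </> Idh (ph (F2 (hsrc f) (hsrc h)) g) <|> qhh (H13 (htgt g)) f h
      </> qhh (H12 (hsrc h)) f g <|> Idh (ph (F3 (htgt f) (htgt g)) h);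
  q3_hvh : forall (f : hcell A) (v : vcell B) (h : hcell C),
    qhh (H13 (vsrc v)) f h </> qhv (H12 (hsrc h)) f v <|> qvh (H23 (htgt f)) v h
    = qvh (H23 (hsrc f)) v h <|> qhv (H12 (htgt h)) f v </> qhh (H13 (vtgt v)) f h;
  q3_hhv : forall (f : hcell A) (g : hcell B) (w : vcell C),
    qhh (H12 (vsrc w)) f g </> qhv (H13 (hsrc g)) f w <|> qhv (H23 (htgt f)) g w
    = qhv (H23 (hsrc f)) g w <|> qhv (H13 (htgt g)) f w </> qhh (H12 (vtgt w)) f g;
  q3_vhh : forall (u : vcell A) (g : hcell B) (h : hcell C),
    qhh (H23 (vsrc u)) g h </> qvh (H12 (hsrc h)) u g <|> qvh (H13 (htgt g)) u h
    = qvh (H13 (hsrc g)) u h <|> qvh (H12 (htgt h)) u g </> qhh (H23 (vtgt u)) g h;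
  q3_vvh : forall (u : vcell A) (v : vcell B) (h : hcell C),
    qvh (H13 (vsrc v)) u h </> qvh (H23 (vtgt u)) v h
    = qvh (H23 (vsrc u)) v h </> qvh (H13 (vtgt v)) u h;
  q3_vhv : forall (u : vcell A) (g : hcell B) (w : vcell C),
    qvh (H12 (vsrc w)) u g </> qhv (H23 (vtgt u)) g w
    = qhv (H23 (vsrc u)) g w </> qvh (H12 (vtgt w)) u g;
  q3_hvv : forall (f : hcell A) (v : vcell B) (w : vcell C),
    qhv (H12 (vsrc w)) f v </> qhv (H13 (vtgt v)) f w
    = qhv (H13 (vsrc v)) f w </> qhv (H12 (vtgt w)) f v
}.

Record quasi3 (A B C E : double_category) := Quasi3 {
  tern1 : ob B -> ob C -> psfunctor A E;
  tern2 : ob A -> ob C -> psfunctor B E;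
  tern3 : ob A -> ob B -> psfunctor C E;
  tern12 : forall z, quasi2 (fun y => tern1 y z) (fun x => tern2 x z);
  tern13 : forall y, quasi2 (fun z => tern1 y z) (fun x => tern3 x y);
  tern23 : forall x, quasi2 (fun z => tern2 x z) (fun y => tern3 x y);
  tern123 : quasi3_ax tern12 tern13 tern23
}.

Record is_quasi3_vst (A B C E : double_category) (H H' : quasi3 A B C E)
    (r0 : ob A -> ob B -> ob C -> vcell E)
    (r1 : hcell A -> ob B -> ob C -> sq E)
    (r2 : ob A -> hcell B -> ob C -> sq E)
    (r3 : ob A -> ob B -> hcell C -> sq E) : Prop := IsQuasi3Vst {
  q3v_1 : forall y z,
    is_vst (tern1 H y z) (tern1 H' y z) (fun x => r0 x y z) (fun f => r1 f y z);
  q3v_2 : forall x z,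
    is_vst (tern2 H x z) (tern2 H' x z) (fun y => r0 x y z) (fun g => r2 x g z);
  q3v_3 : forall x y,
    is_vst (tern3 H x y) (tern3 H' x y) (fun z => r0 x y z) (fun h => r3 x y h);
  q3v_12 : forall z,
    quasi2_vst (tern12 H z) (tern12 H' z) (fun f y => r1 f y z) (fun x g => r2 x g z);
  q3v_13 : forall y,
    quasi2_vst (tern13 H y) (tern13 H' y) (fun f z => r1 f y z) (fun x h => r3 x y h);
  q3v_23 : forall x,
    quasi2_vst (tern23 H x) (tern23 H' x) (fun g z => r2 x g z) (fun y h => r3 x y h)
}.

Record quasi3_vst (A B C E : double_category) (H H' : quasi3 A B C E) := Quasi3Vst {
  q3v_ob : ob A -> ob B -> ob C -> vcell E;
  q3v_h1 : hcell A -> ob B -> ob C -> sq E;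
  q3v_h2 : ob A -> hcell B -> ob C -> sq E;
  q3v_h3 : ob A -> ob B -> hcell C -> sq E;
  q3v_ax : is_quasi3_vst H H' q3v_ob q3v_h1 q3v_h2 q3v_h3
}.

Lemma funext2 (S T R : Type) (f g : S -> T -> R) :
  (forall x y, f x y = g x y) -> f = g.
Proof. by move=> e; do 2 apply: functional_extensionality => ?. Qed.

Lemma funext3 (S T U R : Type) (f g : S -> T -> U -> R) :
  (forall x y z, f x y z = g x y z) -> f = g.
Proof. by move=> e; do 3 apply: functional_extensionality => ?. Qed.

Lemma funext4 (S T U V R : Type) (f g : S -> T -> U -> V -> R) :
  (forall x y z w, f x y z w = g x y z w) -> f = g.
Proof. by move=> e; do 4 apply: functional_extensionality => ?. Qed.

Lemma quasi3_vst_eq (A B C E : double_category) (H H' : quasi3 A B C E)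
    (s t : quasi3_vst H H') :
  (forall x y z, q3v_ob s x y z = q3v_ob t x y z) ->
  (forall x y z, q3v_h1 s x y z = q3v_h1 t x y z) ->
  (forall x y z, q3v_h2 s x y z = q3v_h2 t x y z) ->
  (forall x y z, q3v_h3 s x y z = q3v_h3 t x y z) -> s = t.
Proof.
case: s t => [s0 s1 s2 s3 s] [r0 r1 r2 r3 r] /=
  /funext3 e0 /funext3 e1 /funext3 e2 /funext3 e3; subst.
congr Quasi3Vst; exact: proof_irrelevance.
Qed.

Definition quasi3_vst_id (A B C E : double_category) (H : quasi3 A B C E) :
  quasi3_vst H H.
Proof.
refine (@Quasi3Vst A B C E H H (fun x y z => vid (pob (tern1 H y z) x))
  (fun f y z => Idh (ph (tern1 H y z) f)) (fun x g z => Idh (ph (tern2 H x z) g))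
  (fun x y h => Idh (ph (tern3 H x y) h)) _).
split; intros; try exact: is_vst_id; try exact: quasi2_vst_id.
- have -> : (fun y => vid (pob (tern1 H y z) x)) = fun y => vid (pob (tern2 H x z) y).
    by apply: functional_extensionality => y; rewrite (q_ob (tern12 H z)).
  exact: is_vst_id.
- have -> : (fun z => vid (pob (tern1 H y z) x)) = fun z => vid (pob (tern3 H x y) z).
    by apply: functional_extensionality => z; rewrite (q_ob (tern13 H y)).
  exact: is_vst_id.
Defined.

Definition quasi3_vst_vcomp (A B C E : double_category) (H H' H'' : quasi3 A B C E)
  (s : quasi3_vst H H') (t : quasi3_vst H' H'') : quasi3_vst H H''.
Proof.
refine (@Quasi3Vst A B C E H H'' (fun x y z => q3v_ob s x y z ;v q3v_ob t x y z)
  (fun f y z => q3v_h1 s f y z </> q3v_h1 t f y z)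
  (fun x g z => q3v_h2 s x g z </> q3v_h2 t x g z)
  (fun x y h => q3v_h3 s x y h </> q3v_h3 t x y h) _).
case: (q3v_ax s) (q3v_ax t) => s1 s2 s3 s12 s13 s23 [r1 r2 r3 r12 r13 r23].
split=> *.
- exact: is_vst_comp (s1 _ _) (r1 _ _).
- exact: is_vst_comp (s2 _ _) (r2 _ _).
- exact: is_vst_comp (s3 _ _) (r3 _ _).
- exact: quasi2_vst_comp (fun a => s1 a _) (fun a => s2 a _) (fun a => r1 a _) (fun a => r2 a _) (s12 _) (r12 _).
- exact: quasi2_vst_comp (s1 _) (fun a => s3 a _) (r1 _) (fun a => r3 a _) (s13 _) (r13 _).
- exact: quasi2_vst_comp (s2 _) (s3 _) (r2 _) (r3 _) (s23 _) (r23 _).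
Defined.

Definition q3Ps (A B C E : double_category) : category.
Proof.
refine (@Category (quasi3 A B C E) (@quasi3_vst A B C E) (@quasi3_vst_id A B C E)
          (@quasi3_vst_vcomp A B C E) _ _ _).
- move=> H H' t; case: (q3v_ax t) => r1 r2 r3 _ _ _; apply: quasi3_vst_eq => x y z /=.
  + by case: (is_vst_1l (r1 y z)).
  + by case: (is_vst_1l (r1 y z)).
  + by case: (is_vst_1l (r2 x z)).
  + by case: (is_vst_1l (r3 x y)).
- move=> H H' t; case: (q3v_ax t) => r1 r2 r3 _ _ _; apply: quasi3_vst_eq => x y z /=.
  + by case: (is_vst_1r (r1 y z)).
  + by case: (is_vst_1r (r1 y z)).
  + by case: (is_vst_1r (r2 x z)).
  + by case: (is_vst_1r (r3 x y)).
- move=> H H' H'' H''' p q r.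
  case: (q3v_ax p) (q3v_ax q) (q3v_ax r) => p1 p2 p3 _ _ _ [q1 q2 q3 _ _ _]
    [r1 r2 r3 _ _ _]; apply: quasi3_vst_eq => x y z /=.
  + by case: (is_vst_A (p1 y z) (q1 y z) (r1 y z)).
  + by case: (is_vst_A (p1 y z) (q1 y z) (r1 y z)).
  + by case: (is_vst_A (p2 x z) (q2 x z) (r2 x z)).
  + by case: (is_vst_A (p3 x y) (q3 x y) (r3 x y)).
Defined.

Record quasi4 (A B C D E : double_category) := Quasi4 {
  quat1 : ob B -> ob C -> ob D -> psfunctor A E;
  quat2 : ob A -> ob C -> ob D -> psfunctor B E;
  quat3 : ob A -> ob B -> ob D -> psfunctor C E;
  quat4 : ob A -> ob B -> ob C -> psfunctor D E;
  quat12 : forall z w, quasi2 (fun y => quat1 y z w) (fun x => quat2 x z w);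
  quat13 : forall y w, quasi2 (fun z => quat1 y z w) (fun x => quat3 x y w);
  quat14 : forall y z, quasi2 (fun w => quat1 y z w) (fun x => quat4 x y z);
  quat23 : forall x w, quasi2 (fun z => quat2 x z w) (fun y => quat3 x y w);
  quat24 : forall x z, quasi2 (fun w => quat2 x z w) (fun y => quat4 x y z);
  quat34 : forall x y, quasi2 (fun w => quat3 x y w) (fun z => quat4 x y z);
  quat123 : forall w, quasi3_ax (fun z => quat12 z w) (fun y => quat13 y w) (fun x => quat23 x w);
  quat124 : forall z, quasi3_ax (fun w => quat12 z w) (fun y => quat14 y z) (fun x => quat24 x z);
  quat134 : forall y, quasi3_ax (fun w => quat13 y w) (fun z => quat14 y z) (fun x => quat34 x y);
  quat234 : forall x, quasi3_ax (fun w => quat23 x w) (fun z => quat24 x z) (fun y => quat34 x y)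
}.

Definition quasi4_fix4 (A B C D E : double_category) (H : quasi4 A B C D E) (w : ob D) :
  quasi3 A B C E := Quasi3 (quat123 H w).
Definition quasi4_fix3 (A B C D E : double_category) (H : quasi4 A B C D E) (z : ob C) :
  quasi3 A B D E := Quasi3 (quat124 H z).
Definition quasi4_fix2 (A B C D E : double_category) (H : quasi4 A B C D E) (y : ob B) :
  quasi3 A C D E := Quasi3 (quat134 H y).
Definition quasi4_fix1 (A B C D E : double_category) (H : quasi4 A B C D E) (x : ob A) :
  quasi3 B C D E := Quasi3 (quat234 H x).

Record is_quasi4_vst (A B C D E : double_category) (H H' : quasi4 A B C D E)
    (r0 : ob A -> ob B -> ob C -> ob D -> vcell E)
    (r1 : hcell A -> ob B -> ob C -> ob D -> sq E)
    (r2 : ob A -> hcell B -> ob C -> ob D -> sq E)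
    (r3 : ob A -> ob B -> hcell C -> ob D -> sq E)
    (r4 : ob A -> ob B -> ob C -> hcell D -> sq E) : Prop := IsQuasi4Vst {
  q4v_123 : forall w, is_quasi3_vst (quasi4_fix4 H w) (quasi4_fix4 H' w)
    (fun x y z => r0 x y z w)
    (fun f y z => r1 f y z w) (fun x g z => r2 x g z w) (fun x y h => r3 x y h w);
  q4v_124 : forall z, is_quasi3_vst (quasi4_fix3 H z) (quasi4_fix3 H' z)
    (fun x y w => r0 x y z w)
    (fun f y w => r1 f y z w) (fun x g w => r2 x g z w) (fun x y k => r4 x y z k);
  q4v_134 : forall y, is_quasi3_vst (quasi4_fix2 H y) (quasi4_fix2 H' y)
    (fun x z w => r0 x y z w)
    (fun f z w => r1 f y z w) (fun x h w => r3 x y h w) (fun x z k => r4 x y z k);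
  q4v_234 : forall x, is_quasi3_vst (quasi4_fix1 H x) (quasi4_fix1 H' x)
    (fun y z w => r0 x y z w)
    (fun g z w => r2 x g z w) (fun y h w => r3 x y h w) (fun y z k => r4 x y z k)
}.

Record quasi4_vst (A B C D E : double_category) (H H' : quasi4 A B C D E) := Quasi4Vst {
  q4v_ob : ob A -> ob B -> ob C -> ob D -> vcell E;
  q4v_h1 : hcell A -> ob B -> ob C -> ob D -> sq E;
  q4v_h2 : ob A -> hcell B -> ob C -> ob D -> sq E;
  q4v_h3 : ob A -> ob B -> hcell C -> ob D -> sq E;
  q4v_h4 : ob A -> ob B -> ob C -> hcell D -> sq E;
  q4v_ax : is_quasi4_vst H H' q4v_ob q4v_h1 q4v_h2 q4v_h3 q4v_h4
}.

Lemma quasi4_vst_eq (A B C D E : double_category) (H H' : quasi4 A B C D E)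
    (s t : quasi4_vst H H') :
  (forall x y z w, q4v_ob s x y z w = q4v_ob t x y z w) ->
  (forall x y z w, q4v_h1 s x y z w = q4v_h1 t x y z w) ->
  (forall x y z w, q4v_h2 s x y z w = q4v_h2 t x y z w) ->
  (forall x y z w, q4v_h3 s x y z w = q4v_h3 t x y z w) ->
  (forall x y z w, q4v_h4 s x y z w = q4v_h4 t x y z w) -> s = t.
Proof.
case: s t => [s0 s1 s2 s3 s4 s] [r0 r1 r2 r3 r4 r] /=
  /funext4 e0 /funext4 e1 /funext4 e2 /funext4 e3 /funext4 e4; subst.
congr Quasi4Vst; exact: proof_irrelevance.
Qed.

Definition quasi4_vst_id (A B C D E : double_category) (H : quasi4 A B C D E) :
  quasi4_vst H H.
Proof.
refine (@Quasi4Vst A B C D E H H (fun x y z w => vid (pob (quat1 H y z w) x))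
  (fun f y z w => Idh (ph (quat1 H y z w) f)) (fun x g z w => Idh (ph (quat2 H x z w) g))
  (fun x y h w => Idh (ph (quat3 H x y w) h)) (fun x y z k => Idh (ph (quat4 H x y z) k)) _).
split; intros.
- exact: q3v_ax (quasi3_vst_id (quasi4_fix4 H w)).
- exact: q3v_ax (quasi3_vst_id (quasi4_fix3 H z)).
- exact: q3v_ax (quasi3_vst_id (quasi4_fix2 H y)).
- have -> : (fun y z w => vid (pob (quat1 H y z w) x))
            = fun y z w => vid (pob (quat2 H x z w) y).
    by apply: funext3 => y z w; rewrite (q_ob (quat12 H z w)).
  exact: q3v_ax (quasi3_vst_id (quasi4_fix1 H x)).
Defined.

Definition quasi4_vst_vcomp (A B C D E : double_category) (H H' H'' : quasi4 A B C D E)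
  (s : quasi4_vst H H') (t : quasi4_vst H' H'') : quasi4_vst H H''.
Proof.
refine (@Quasi4Vst A B C D E H H''
  (fun x y z w => q4v_ob s x y z w ;v q4v_ob t x y z w)
  (fun f y z w => q4v_h1 s f y z w </> q4v_h1 t f y z w)
  (fun x g z w => q4v_h2 s x g z w </> q4v_h2 t x g z w)
  (fun x y h w => q4v_h3 s x y h w </> q4v_h3 t x y h w)
  (fun x y z k => q4v_h4 s x y z k </> q4v_h4 t x y z k) _).
case: (q4v_ax s) (q4v_ax t) => s1 s2 s3 s4 [r1 r2 r3 r4].
split; intros.
- exact: q3v_ax (quasi3_vst_vcomp (Quasi3Vst (s1 w)) (Quasi3Vst (r1 w))).
- exact: q3v_ax (quasi3_vst_vcomp (Quasi3Vst (s2 z)) (Quasi3Vst (r2 z))).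
- exact: q3v_ax (quasi3_vst_vcomp (Quasi3Vst (s3 y)) (Quasi3Vst (r3 y))).
- exact: q3v_ax (quasi3_vst_vcomp (Quasi3Vst (s4 x)) (Quasi3Vst (r4 x))).
Defined.

Definition q4Ps (A B C D E : double_category) : category.
Proof.
refine (@Category (quasi4 A B C D E) (@quasi4_vst A B C D E) (@quasi4_vst_id A B C D E)
          (@quasi4_vst_vcomp A B C D E) _ _ _).
- move=> H H' t; case: (q4v_ax t) => r1 r2 _ _; apply: quasi4_vst_eq => x y z w /=.
  + by case: (is_vst_1l (q3v_1 (r1 w) y z)) => h _; exact: h.
  + by case: (is_vst_1l (q3v_1 (r1 w) y z)) => _ h; exact: h.
  + by case: (is_vst_1l (q3v_2 (r1 w) x z)) => _ h; exact: h.
  + by case: (is_vst_1l (q3v_3 (r1 w) x y)) => _ h; exact: h.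
  + by case: (is_vst_1l (q3v_3 (r2 z) x y)) => _ h; exact: h.
- move=> H H' t; case: (q4v_ax t) => r1 r2 _ _; apply: quasi4_vst_eq => x y z w /=.
  + by case: (is_vst_1r (q3v_1 (r1 w) y z)) => h _; exact: h.
  + by case: (is_vst_1r (q3v_1 (r1 w) y z)) => _ h; exact: h.
  + by case: (is_vst_1r (q3v_2 (r1 w) x z)) => _ h; exact: h.
  + by case: (is_vst_1r (q3v_3 (r1 w) x y)) => _ h; exact: h.
  + by case: (is_vst_1r (q3v_3 (r2 z) x y)) => _ h; exact: h.
- move=> H H' H'' H''' p q r.
  case: (q4v_ax p) (q4v_ax q) (q4v_ax r) => p1 p2 _ _ [q1 q2 _ _] [r1 r2 _ _].
  apply: quasi4_vst_eq => x y z w /=.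
  + case: (is_vst_A (q3v_1 (p1 w) y z) (q3v_1 (q1 w) y z) (q3v_1 (r1 w) y z)) => h _.
    exact: h.
  + case: (is_vst_A (q3v_1 (p1 w) y z) (q3v_1 (q1 w) y z) (q3v_1 (r1 w) y z)) => _ h.
    exact: h.
  + case: (is_vst_A (q3v_2 (p1 w) x z) (q3v_2 (q1 w) x z) (q3v_2 (r1 w) x z)) => _ h.
    exact: h.
  + case: (is_vst_A (q3v_3 (p1 w) x y) (q3v_3 (q1 w) x y) (q3v_3 (r1 w) x y)) => _ h.
    exact: h.
  + case: (is_vst_A (q3v_3 (p2 z) x y) (q3v_3 (q2 z) x y) (q3v_3 (r2 z) x y)) => _ h.
    exact: h.
Defined.

(* Main.v *)
(* A binary quasi-functor H glues to a pseudofunctor P on the product: P(f,g) = H(f,y) H(x',g) for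
   f : x -> x' and g : y -> y', and its compositors are those of H pasted with the interchange
   cells H(f,g).  A ternary quasi-functor on A, B, C becomes a binary one on A x B, C once its
   first two slots are glued, and a quaternary one on A, B, C, D becomes ternary on A x B, C, D;
   this gives the two functors.

   They are full and faithful because H(f,y) and H(x,g) are isomorphic to P(f,1) and P(1,g)
   through unitors: a transformation of glued functors restricts to the slots along these
   isomorphisms, and the multiplicativity of its components recovers it from the restrictions.

   They are essentially surjective because the inclusions of the slots into the product form a
   strict quasi-functor.  Composing it with a pseudofunctor P, with interchange cells obtained by
   conjugating identities by compositors, gives a quasi-functor whose gluing is isomorphic to P
   via iterated compositors. *)

From mathcomp Require Import ssreflect.
From Stdlib Require Import ProofIrrelevance FunctionalExtensionality ClassicalEpsilon List.
Import ListNotations.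
Require Import Defs.

Set Implicit Arguments.
Unset Strict Implicit.
Unset Printing Implicit Defensive.
Local Open Scope dbl_scope.

(** Two obstacles shape the proof. Composability of squares is an equation, so each use of
    interchange or associativity carries side conditions; these are discharged by computing the
    boundary of a pasting recursively ([typ], [beq], [bd]). The second obstacle is coherence: the
    axioms of the restricted quasi-functor, and of its comparison with P, are equations between
    large pastings of compositors of P. They are not treated one by one. A square of E between
    composites of values of P is said to lie over a square of the product if iterated compositors
    identify it with the image of that square. This relation is closed under both compositions,
    compositors lie over identities, and a square is determined by the one underneath. Each equation
    thus descends to the product, where the slot inclusions are strict and the interchange cells are
    identities. Fullness and faithfulness in four variables come from composing two functors;
    essential surjectivity does not, and is shown directly from the restriction to four slots. *)

(** * Boundaries of pastings and their computation *)

Section Boundaries.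
Variable D : double_category.
Implicit Types (f g h : hcell D) (u v w : vcell D) (a b c d : sq D).

(** The four sides are bundled so that one pass over a pasting computes them all, at the price of
    one matching condition per composition. *)
Definition boundary a f g u v := top a = f /\ bot a = g /\ lft a = u /\ rgt a = v.

Lemma boundary_self a : boundary a (top a) (bot a) (lft a) (rgt a).
Proof. by []. Qed.

Lemma boundary_idh f : boundary (Idh f) f f (vid (hsrc f)) (vid (htgt f)).
Proof. by split; rewrite ?top_id1h ?bot_id1h ?lft_id1h ?rgt_id1h. Qed.

Lemma boundary_idv u : boundary (Idv u) (hid (vsrc u)) (hid (vtgt u)) u u.
Proof. by split; rewrite ?top_id1v ?bot_id1v ?lft_id1v ?rgt_id1v. Qed.

Lemma boundary_h a b f g u v f' g' v' w : boundary a f g u v -> boundary b f' g' v' w -> v = v' ->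
  boundary (a <|> b) (f ;h f') (g ;h g') u w.
Proof. by move=> [? [? [? ?]]] [? [? [? ?]]] ?; split; rewrite ?top_sqh ?bot_sqh ?lft_sqh ?rgt_sqh;
  subst. Qed.

Lemma boundary_v a b f g u v g' h u' v' : boundary a f g u v -> boundary b g' h u' v' -> g = g' ->
  boundary (a </> b) f h (u ;v u') (v ;v v').
Proof. by move=> [? [? [? ?]]] [? [? [? ?]]] ?; split; rewrite ?top_sqv ?bot_sqv ?lft_sqv ?rgt_sqv;
  subst. Qed.

Lemma boundary_conv a f g u v f' g' u' v' : boundary a f g u v -> f = f' -> g = g' -> u = u' -> v =
  v' ->
  boundary a f' g' u' v'.
Proof. by move=> ? <- <- <- <-. Qed.

Lemma boundary_ig a f g : inv_globular f g a -> boundary a f g (vid (hsrc f)) (vid (htgt f)).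
Proof. by case. Qed.

Lemma boundary_bt a b f g u v f' g' u' v' : boundary a f g u v -> boundary b f' g' u' v' -> g =
  f' -> bot a = top b.
Proof. by move=> [? [-> ?]] [-> ?]. Qed.
Lemma boundary_rl a b f g u v f' g' u' v' : boundary a f g u v -> boundary b f' g' u' v' -> v =
  u' -> rgt a = lft b.
Proof. by move=> [? [? [? ->]]] [? [? [-> ?]]]. Qed.
Lemma boundary_top a f g u v f' : boundary a f g u v -> f = f' -> top a = f'.
Proof. by move=> [-> ?] ->. Qed.
Lemma boundary_bot a f g u v f' : boundary a f g u v -> g = f' -> bot a = f'.
Proof. by move=> [? [-> ?]] ->. Qed.
Lemma boundary_lft a f g u v u' : boundary a f g u v -> u = u' -> lft a = u'.
Proof. by move=> [? [? [-> ?]]] ->. Qed.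
Lemma boundary_rgt a f g u v u' : boundary a f g u v -> v = u' -> rgt a = u'.
Proof. by move=> [? [? [? ->]]] ->. Qed.

Lemma hid_compl x f : x = hsrc f -> hid x ;h f = f.
Proof. by move=> ->; rewrite hcomp1l. Qed.
Lemma hid_compr x f : htgt f = x -> f ;h hid x = f.
Proof. by move=> <-; rewrite hcomp1r. Qed.
Lemma vid_compl x u : x = vsrc u -> vid x ;v u = u.
Proof. by move=> ->; rewrite vcomp1l. Qed.
Lemma vid_compr x u : vtgt u = x -> u ;v vid x = u.
Proof. by move=> <-; rewrite vcomp1r. Qed.

Lemma idh_sqv f a : f = top a -> Idh f </> a = a.
Proof. by move=> ->; rewrite sqv1l. Qed.
Lemma sqv_idh f a : bot a = f -> a </> Idh f = a.
Proof. by move=> <-; rewrite sqv1r. Qed.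
Lemma idv_sqh u a : u = lft a -> Idv u <|> a = a.
Proof. by move=> ->; rewrite sqh1l. Qed.
Lemma sqh_idv u a : rgt a = u -> a <|> Idv u = a.
Proof. by move=> <-; rewrite sqh1r. Qed.

Lemma interchange3 a b c a' b' c' :
  rgt a = lft b -> rgt b = lft c -> rgt a' = lft b' -> rgt b' = lft c' ->
  bot a = top a' -> bot b = top b' -> bot c = top c' ->
  a <|> b <|> c </> (a' <|> b' <|> c') = (a </> a') <|> (b </> b') <|> (c </> c').
Proof.
by move=> *; rewrite interchange ?rgt_sqh ?bot_sqh ?top_sqh ?interchange //; congruence.
Qed.
End Boundaries.

Lemma boundary_pcomp (A B : double_category) (F : psfunctor A B) f g (e : htgt f = hsrc g) :
  boundary (pcomp F e) (ph F f ;h ph F g) (ph F (f ;h g)) (vid (pob F (hsrc f)))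
    (vid (pob F (htgt g))).
Proof.
by eapply boundary_conv; [apply: boundary_ig (pcomp_glob F e) | | | |];
  rewrite ?hsrc_hcomp ?htgt_hcomp ?ph_src ?ph_tgt ?e.
Qed.
Lemma boundary_punit (A B : double_category) (F : psfunctor A B) x :
  boundary (punit F x) (hid (pob F x)) (ph F (hid x)) (vid (pob F x)) (vid (pob F x)).
Proof.
by eapply boundary_conv; [apply: boundary_ig (punit_glob F x) | | | |];
  rewrite ?hsrc_hid ?htgt_hid.
Qed.
Lemma boundary_psq (A B : double_category) (F : psfunctor A B) a :
  boundary (psq F a) (ph F (top a)) (ph F (bot a)) (pv F (lft a)) (pv F (rgt a)).
Proof. by split; rewrite ?psq_top ?psq_bot ?psq_lft ?psq_rgt. Qed.

Lemma boundary_qhh (A B C : double_category) (F : ob B -> psfunctor A C) (G : ob A -> psfunctor B C)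
  (H : quasi2 F G) K k :
  boundary (qhh H K k) (ph (G (hsrc K)) k ;h ph (F (htgt k)) K) (ph (F (hsrc k)) K ;h
    ph (G (htgt K)) k)
    (vid (pob (G (hsrc K)) (hsrc k))) (vid (pob (G (htgt K)) (htgt k))).
Proof.
by eapply boundary_conv; [apply: boundary_ig (qhh_glob H K k) | | | |];
  rewrite ?hsrc_hcomp ?htgt_hcomp ?ph_src ?ph_tgt ?(q_ob H).
Qed.
Lemma boundary_qhv (A B C : double_category) (F : ob B -> psfunctor A C) (G : ob A -> psfunctor B C)
  (H : quasi2 F G) K k :
  boundary (qhv H K k) (ph (F (vsrc k)) K) (ph (F (vtgt k)) K) (pv (G (hsrc K)) k) (pv (G (htgt K))
    k).
Proof. by split; rewrite ?qhv_top ?qhv_bot ?qhv_lft ?qhv_rgt. Qed.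
Lemma boundary_qvh (A B C : double_category) (F : ob B -> psfunctor A C) (G : ob A -> psfunctor B C)
  (H : quasi2 F G) K k :
  boundary (qvh H K k) (ph (G (vsrc K)) k) (ph (G (vtgt K)) k) (pv (F (hsrc k)) K) (pv (F (htgt k))
    K).
Proof. by split; rewrite ?qvh_top ?qvh_bot ?qvh_lft ?qvh_rgt. Qed.

(* [ob_step], [typ_atom] and [ov_atom] are hooks: each section redefines them for its own cells. *)
Ltac ob_step := fail.
(** The guard stops a hypothesis whose right side contains its left side from being rewritten
    forever. *)
Ltac hyp_rewrite H x y := lazymatch y with context [x] => fail | _ => rewrite H end.
Ltac hyps :=
  match goal with
  | H : ?x = hsrc ?y |- context [?x] => hyp_rewrite H x y
  | H : ?x = vsrc ?y |- context [?x] => hyp_rewrite H x y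
  | H : ?x = lft ?y |- context [?x] => hyp_rewrite H x y
  | H : ?x = top ?y |- context [?x] => hyp_rewrite H x y
  | H : hsrc ?x = ?y |- context [hsrc ?x] => is_var y; rewrite H
  | H : htgt ?x = ?y |- context [htgt ?x] => is_var y; rewrite H
  end.
(** The normal form has sources and targets pushed down to objects, units removed and compositions
    bracketed to the right. These laws are conditional, so [side] calls the normalisation
    recursively to prove composability. *)
Ltac nstep side := match goal with
 | |- context [hsrc (ph _ _)] => rewrite ph_src
 | |- context [htgt (ph _ _)] => rewrite ph_tgt
 | |- context [vsrc (pv _ _)] => rewrite pv_src
 | |- context [vtgt (pv _ _)] => rewrite pv_tgt
 | |- context [hsrc (hid _)] => rewrite hsrc_hid
 | |- context [htgt (hid _)] => rewrite htgt_hid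
 | |- context [vsrc (vid _)] => rewrite vsrc_vid
 | |- context [vtgt (vid _)] => rewrite vtgt_vid
 | |- context [hsrc (top _)] => rewrite hsrc_top
 | |- context [htgt (top _)] => rewrite htgt_top
 | |- context [hsrc (bot _)] => rewrite hsrc_bot
 | |- context [htgt (bot _)] => rewrite htgt_bot
 | |- context [top (Idh _)] => rewrite top_id1h
 | |- context [bot (Idh _)] => rewrite bot_id1h
 | |- context [lft (Idh _)] => rewrite lft_id1h
 | |- context [rgt (Idh _)] => rewrite rgt_id1h
 | |- context [top (Idv _)] => rewrite top_id1v
 | |- context [bot (Idv _)] => rewrite bot_id1v
 | |- context [lft (Idv _)] => rewrite lft_id1v
 | |- context [rgt (Idv _)] => rewrite rgt_id1v
 | |- context [top (qhv _ _ _)] => rewrite qhv_top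
 | |- context [bot (qhv _ _ _)] => rewrite qhv_bot
 | |- context [lft (qhv _ _ _)] => rewrite qhv_lft
 | |- context [rgt (qhv _ _ _)] => rewrite qhv_rgt
 | |- context [top (qvh _ _ _)] => rewrite qvh_top
 | |- context [bot (qvh _ _ _)] => rewrite qvh_bot
 | |- context [lft (qvh _ _ _)] => rewrite qvh_lft
 | |- context [rgt (qvh _ _ _)] => rewrite qvh_rgt
 | |- context [top (psq _ _)] => rewrite psq_top
 | |- context [bot (psq _ _)] => rewrite psq_bot
 | |- context [lft (psq _ _)] => rewrite psq_lft
 | |- context [rgt (psq _ _)] => rewrite psq_rgt
 | |- context [pv _ (vid _)] => rewrite pv_vid
 | |- context [hsrc (?f ;h ?g)] => rewrite (@hsrc_hcomp _ f g); [|side]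
 | |- context [htgt (?f ;h ?g)] => rewrite (@htgt_hcomp _ f g); [|side]
 | |- context [vsrc (?f ;v ?g)] => rewrite (@vsrc_vcomp _ f g); [|side]
 | |- context [vtgt (?f ;v ?g)] => rewrite (@vtgt_vcomp _ f g); [|side]
 | |- context [hid ?x ;h ?g] => rewrite (@hid_compl _ x g); [|side]
 | |- context [?g ;h hid ?x] => rewrite (@hid_compr _ x g); [|side]
 | |- context [vid ?x ;v ?g] => rewrite (@vid_compl _ x g); [|side]
 | |- context [?g ;v vid ?x] => rewrite (@vid_compr _ x g); [|side]
 | |- context [?f ;h ?g ;h ?h] => rewrite (@hcompA _ f g h); [|side|side]
 | |- context [?f ;v ?g ;v ?h] => rewrite (@vcompA _ f g h); [|side|side]
 | |- context [top (?a </> ?b)] => rewrite (@top_sqv _ a b); [|side]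
 | |- context [bot (?a </> ?b)] => rewrite (@bot_sqv _ a b); [|side]
 | |- context [lft (?a </> ?b)] => rewrite (@lft_sqv _ a b); [|side]
 | |- context [rgt (?a </> ?b)] => rewrite (@rgt_sqv _ a b); [|side]
 | |- context [top (?a <|> ?b)] => rewrite (@top_sqh _ a b); [|side]
 | |- context [bot (?a <|> ?b)] => rewrite (@bot_sqh _ a b); [|side]
 | |- context [lft (?a <|> ?b)] => rewrite (@lft_sqh _ a b); [|side]
 | |- context [rgt (?a <|> ?b)] => rewrite (@rgt_sqh _ a b); [|side]
 | _ => hyps
 | _ => ob_step
 end.
Ltac nrm := repeat nstep ltac:(solve [nrm; reflexivity]).
Ltac beq := first [reflexivity | solve [nrm; done]].
Ltac typ_atom := fail.
(** Recursion on the shape of the pasting: atoms have known boundaries, and each composition leaves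
    a single equation between adjacent sides to [beq]. *)
Ltac typ := first [eassumption | lazymatch goal with
 | |- boundary (_ <|> _) _ _ _ _ => eapply boundary_h; [typ | typ | beq]
 | |- boundary (_ </> _) _ _ _ _ => eapply boundary_v; [typ|typ|beq]
 | |- boundary (Idh _) _ _ _ _ => apply boundary_idh
 | |- boundary (Idv _) _ _ _ _ => apply boundary_idv
 | |- boundary (psq _ _) _ _ _ _ => apply boundary_psq
 | |- boundary (pcomp _ _) _ _ _ _ => apply boundary_pcomp
 | |- boundary (punit _ _) _ _ _ _ => apply boundary_punit
 | |- boundary (qhh _ _ _) _ _ _ _ => apply boundary_qhh
 | |- boundary (qhv _ _ _) _ _ _ _ => apply boundary_qhv
 | |- boundary (qvh _ _ _) _ _ _ _ => apply boundary_qvh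
 | |- boundary _ _ _ _ _ => first [typ_atom | apply boundary_self] end].
Ltac bd := lazymatch goal with
 | |- bot _ = top _ => eapply boundary_bt; [typ|typ|beq]
 | |- top _ = bot _ => symmetry; eapply boundary_bt; [typ|typ|beq]
 | |- rgt _ = lft _ => eapply boundary_rl; [typ|typ|beq]
 | |- lft _ = rgt _ => symmetry; eapply boundary_rl; [typ|typ|beq]
 | |- top _ = _ => eapply boundary_top; [typ|beq]
 | |- bot _ = _ => eapply boundary_bot; [typ|beq]
 | |- lft _ = _ => eapply boundary_lft; [typ|beq]
 | |- rgt _ = _ => eapply boundary_rgt; [typ|beq]
 | |- _ = top _ => symmetry; eapply boundary_top; [typ|beq]
 | |- _ = bot _ => symmetry; eapply boundary_bot; [typ|beq]
 | |- _ = lft _ => symmetry; eapply boundary_lft; [typ|beq]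
 | |- _ = rgt _ => symmetry; eapply boundary_rgt; [typ|beq]
 | |- boundary _ _ _ _ _ => eapply boundary_conv; [typ|beq|beq|beq|beq]
 | |- _ => beq
 end.

(** * Globular squares, whiskering and exchange *)

Section Globular.
Variable D : double_category.
Implicit Types (f g h : hcell D) (a b : sq D).

Lemma inv_globular_idh f : inv_globular f f (Idh f).
Proof.
split; try bd.
by exists (Idh f); split; [bd|split; [bd|]]; rewrite idh_sqv; bd.
Qed.

Lemma inv_globular_sqv f g h a b :
  inv_globular f g a -> inv_globular g h b -> inv_globular f h (a </> b).
Proof.
move=> [ta ba la ra [a' [e1 [e2 [e3 e4]]]]] [tb bb lb rb [b' [e5 [e6 [e7 e8]]]]].
have eab : bot a = top b by rewrite ba tb.
have hs : hsrc f = hsrc g by rewrite -ta -ba hsrc_top hsrc_bot la vtgt_vid vsrc_vid.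
have ht : htgt f = htgt g by rewrite -ta -ba htgt_top htgt_bot ra vtgt_vid vsrc_vid.
split; rewrite ?top_sqv ?bot_sqv ?lft_sqv ?rgt_sqv // ?la ?ra ?lb ?rb -?hs -?ht; try bd.
have e9 : bot b' = top a' by rewrite e6 -e1.
exists (b' </> a'); split; [|split; [|split]].
- by rewrite top_sqv.
- by rewrite bot_sqv.
- rewrite sqvA ?top_sqv // -(sqvA e5) // e7 idh_sqv; first by rewrite e3.
  by rewrite -eab.
- rewrite sqvA ?bot_sqv ?top_sqv // -?(sqvA e2) // e4 idh_sqv -?eab ?e8 ?bot_sqv //.
Qed.

Lemma inv_globular_sqh f g f' g' a b :
  inv_globular f g a -> inv_globular f' g' b -> htgt f = hsrc f' ->
  inv_globular (f ;h f') (g ;h g') (a <|> b).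
Proof.
move=> [ta ba la ra [a' [e1 [e2 [e3 e4]]]]] [tb bb lb rb [b' [e5 [e6 [e7 e8]]]]] e.
have rl : rgt a = lft b by rewrite ra lb e.
have ht : htgt g = hsrc g'.
  by rewrite -ba -bb hsrc_bot htgt_bot ra lb e.
(* The inverses are not assumed to be globular. Comparing the sides of [a </> a'] and [b </> b']
   with those of identities shows that their relevant sides are vertical identities. *)
have rl' : rgt a' = lft b'.
  have ea : rgt a ;v rgt a' = vid (htgt (top a)) by rewrite -rgt_sqv // e3 rgt_id1h.
  have eb : lft b ;v lft b' = vid (hsrc (top b)) by rewrite -lft_sqv // e7 lft_id1h.
  have ha : htgt f = vsrc (rgt a') by rewrite -htgt_top -e1 htgt_bot ra vtgt_vid.
  have hb : hsrc f' = vsrc (lft b') by rewrite -hsrc_top -e5 hsrc_bot lb vtgt_vid.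
  by move: ea eb; rewrite ra lb !vid_compl // ta tb e => -> ->.
split; rewrite ?top_sqh ?bot_sqh ?lft_sqh ?rgt_sqh ?ta ?tb ?ba ?bb ?la ?rb //.
- by rewrite hsrc_hcomp.
- by rewrite htgt_hcomp.
have tb2 : htgt (bot a) = hsrc (bot b) by rewrite ba bb.
exists (a' <|> b'); split; [|split; [|split]].
- by rewrite (top_sqh rl') -e1 -e5 ba bb.
- by rewrite (bot_sqh rl') e2 e6 ta tb.
- by rewrite interchange // e3 e7 -sq_id1h_hcomp ta tb.
- by rewrite interchange // e4 e8 -sq_id1h_hcomp // ba bb.
Qed.

Lemma inv_globular_conv f g f' g' a :
  inv_globular f g a -> f = f' -> g = g' -> inv_globular f' g' a.
Proof. by move=> ? <- <-. Qed.
End Globular.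
Ltac vR := repeat match goal with |- context [?a </> ?b </> ?c] => rewrite (@sqvA _ a b c);
  [|bd|bd] end.
Ltac vL := repeat match goal with |- context [?a </> (?b </> ?c)] => rewrite -(@sqvA _ a b c);
  [|bd|bd] end.
Ltac hR := repeat match goal with |- context [?a <|> ?b <|> ?c] => rewrite (@sqhA _ a b c);
  [|bd|bd] end.
Ltac hL := repeat match goal with |- context [?a <|> (?b <|> ?c)] => rewrite -(@sqhA _ a b c);
  [|bd|bd] end.

(** The middle pair, where an interchange cell acts, becomes a single column, which is the shape
    that [interchange3] expects. *)
Lemma sqh_middle (D : double_category) (a b c d : sq D) :
  rgt a = lft b -> rgt b = lft c -> rgt c = lft d ->
  a <|> b <|> (c <|> d) = a <|> (b <|> c) <|> d.
Proof. by move=> ? ? ?; rewrite !sqhA ?lft_sqh ?rgt_sqh. Qed.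

Lemma whiskr (D : double_category) (a b : sq D) f :
  bot a = top b -> rgt a = vid (hsrc f) -> rgt b = vid (hsrc f) ->
  (a </> b) <|> Idh f = a <|> Idh f </> (b <|> Idh f).
Proof. by move=> ? ? ?; rewrite interchange ?idh_sqv; bd. Qed.

Lemma whiskl (D : double_category) (a b : sq D) f :
  bot a = top b -> lft a = vid (htgt f) -> lft b = vid (htgt f) ->
  Idh f <|> (a </> b) = Idh f <|> a </> (Idh f <|> b).
Proof. by move=> ? ? ?; rewrite interchange ?idh_sqv; bd. Qed.

Lemma exchange (D : double_category) (a b : sq D) f g h k :
  top a = f -> bot a = g -> top b = h -> bot b = k ->
  htgt f = hsrc h -> lft a = vid (hsrc f) -> rgt a = vid (htgt f) ->
  lft b = vid (hsrc h) -> rgt b = vid (htgt h) ->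
  a <|> Idh h </> (Idh g <|> b) = Idh f <|> b </> (a <|> Idh k).
Proof.
move=> ta ba tb bb e la ra lb rb.
have eg : htgt g = hsrc h by rewrite -ba -tb htgt_bot ra hsrc_top lb vtgt_vid vsrc_vid.
have ek : htgt f = hsrc k by rewrite -ta -bb htgt_top ra hsrc_bot lb vtgt_vid vsrc_vid.
rewrite !interchange ?idh_sqv ?sqv_idh //; rewrite ?bot_id1h ?top_id1h ?lft_id1h ?rgt_id1h //;
by rewrite ?ra ?lb -?e ?eg ?ek // -e ek.
Qed.

Lemma hid_hcomp (D : double_category) (x : ob D) : hid x ;h hid x = hid x.
Proof. by rewrite hid_compl ?hsrc_hid. Qed.
Lemma vid_vcomp (D : double_category) (x : ob D) : vid x ;v vid x = vid x.
Proof. by rewrite vid_compl ?vsrc_vid. Qed.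
Lemma idhid_sqh (D : double_category) (x : ob D) a : lft a = vid x -> Idh (hid x) <|> a = a.
Proof. by move=> e; rewrite -sq_id1v_vid -e sqh1l. Qed.
Lemma sqh_idhid (D : double_category) (x : ob D) a : rgt a = vid x -> a <|> Idh (hid x) = a.
Proof. by move=> e; rewrite -sq_id1v_vid -e sqh1r. Qed.

Lemma pcomp_irr (A B : double_category) (P : psfunctor A B) f g (e e' : htgt f = hsrc g) :
  pcomp P e = pcomp P e'.
Proof. by rewrite (proof_irrelevance _ e e'). Qed.

(** * Gluing a binary quasi-functor *)

Section Glue.
Variables (A B E : double_category) (F : ob B -> psfunctor A E) (G : ob A -> psfunctor B E).
Variable H : quasi2 F G.
Ltac ob_step ::= rewrite (q_ob H).

(** The pair [(a, b)] is [(a, Idh (top b))] over [(Idh (bot a), b)]. Each row lets one variable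
    move, and a mixed cell transports the 1h-cell of the other variable. *)
Definition glue_sq (a : sq A) (b : sq B) : sq E :=
  psq (F (hsrc (top b))) a <|> qvh H (rgt a) (top b)
    </> (qhv H (bot a) (lft b) <|> psq (G (htgt (bot a))) b).

Definition glue_comp (f g : hcell A) (h k : hcell B) (e : htgt f = hsrc g) (e' : htgt h = hsrc k) :
  sq E :=
  Idh (ph (F (hsrc h)) f) <|> qhh H g h <|> Idh (ph (G (htgt g)) k)
    </> (pcomp (F (hsrc h)) e <|> pcomp (G (htgt g)) e').

Lemma boundary_glue_sq a b : boundary (glue_sq a b)
  (ph (F (hsrc (top b))) (top a) ;h ph (G (htgt (top a))) (top b))
  (ph (F (hsrc (bot b))) (bot a) ;h ph (G (htgt (bot a))) (bot b))
  (pv (F (vsrc (lft b))) (lft a) ;v pv (G (vtgt (lft a))) (lft b))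
  (pv (F (vsrc (rgt b))) (rgt a) ;v pv (G (vtgt (rgt a))) (rgt b)).
Proof. rewrite /glue_sq; bd. Qed.

Lemma boundary_glue_comp f g h k (e : htgt f = hsrc g) (e' : htgt h = hsrc k) :
  boundary (glue_comp e e')
  (ph (F (hsrc h)) f ;h ph (G (htgt f)) h ;h (ph (F (hsrc k)) g ;h ph (G (htgt g)) k))
  (ph (F (hsrc h)) (f ;h g) ;h ph (G (htgt g)) (h ;h k))
  (vid (pob (F (hsrc h)) (hsrc f))) (vid (pob (G (htgt g)) (htgt k))).
Proof. rewrite /glue_comp; bd. Qed.

Lemma glue_comp_glob f g h k (e : htgt f = hsrc g) (e' : htgt h = hsrc k) :
  inv_globular (ph (F (hsrc h)) f ;h ph (G (htgt f)) h ;h (ph (F (hsrc k)) g ;h ph (G (htgt g)) k))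
    (ph (F (hsrc (h ;h k))) (f ;h g) ;h ph (G (htgt (f ;h g))) (h ;h k)) (glue_comp e e').
Proof.
apply: inv_globular_sqv.
  eapply inv_globular_conv.
    apply: inv_globular_sqh; first apply: inv_globular_sqh; try exact: inv_globular_idh.
    - exact: qhh_glob.
    - beq.
    - beq.
  - beq.
  - reflexivity.
eapply inv_globular_conv.
  apply: inv_globular_sqh; first exact: pcomp_glob; first exact: pcomp_glob; beq.
all: beq.
Qed.

(** Naturality of the interchange cell in both variables at once: [qhh_sq_r] moves [b] past it and
    [qhh_sq_l] then moves [a]. *)
Lemma glue_comp_middle (a : sq A) (b : sq B) f g :
  f = top a -> g = top b ->
  qvh H (lft a) g <|> psq (F (htgt g)) a </> (psq (G (vtgt (lft a))) b <|> qhv H (bot a) (rgt b))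
    </> qhh H (bot a) (bot b)
  = qhh H f g </> (psq (F (hsrc g)) a <|> qvh H (rgt a) g)
    </> (qhv H (bot a) (lft b) <|> psq (G (htgt (bot a))) b).
Proof.
move=> -> ->.
have := qhh_sq_r H (bot a) b; rewrite hsrc_bot => er.
rewrite sqvA; [|bd|bd].
rewrite -er -sqvA; [|bd|bd].
by rewrite -qhh_sq_l.
Qed.

Lemma glue_comp_nat (a a' : sq A) (b b' : sq B) (e1 : htgt (top a) = hsrc (top a'))
  (e2 : htgt (top b) = hsrc (top b')) (e1' : htgt (bot a) = hsrc (bot a'))
  (e2' : htgt (bot b) = hsrc (bot b')) : rgt a = lft a' -> rgt b = lft b' ->
  glue_comp e1 e2 </> glue_sq (a <|> a') (b <|> b') = glue_sq a b <|> glue_sq a' b' </>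
    glue_comp e1' e2'.
Proof.
move=> ea eb.
rewrite /glue_comp /glue_sq !top_sqh ?bot_sqh ?lft_sqh ?rgt_sqh //.
have -> : hsrc (top b ;h top b') = hsrc (top b) by beq.
have -> : htgt (bot a ;h bot a') = htgt (bot a') by beq.
rewrite -sqvA; [|bd|bd].
rewrite (@sqvA _ _ (pcomp _ _ <|> pcomp _ _)); [|bd|bd].
rewrite (@interchange _ (pcomp _ _) (pcomp _ _)); [|bd|bd|bd|bd].
rewrite (pcomp_nat (F (hsrc (top b))) e1 e1' ea) htgt_top qvh_hcomp.
rewrite -(@interchange _ (psq _ _ <|> psq _ _)); [|bd|bd|bd|bd].
vR.
rewrite (@interchange _ (pcomp _ _) (pcomp _ _)); [|bd|bd|bd|bd].
have eb' : hsrc (top b) = vsrc (lft b) by beq.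
have := qhv_hcomp H (lft b) e1'; rewrite hsrc_top => ->.
have := pcomp_nat (G (htgt (bot a'))) e2 e2' eb; rewrite htgt_bot => ->.
rewrite -(@interchange _ (qhv _ _ _ <|> qhv _ _ _)); [|bd|bd|bd|bd].
rewrite -!sqvA; try bd.
rewrite hsrc_bot; congr (_ </> _).
rewrite -interchange; [|bd|bd|bd|bd].
(* With the compositors moved below, the pasting splits into three columns; only the middle one,
   holding the interchange cell, differs, and [glue_comp_middle] settles it. *)
rewrite !sqh_middle; try bd.
rewrite !interchange3; try bd.
rewrite ea -eb.
have eh : htgt (top b) = hsrc (top b') by beq.
rewrite -eh -?htgt_bot.
have eh2 : htgt (bot a) = vtgt (lft a') by beq.
rewrite eh2 (glue_comp_middle (a:=a') (b:=b) eq_refl eq_refl) hsrc_top.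
by rewrite ?(idh_sqv (a := psq _ _)) ?(idh_sqv (a := qvh _ _ _)) ?sqv_idh; try bd.
Qed.

(** This lemma and the next prepare the two bracketings in [glue_compA]: expanding the interchange
    cell at a composite lets all compositors sink below all interchange cells. *)
Lemma glue_comp_hcomp_l (f1 f2 f3 : hcell A) (g1 g2 g3 : hcell B)
 (e12 : htgt f1 = hsrc f2) (e23 : htgt f2 = hsrc f3) (d12 : htgt g1 = hsrc g2) (d23 : htgt g2 =
   hsrc g3) :
 pcomp (F (hsrc g1)) e12 <|> pcomp (G (htgt f2)) d12 <|> (Idh (ph (F (hsrc g3)) f3) <|>
   Idh (ph (G (htgt f3)) g3))
  </> (Idh (ph (F (hsrc g1)) (f1 ;h f2)) <|> qhh H f3 (g1 ;h g2) <|> Idh (ph (G (htgt f3)) g3))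
 = Idh (ph (F (hsrc g1)) f1 ;h ph (F (hsrc g1)) f2) <|>
   (Idh (ph (G (hsrc f3)) g1) <|> qhh H f3 g2 </> (qhh H f3 g1 <|> Idh (ph (G (htgt f3)) g2))) <|>
     Idh (ph (G (htgt f3)) g3)
  </> ((pcomp (F (hsrc g1)) e12 <|> (Idh (ph (F (hsrc g1)) f3) <|> pcomp (G (htgt f3)) d12)) <|>
    Idh (ph (G (htgt f3)) g3)).
Proof.
rewrite -!sqhA; try bd.
rewrite (@sqhA _ (pcomp (F (hsrc g1)) e12) (pcomp (G _) d12)); try bd.
rewrite interchange3; try bd.
rewrite (@sqhA _ (pcomp (F (hsrc g1)) e12)); try bd.
rewrite interchange3; try bd.
rewrite !sqv_idh ?idh_sqv; try bd.
congr (_ <|> _ <|> _).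
have := qhh_hcomp_r H f3 d12.
by rewrite d23 e23 => ->.
Qed.

Lemma glue_comp_hcomp_r (f1 f2 f3 : hcell A) (g1 g2 g3 : hcell B)
 (e12 : htgt f1 = hsrc f2) (e23 : htgt f2 = hsrc f3) (d12 : htgt g1 = hsrc g2) (d23 : htgt g2 =
   hsrc g3) :
 Idh (ph (F (hsrc g1)) f1) <|> Idh (ph (G (htgt f1)) g1) <|> (pcomp (F (hsrc g2)) e23 <|>
   pcomp (G (htgt f3)) d23)
  </> (Idh (ph (F (hsrc g1)) f1) <|> qhh H (f2 ;h f3) g1 <|> Idh (ph (G (htgt f3)) (g2 ;h g3)))
 = Idh (ph (F (hsrc g1)) f1) <|>
   (qhh H f2 g1 <|> Idh (ph (F (hsrc g2)) f3) </> (Idh (ph (F (hsrc g1)) f2) <|> qhh H f3 g1)) <|>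
     Idh (ph (G (htgt f3)) g2 ;h ph (G (htgt f3)) g3)
  </> (Idh (ph (F (hsrc g1)) f1) <|> (pcomp (F (hsrc g1)) e23 <|> Idh (ph (G (htgt f3)) g1) <|>
    pcomp (G (htgt f3)) d23)).
Proof.
rewrite sqh_middle; try bd.
rewrite interchange3; try bd.
rewrite -(@sqhA _ (Idh _) _ (pcomp (G _) _)); try bd.
rewrite interchange3; try bd.
rewrite !sqv_idh ?idh_sqv; try bd.
congr (_ <|> _ <|> _).
have := qhh_hcomp_l H g1 e23.
by rewrite d12 e12 => ->.
Qed.

Lemma glue_compA (f1 f2 f3 : hcell A) (g1 g2 g3 : hcell B)
 (e12 : htgt f1 = hsrc f2) (e23 : htgt f2 = hsrc f3) (d12 : htgt g1 = hsrc g2) (d23 : htgt g2 =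
   hsrc g3)
 (e12_3 : htgt (f1 ;h f2) = hsrc f3) (e1_23 : htgt f1 = hsrc (f2 ;h f3))
 (d12_3 : htgt (g1 ;h g2) = hsrc g3) (d1_23 : htgt g1 = hsrc (g2 ;h g3)) :
 glue_comp e12 d12 <|> Idh (ph (F (hsrc g3)) f3 ;h ph (G (htgt f3)) g3) </> glue_comp e12_3 d12_3 =
 Idh (ph (F (hsrc g1)) f1 ;h ph (G (htgt f1)) g1) <|> glue_comp e23 d23 </> glue_comp e1_23 d1_23.
Proof.
rewrite /glue_comp.
have -> : hsrc (g1 ;h g2) = hsrc g1 by beq.
have -> : htgt (f2 ;h f3) = htgt f3 by beq.
have eid1 : Idh (ph (F (hsrc g3)) f3 ;h ph (G (htgt f3)) g3)
  = Idh (ph (F (hsrc g3)) f3) <|> Idh (ph (G (htgt f3)) g3) by rewrite sq_id1h_hcomp //; beq.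
have eid2 : Idh (ph (F (hsrc g1)) f1 ;h ph (G (htgt f1)) g1)
  = Idh (ph (F (hsrc g1)) f1) <|> Idh (ph (G (htgt f1)) g1) by rewrite sq_id1h_hcomp //; beq.
rewrite whiskr; [|bd|bd|bd].
rewrite whiskl; [|bd|bd|bd].
rewrite eid1 eid2.
vR.
rewrite -(@sqvA _ (pcomp _ _ <|> pcomp _ _ <|> (Idh _ <|> Idh _))); try bd.
rewrite glue_comp_hcomp_l //.
rewrite -(@sqvA _ (Idh _ <|> Idh _ <|> (pcomp _ _ <|> pcomp _ _))); try bd.
rewrite glue_comp_hcomp_r //.
vR.
rewrite -(@sqvA _ (_ <|> _ <|> (Idh _ <|> Idh _)) (Idh _ <|> _ <|> Idh _)); [|bd|bd].
rewrite -(@sqvA _ (Idh _ <|> Idh _ <|> (_ <|> _ <|> Idh _)) (Idh _ <|> _ <|> Idh _)); [|bd|bd].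
have eh : htgt f1 = hsrc f2 by [].
have eh1 : htgt f2 = hsrc f3 by [].
have eh2 : htgt g1 = hsrc g2 by [].
have eh3 : htgt g2 = hsrc g3 by [].
(* The interchange cells at [(f2, g1)] and [(f3, g2)] lie in disjoint columns, so their order can be
   exchanged. Below them the compositors agree by [pcompA] in each variable. *)
congr (_ </> _).
- rewrite -(@sqhA _ _ (Idh _) (Idh _)); [|bd|bd].
  rewrite (@sqhA _ _ (Idh (ph (G (htgt f2)) g2)) (Idh _)); [|bd|bd].
  rewrite (@sqhA _ (Idh (ph (F (hsrc g1)) f1)) (qhh H f2 g1) _); [|bd|bd].
  rewrite !sq_id1h_hcomp; try beq.
  rewrite (@sqhA _ (Idh (ph (F (hsrc g1)) f1)) (Idh _)); [|bd|bd].
  rewrite interchange3; try bd.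
  rewrite -(@sqhA _ _ (_ <|> qhh H f3 g2) (Idh _)); [|bd|bd].
  rewrite (@sqhA _ (Idh (ph (F (hsrc g1)) f1)) (Idh _)); [|bd|bd].
  rewrite -(@sqhA _ _ (Idh (ph (G (htgt f3)) g2)) (Idh _)); [|bd|bd].
  rewrite (@sqhA _ (Idh (ph (F (hsrc g1)) f1)) _ (Idh (ph (G (htgt f3)) g2))); [|bd|bd].
  rewrite interchange3; try bd.
  congr (_ <|> _ <|> _).
  rewrite whiskl; [|bd|bd|bd].
  rewrite whiskr; [|bd|bd|bd].
  rewrite -!sqvA; try bd.
  rewrite -!sqhA; try bd.
  congr (_ </> _).
  rewrite !(@sqhA _ (qhh _ _ _)); try bd.
  rewrite -!sq_id1h_hcomp; try beq.
  by rewrite (exchange (f := ph (G (hsrc f2)) g1 ;h ph (F (hsrc g2)) f2) (g :=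
    ph (F (hsrc g1)) f2 ;h ph (G (hsrc f3)) g1) (k := ph (F (hsrc g2)) f3 ;h ph (G (htgt f3)) g2));
      try bd.
rewrite -sqhA; [|bd|bd].
rewrite -sqhA; [|bd|bd].
rewrite -sqhA; [|bd|bd].
rewrite (@sqhA _ (pcomp (F _) _ <|> _)); [|bd|bd].
rewrite (@sqhA _ (Idh (ph (F _) _) <|> _)); [|bd|bd].
rewrite !interchange; try bd.
by rewrite (pcompA _ e12 e23 e12_3 e1_23) (pcompA _ d12 d23 d12_3 d1_23).
Qed.

Lemma glue_sq_sqv (a a' : sq A) (b b' : sq B) : bot a = top a' -> bot b = top b' ->
  glue_sq (a </> a') (b </> b') = glue_sq a b </> glue_sq a' b'.
Proof.
move=> ea eb; rewrite /glue_sq.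
rewrite ?top_sqv ?bot_sqv ?rgt_sqv ?lft_sqv //.
have er : vtgt (rgt a) = vsrc (rgt a') by rewrite -htgt_bot -htgt_top ea.
have el : vtgt (lft b) = vsrc (lft b') by rewrite -hsrc_bot -hsrc_top eb.
rewrite qvh_vcomp // qhv_vcomp // !psq_sqv //.
rewrite -!interchange; try bd.
vR; congr (_ </> _); vL; congr (_ </> _).
(* Only the two middle rows remain, in opposite orders. They trade places by [qhv_sq] in the left
   column and [qvh_sq] in the right one. *)
rewrite !interchange; try bd.
rewrite -eb hsrc_bot hsrc_top -qhv_sq -ea htgt_bot htgt_bot.
have -> : vtgt (rgt a) = vsrc (rgt a') by [].
by rewrite qvh_sq.
Qed.

Lemma glue_sq_idh f g : glue_sq (Idh f) (Idh g) = Idh (ph (F (hsrc g)) f ;h ph (G (htgt f)) g).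
Proof.
rewrite /glue_sq !psq_id1h top_id1h bot_id1h lft_id1h rgt_id1h qhv_vid qvh_vid.
by rewrite -sq_id1h_hcomp ?idh_sqv; bd.
Qed.

Lemma glue_unit_glob x y : inv_globular (hid (pob (F y) x))
  (ph (F (hsrc (hid y))) (hid x) ;h ph (G (htgt (hid x))) (hid y))
  (punit (F y) x <|> punit (G x) y).
Proof.
eapply inv_globular_conv.
  apply: inv_globular_sqh; first exact: punit_glob; first exact: punit_glob.
  all: beq.
Qed.

Lemma glue_unit_nat u v :
  punit (F (vsrc v)) (vsrc u) <|> punit (G (vsrc u)) (vsrc v) </> glue_sq (Idv u) (Idv v)
  = Idv (pv (F (vsrc v)) u ;v pv (G (vtgt u)) v) </> (punit (F (vtgt v)) (vtgt u) <|>
    punit (G (vtgt u)) (vtgt v)).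
Proof.
rewrite /glue_sq top_id1v bot_id1v lft_id1v rgt_id1v hsrc_hid htgt_hid -sqvA; try bd.
rewrite interchange; try bd.
rewrite punit_nat qvh_hid -interchange; try bd.
rewrite sqvA; try bd.
rewrite interchange; try bd.
rewrite punit_nat qhv_hid -interchange; try bd.
rewrite -sqvA; try bd.
by rewrite !idv_sqh ?sq_id1v_vcomp; bd.
Qed.

Lemma glue_comp1l f g (e : htgt (hid (hsrc f)) = hsrc f) (e' : htgt (hid (hsrc g)) = hsrc g) :
  punit (F (hsrc g)) (hsrc f) <|> punit (G (hsrc f)) (hsrc g)
    <|> Idh (ph (F (hsrc g)) f ;h ph (G (htgt f)) g) </> glue_comp e e'
  = Idh (ph (F (hsrc g)) f ;h ph (G (htgt f)) g).
Proof.
rewrite /glue_comp hsrc_hid.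
rewrite !sq_id1h_hcomp; try beq.
rewrite sqh_middle; try bd.
rewrite -sqvA; try bd.
rewrite interchange3; try bd.
(* Against a unitor the interchange cell disappears, and the unit laws of the two one-variable
   functors remain. *)
have := qhh_hid_r H f (hsrc g) => ->.
rewrite !sqv_idh ?idh_sqv; try bd.
rewrite -sqh_middle; try bd.
rewrite interchange; try bd.
by rewrite !pcomp1l.
Qed.

Lemma glue_comp1r f g (e : htgt f = hsrc (hid (htgt f))) (e' : htgt g = hsrc (hid (htgt g))) :
  Idh (ph (F (hsrc g)) f ;h ph (G (htgt f)) g) <|>
  (punit (F (htgt g)) (htgt f) <|> punit (G (htgt f)) (htgt g)) </> glue_comp e e'
  = Idh (ph (F (hsrc g)) f ;h ph (G (htgt f)) g).
Proof.
rewrite /glue_comp htgt_hid.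
rewrite !sq_id1h_hcomp; try beq.
rewrite sqh_middle; try bd.
rewrite -sqvA; try bd.
rewrite interchange3; try bd.
have := qhh_hid_l H (htgt f) g => ->.
rewrite !sqv_idh ?idh_sqv; try bd.
rewrite -sqh_middle; try bd.
rewrite interchange; try bd.
by rewrite !pcomp1r.
Qed.

Definition glue : psfunctor (A ** B) E.
Proof.
refine (@PsFunctor (A ** B) E (fun x => pob (F (snd x)) (fst x))
  (fun f => ph (F (hsrc (snd f))) (fst f) ;h ph (G (htgt (fst f))) (snd f))
  (fun u => pv (F (vsrc (snd u))) (fst u) ;v pv (G (vtgt (fst u))) (snd u))
  (fun a => glue_sq (fst a) (snd a))
  (fun f g e => glue_comp (f_equal fst e) (f_equal snd e))
  (fun x => punit (F (snd x)) (fst x) <|> punit (G (fst x)) (snd x))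
  _ _ _ _ _ _ _ _ _ _ _ _ _ _ _ _ _ _ _).
- move=> [f g] /=; beq.
- move=> [f g] /=; beq.
- move=> [f g] /=; beq.
- move=> [f g] /=; beq.
- by move=> [a b] /=; case: (boundary_glue_sq a b).
- by move=> [a b] /=; case: (boundary_glue_sq a b) => _ [].
- by move=> [a b] /=; case: (boundary_glue_sq a b) => _ [_ []].
- by move=> [a b] /=; case: (boundary_glue_sq a b) => _ [_ []].
- move=> [x y] /=; beq.
- move=> [u v] [u' v'] /= e; case: (e) => eu ev.
  rewrite !pv_vcomp // vsrc_vcomp // vtgt_vcomp //.
  (* Vertical composition is preserved strictly because the two inner factors commute: this is the
     triviality of the vertical-vertical cells. *)
  have := qvv H u' v; rewrite -eu -ev => ev'.
  rewrite vcompA; try beq.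
  rewrite vcompA; try beq. congr (_ ;v _).
  rewrite -vcompA; try beq.
  rewrite -[RHS]vcompA; try beq.
  by rewrite ev'.
- move=> [f g]; exact: glue_sq_idh.
- move=> [a b] [a' b'] e; exact: glue_sq_sqv (f_equal fst e) (f_equal snd e).
- move=> [f g] [f' g'] e; exact: glue_comp_glob.
- move=> [x y]; exact: glue_unit_glob.
- move=> [a b] [a' b'] e e' e''; exact: glue_comp_nat (f_equal fst e'') (f_equal snd e'').
- move=> [u v]; exact: glue_unit_nat.
- move=> [f1 g1] [f2 g2] [f3 g3] e1 e2 e12 e21; exact: glue_compA.
- move=> [f g] e; exact: glue_comp1l.
- move=> [f g] e; exact: glue_comp1r.
Defined.
End Glue.

(** * Currying *)

Section Curry.
Variables (A B C E : double_category)
    (F1 : ob B -> ob C -> psfunctor A E)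
    (F2 : ob A -> ob C -> psfunctor B E)
    (F3 : ob A -> ob B -> psfunctor C E)
    (H12 : forall z, quasi2 (fun y => F1 y z) (fun x => F2 x z))
    (H13 : forall y, quasi2 (fun z => F1 y z) (fun x => F3 x y))
    (H23 : forall x, quasi2 (fun z => F2 x z) (fun y => F3 x y)).
Hypothesis H : quasi3_ax H12 H13 H23.

Lemma q3_ob1 x y z : pob (F1 y z) x = pob (F3 x y) z.
Proof. exact: (q_ob (H13 y)). Qed.
Lemma q3_ob2 x y z : pob (F2 x z) y = pob (F3 x y) z.
Proof. exact: (q_ob (H23 x)). Qed.
Ltac ob_step ::= first [rewrite q3_ob1 | rewrite q3_ob2].

(** [glue] reads [(f, g)] as [f] followed by [g], so [h] crosses [f] by [H13] and then [g] by [H23];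
    [H12] is already part of the glued functor. *)
Definition curry_hh f g h : sq E :=
  qhh (H13 (hsrc g)) f h <|> Idh (ph (F2 (htgt f) (htgt h)) g)
    </> (Idh (ph (F1 (hsrc g) (hsrc h)) f) <|> qhh (H23 (htgt f)) g h).
Definition curry_hv f g w : sq E := qhv (H13 (hsrc g)) f w <|> qhv (H23 (htgt f)) g w.
Definition curry_vh u v h : sq E := qvh (H13 (vsrc v)) u h </> qvh (H23 (vtgt u)) v h.

Lemma curry_hh_glob f g h : inv_globular
  (ph (F3 (hsrc f) (hsrc g)) h ;h (ph (F1 (hsrc g) (htgt h)) f ;h ph (F2 (htgt f) (htgt h)) g))
  (ph (F1 (hsrc g) (hsrc h)) f ;h ph (F2 (htgt f) (hsrc h)) g ;h ph (F3 (htgt f) (htgt g)) h)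
  (curry_hh f g h).
Proof.
apply: inv_globular_sqv.
  eapply inv_globular_conv.
    apply: inv_globular_sqh; [exact: qhh_glob|exact: inv_globular_idh|beq].
  - beq.
  - reflexivity.
eapply inv_globular_conv.
  apply: inv_globular_sqh; [exact: inv_globular_idh|exact: qhh_glob|beq].
all: beq.
Qed.

Lemma curry_hh_hid_r f g z :
  punit (F3 (hsrc f) (hsrc g)) z <|> Idh (ph (F1 (hsrc g) z) f ;h ph (F2 (htgt f) z) g) </>
    curry_hh f g (hid z)
  = Idh (ph (F1 (hsrc g) z) f ;h ph (F2 (htgt f) z) g) <|> punit (F3 (htgt f) (htgt g)) z.
Proof.
rewrite /curry_hh hsrc_hid htgt_hid !sq_id1h_hcomp; try beq.
rewrite -!sqhA; try bd.
rewrite -sqvA; try bd.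
rewrite interchange; try bd.
rewrite (qhh_hid_r (H13 (hsrc g))) sqv_idh; try bd.
rewrite !sqhA; try bd.
rewrite interchange; try bd.
by rewrite (qhh_hid_r (H23 (htgt f))) sqv_idh; bd.
Qed.

Lemma curry_hh_hid_l x y h :
  Idh (ph (F3 x y) h) <|> (punit (F1 y (htgt h)) x <|> punit (F2 x (htgt h)) y) </>
    curry_hh (hid x) (hid y) h
  = punit (F1 y (hsrc h)) x <|> punit (F2 x (hsrc h)) y <|> Idh (ph (F3 x y) h).
Proof.
rewrite /curry_hh !hsrc_hid !htgt_hid -!sqhA; try bd.
rewrite -sqvA; try bd.
rewrite interchange; try bd.
rewrite (qhh_hid_l (H13 y)) sqv_idh; try bd.
rewrite !sqhA; try bd.
rewrite interchange; try bd.
by rewrite (qhh_hid_l (H23 x)) sqv_idh; bd.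
Qed.

Lemma curry_hv_hid x y w :
  punit (F1 y (vsrc w)) x <|> punit (F2 x (vsrc w)) y </> curry_hv (hid x) (hid y) w =
  Idv (pv (F3 x y) w) </> (punit (F1 y (vtgt w)) x <|> punit (F2 x (vtgt w)) y).
Proof.
rewrite /curry_hv !hsrc_hid !htgt_hid interchange; try bd.
rewrite (qhv_hid (H13 y)) (qhv_hid (H23 x)) -interchange; try bd.
by rewrite idv_sqh; bd.
Qed.

Lemma curry_vh_hid u v z :
  punit (F3 (vsrc u) (vsrc v)) z </> curry_vh u v (hid z) =
  Idv (pv (F1 (vsrc v) z) u ;v pv (F2 (vtgt u) z) v) </> punit (F3 (vtgt u) (vtgt v)) z.
Proof.
rewrite /curry_vh -sqvA; try bd.
rewrite (qvh_hid (H13 (vsrc v))) sqvA; try bd.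
rewrite (qvh_hid (H23 (vtgt u))) -sqvA; try bd.
by rewrite sq_id1v_vcomp //; bd.
Qed.

Lemma curry_hv_vid f g z :
  curry_hv f g (vid z) = Idh (ph (F1 (hsrc g) z) f ;h ph (F2 (htgt f) z) g).
Proof. by rewrite /curry_hv !qhv_vid -sq_id1h_hcomp; bd. Qed.

Lemma curry_vh_vid x y h : curry_vh (vid x) (vid y) h = Idh (ph (F3 x y) h).
Proof. by rewrite /curry_vh vsrc_vid vtgt_vid !qvh_vid idh_sqv; bd. Qed.

Lemma curry_hv_vcomp f g w w' : vtgt w = vsrc w' -> curry_hv f g (w ;v w') = curry_hv f g w </>
  curry_hv f g w'.
Proof. by move=> e; rewrite /curry_hv !qhv_vcomp // interchange; bd. Qed.

Lemma curry_vh_vcomp u v u' v' h : vtgt u = vsrc u' -> vtgt v = vsrc v' ->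
  curry_vh (u ;v u') (v ;v v') h = curry_vh u v h </> curry_vh u' v' h.
Proof.
move=> eu ev; rewrite /curry_vh vsrc_vcomp // vtgt_vcomp // !qvh_vcomp //.
rewrite -!sqvA; try bd. congr (_ </> _).
rewrite !sqvA; try bd. congr (_ </> _).
by have := q3_vvh H u' v h; rewrite ev eu => ->.
Qed.

Lemma curry_vh_hcomp u v h h' (e : htgt h = hsrc h') :
  pcomp (F3 (vsrc u) (vsrc v)) e </> curry_vh u v (h ;h h')
  = curry_vh u v h <|> curry_vh u v h' </> pcomp (F3 (vtgt u) (vtgt v)) e.
Proof.
rewrite /curry_vh -sqvA; try bd.
rewrite (qvh_hcomp (H13 (vsrc v))) sqvA; try bd.
rewrite (qvh_hcomp (H23 (vtgt u))) -sqvA; try bd.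
by rewrite interchange; bd.
Qed.

Lemma curry_hv_hcomp f f' g g' w (e : htgt f = hsrc f') (e' : htgt g = hsrc g') :
  glue_comp (H12 (vsrc w)) e e' </> curry_hv (f ;h f') (g ;h g') w
  = curry_hv f g w <|> curry_hv f' g' w </> glue_comp (H12 (vtgt w)) e e'.
Proof.
rewrite /curry_hv /glue_comp.
have -> : hsrc (g ;h g') = hsrc g by beq.
have -> : htgt (f ;h f') = htgt f' by beq.
rewrite sqvA; try bd.
rewrite interchange; try bd.
rewrite (qhv_hcomp (H13 _)) (qhv_hcomp (H23 _)) -interchange; try bd.
rewrite -!sqvA; try bd. congr (_ </> _).
rewrite !sqh_middle; try bd.
rewrite !interchange3; try bd.
rewrite !idh_sqv ?sqv_idh; try bd.
congr (_ <|> _ <|> _).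
have := q3_hhv H f' g w. by rewrite -e e'.
Qed.

Lemma curry_vh_sq u v (c : sq C) :
  psq (F3 (vsrc u) (vsrc v)) c </> curry_vh u v (bot c) = curry_vh u v (top c) </>
    psq (F3 (vtgt u) (vtgt v)) c.
Proof.
rewrite /curry_vh -sqvA; try bd.
rewrite (qvh_sq (H13 _)) sqvA; try bd.
by rewrite (qvh_sq (H23 _)) -sqvA; bd.
Qed.

Lemma curry_hv_sq a b w :
  curry_hv (top a) (top b) w </> glue_sq (H12 (vtgt w)) a b = glue_sq (H12 (vsrc w)) a b </>
    curry_hv (bot a) (bot b) w.
Proof.
rewrite /curry_hv /glue_sq -!sqvA; try bd.
rewrite interchange; try bd.
have := qhv_sq (H13 (hsrc (top b))) a w => ->.
have := q3_vhv H (rgt a) (top b) w; rewrite -htgt_top => <-.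
rewrite -interchange; try bd.
rewrite !sqvA; try bd. congr (_ </> _).
rewrite !interchange; try bd.
rewrite -htgt_bot (qhv_sq (H23 (htgt (bot a)))) hsrc_bot.
have := q3_hvv H (bot a) (lft b) w; rewrite -hsrc_top => <-.
by [].
Qed.

Lemma curry_hh_sq_r f g (w : sq C) :
  curry_hh f g (top w) </> (curry_hv f g (lft w) <|> psq (F3 (htgt f) (htgt g)) w)
  = psq (F3 (hsrc f) (hsrc g)) w <|> curry_hv f g (rgt w) </> curry_hh f g (bot w).
Proof.
rewrite /curry_hh /curry_hv.
rewrite sqvA; try bd.
rewrite (@sqhA _ (qhv _ _ _)); try bd.
rewrite interchange; try bd.
have := qhh_sq_r (H23 (htgt f)) g w => ->.
rewrite idh_sqv; try bd.
rewrite -(@sqv_idh _ (ph (F1 (hsrc g) (hsrc (bot w))) f) (qhv (H13 _) f _)); try bd.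
rewrite -interchange; try bd.
rewrite -sqvA; try bd.
rewrite -sqhA; try bd.
rewrite interchange; try bd.
rewrite -!sqvA; try bd. congr (_ </> _).
have := qhh_sq_r (H13 (hsrc g)) f w => ->.
rewrite -!sqhA; try bd.
rewrite interchange; try bd.
by rewrite idh_sqv ?sqv_idh; bd.
Qed.

Lemma curry_hh_sq_l a b h :
  curry_hh (top a) (top b) h </> (glue_sq (H12 (hsrc h)) a b <|> curry_vh (rgt a) (rgt b) h)
  = curry_vh (lft a) (lft b) h <|> glue_sq (H12 (htgt h)) a b </> curry_hh (bot a) (bot b) h.
Proof.
rewrite /curry_hh /curry_vh /glue_sq -!interchange; try bd.
rewrite !htgt_top !htgt_bot !hsrc_top !hsrc_bot.
(* Both [curry_hh] and [glue_sq] consist of two rows. The steps [s1] to [s4] move each row of the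
   former past each row of the latter: [s1] and [s4] use the mixed ternary axioms, [s2] and [s3] the
   naturality of [H13] and [H23]. *)
have s1 : Idh (ph (F1 (vsrc (lft b)) (hsrc h)) (top a)) <|> qhh (H23 (vsrc (rgt a))) (top b) h
   </> (psq (F1 (vsrc (lft b)) (hsrc h)) a <|> qvh (H12 (hsrc h)) (rgt a) (top b) <|>
     qvh (H13 (vsrc (rgt b))) (rgt a) h)
   = psq (F1 (vsrc (lft b)) (hsrc h)) a <|> qvh (H13 (vsrc (lft b))) (rgt a) h <|>
     qvh (H12 (htgt h)) (rgt a) (top b)
   </> (Idh (ph (F1 (vsrc (lft b)) (hsrc h)) (bot a)) <|> qhh (H23 (vtgt (rgt a))) (top b) h).
  rewrite !sqhA; try bd.
  rewrite !interchange; try bd.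
  rewrite idh_sqv ?sqv_idh; try bd.
  by have := q3_vhh H (rgt a) (top b) h; rewrite htgt_top hsrc_top => ->.
have s2 : qhh (H13 (vsrc (lft b))) (top a) h <|> Idh (ph (F2 (vsrc (rgt a)) (htgt h)) (top b))
   </> (psq (F1 (vsrc (lft b)) (hsrc h)) a <|> qvh (H13 (vsrc (lft b))) (rgt a) h <|>
     qvh (H12 (htgt h)) (rgt a) (top b))
   = qvh (H13 (vsrc (lft b))) (lft a) h <|> psq (F1 (vsrc (lft b)) (htgt h)) a <|>
     qvh (H12 (htgt h)) (rgt a) (top b)
   </> (qhh (H13 (vsrc (lft b))) (bot a) h <|> Idh (ph (F2 (vtgt (rgt a)) (htgt h)) (top b))).
  rewrite !interchange; try bd.
  rewrite idh_sqv ?sqv_idh; try bd.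
  by have := qhh_sq_l (H13 (vsrc (lft b))) a h => ->.
have s3 : Idh (ph (F1 (vsrc (lft b)) (hsrc h)) (bot a)) <|> qhh (H23 (vtgt (rgt a))) (top b) h
   </> (qhv (H12 (hsrc h)) (bot a) (lft b) <|> psq (F2 (vtgt (rgt a)) (hsrc h)) b <|>
     qvh (H23 (vtgt (rgt a))) (rgt b) h)
  = qhv (H12 (hsrc h)) (bot a) (lft b) <|> qvh (H23 (vtgt (rgt a))) (lft b) h <|>
    psq (F2 (vtgt (rgt a)) (htgt h)) b
  </> (Idh (ph (F1 (vtgt (lft b)) (hsrc h)) (bot a)) <|> qhh (H23 (vtgt (rgt a))) (bot b) h).
  rewrite !sqhA; try bd.
  rewrite !interchange; try bd.
  rewrite idh_sqv ?sqv_idh; try bd.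
  by have := qhh_sq_l (H23 (vtgt (rgt a))) b h => ->.
have s4 : qhh (H13 (vsrc (lft b))) (bot a) h <|> Idh (ph (F2 (vtgt (rgt a)) (htgt h)) (top b))
   </> (qhv (H12 (hsrc h)) (bot a) (lft b) <|> qvh (H23 (vtgt (rgt a))) (lft b) h <|>
     psq (F2 (vtgt (rgt a)) (htgt h)) b)
   = qvh (H23 (vtgt (lft a))) (lft b) h <|> qhv (H12 (htgt h)) (bot a) (lft b) <|>
     psq (F2 (vtgt (rgt a)) (htgt h)) b
   </> (qhh (H13 (vtgt (lft b))) (bot a) h <|> Idh (ph (F2 (vtgt (rgt a)) (htgt h)) (bot b))).
  rewrite !interchange; try bd.
  rewrite idh_sqv ?sqv_idh; try bd.
  by have := q3_hvh H (bot a) (lft b) h; rewrite htgt_bot hsrc_bot => ->.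
vR.
rewrite -(@sqvA _ (Idh _ <|> _)); try bd.
rewrite s1.
vR.
rewrite -(@sqvA _ (qhh _ _ _ <|> _)); try bd.
rewrite s2.
vR.
rewrite s3.
rewrite -(@sqvA _ (qhh _ _ _ <|> _)); try bd.
rewrite s4.
vR.
by rewrite !sqhA; bd.
Qed.

Lemma curry_hh_hcomp_r f g h h' (e : htgt h = hsrc h') :
  Idh (ph (F3 (hsrc f) (hsrc g)) h) <|> curry_hh f g h'
  </> (curry_hh f g h <|> Idh (ph (F3 (htgt f) (htgt g)) h'))
  </> (Idh (ph (F1 (hsrc g) (hsrc h)) f ;h ph (F2 (htgt f) (hsrc h)) g) <|>
    pcomp (F3 (htgt f) (htgt g)) e)
  = pcomp (F3 (hsrc f) (hsrc g)) e <|> Idh (ph (F1 (hsrc g) (htgt h')) f ;h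
    ph (F2 (htgt f) (htgt h')) g)
  </> curry_hh f g (h ;h h').
Proof.
rewrite /curry_hh.
have -> : htgt (h ;h h') = htgt h' by beq.
have -> : hsrc (h ;h h') = hsrc h by beq.
rewrite !sq_id1h_hcomp; try beq.
rewrite whiskl; [|bd|bd|bd].
rewrite whiskr; [|bd|bd|bd].
rewrite -(@sqhA _ (pcomp _ _)); try bd.
rewrite -(@sqvA _ (pcomp _ _ <|> _ <|> _)); try bd.
rewrite (@interchange _ (pcomp _ _ <|> _)); try bd.
rewrite -(qhh_hcomp_r (H13 (hsrc g))) idh_sqv; try bd.
rewrite !whiskr; [|bd|bd|bd|bd|bd|bd].
vR.
rewrite (@sqhA _ (Idh _) (pcomp _ _)); try bd.
rewrite (@interchange _ (Idh _) (pcomp _ _ <|> _)); try bd.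
rewrite -(qhh_hcomp_r (H23 (htgt f))) idh_sqv; try bd.
do 2 (rewrite (@whiskl _ _ _ (ph (F1 _ _) _)); [|bd|bd|bd]).
rewrite !sqhA; try bd.
vR; congr (_ </> _); vL; congr (_ </> _ </> _).
rewrite -!(@sqhA _ (Idh _) (Idh _)); try bd.
rewrite -!sq_id1h_hcomp; try beq.
(* The crossing of [f] by [h] and that of [g] by [h'] lie in disjoint columns. *)
by rewrite (exchange (f := ph (F3 (hsrc f) (hsrc g)) h ;h ph (F1 (hsrc g) (htgt h)) f)
  (g := ph (F1 (hsrc g) (hsrc h)) f ;h ph (F3 (htgt f) (hsrc g)) h)
  (h := ph (F3 (htgt f) (hsrc g)) h' ;h ph (F2 (htgt f) (htgt h')) g)
  (k := ph (F2 (htgt f) (hsrc h')) g ;h ph (F3 (htgt f) (htgt g)) h')); try bd.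
Qed.

Lemma curry_hh_hcomp_l f f' g g' h (e : htgt f = hsrc f') (e' : htgt g = hsrc g') :
  Idh (ph (F3 (hsrc f) (hsrc g)) h) <|> glue_comp (H12 (htgt h)) e e' </> curry_hh (f ;h f') (g ;h
    g') h
  = curry_hh f g h <|> Idh (ph (F1 (hsrc g') (htgt h)) f' ;h ph (F2 (htgt f') (htgt h)) g')
   </> (Idh (ph (F1 (hsrc g) (hsrc h)) f ;h ph (F2 (htgt f) (hsrc h)) g) <|> curry_hh f' g' h)
   </> (glue_comp (H12 (hsrc h)) e e' <|> Idh (ph (F3 (htgt f') (htgt g')) h)).
Proof.
rewrite /curry_hh /glue_comp.
have -> : htgt (f ;h f') = htgt f' by beq.
have -> : hsrc (g ;h g') = hsrc g by beq.
(* [sA] and [sB] expand the crossings of [h] with composites, so that the compositors sink below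
   every crossing. *)
have sA : Idh (ph (F3 (hsrc f) (hsrc g)) h) <|> (pcomp (F1 (hsrc g) (htgt h)) e <|>
  pcomp (F2 (htgt f') (htgt h)) e')
  </> (qhh (H13 (hsrc g)) (f ;h f') h <|> Idh (ph (F2 (htgt f') (htgt h)) (g ;h g')))
  = qhh (H13 (hsrc g)) f h <|> Idh (ph (F1 (hsrc g) (htgt h)) f') <|>
    Idh (ph (F2 (htgt f') (htgt h)) g ;h ph (F2 (htgt f') (htgt h)) g')
  </> (Idh (ph (F1 (hsrc g) (hsrc h)) f) <|> qhh (H13 (hsrc g)) f' h <|>
    Idh (ph (F2 (htgt f') (htgt h)) g ;h ph (F2 (htgt f') (htgt h)) g'))
  </> (pcomp (F1 (hsrc g) (hsrc h)) e <|> Idh (ph (F3 (htgt f') (hsrc g)) h) <|>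
    pcomp (F2 (htgt f') (htgt h)) e').
  hL.
  rewrite !(@interchange _ (_ <|> _)); try bd.
  rewrite (@interchange _ (_ </> _)); try bd.
  rewrite -(qhh_hcomp_l (H13 (hsrc g)) h e).
  by rewrite sqv_idh ?idh_sqv; try bd.
have sB : (pcomp (F1 (hsrc g) (hsrc h)) e <|> Idh (ph (F3 (htgt f') (hsrc g)) h) <|>
  pcomp (F2 (htgt f') (htgt h)) e')
  </> (Idh (ph (F1 (hsrc g) (hsrc h)) (f ;h f')) <|> qhh (H23 (htgt f')) (g ;h g') h)
  = Idh (ph (F1 (hsrc g) (hsrc h)) f ;h ph (F1 (hsrc g) (hsrc h)) f') <|>
    (qhh (H23 (htgt f')) g h <|> Idh (ph (F2 (htgt f') (htgt h)) g'))
  </> (Idh (ph (F1 (hsrc g) (hsrc h)) f ;h ph (F1 (hsrc g) (hsrc h)) f') <|>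
    (Idh (ph (F2 (htgt f') (hsrc h)) g) <|> qhh (H23 (htgt f')) g' h))
  </> (pcomp (F1 (hsrc g) (hsrc h)) e <|> (pcomp (F2 (htgt f') (hsrc h)) e' <|>
    Idh (ph (F3 (htgt f') (htgt g')) h))).
  hR.
  rewrite !(@interchange _ _ (_ <|> _)); try bd.
  rewrite (@interchange _ _ (_ </> _)); try bd.
  rewrite -(qhh_hcomp_l (H23 (htgt f')) h e').
  by rewrite sqv_idh ?idh_sqv; try bd.
rewrite whiskl; [|bd|bd|bd].
vR.
rewrite -(@sqvA _ (Idh _ <|> (pcomp _ _ <|> pcomp _ _))); try bd.
rewrite sA.
vR.
rewrite sB.
rewrite !whiskr; [|bd|bd|bd|bd|bd|bd].
rewrite whiskl; [|bd|bd|bd].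
rewrite !sqhA; try bd.
vL; congr (_ </> _).
rewrite !sq_id1h_hcomp; try beq.
hR.
(* [x1] and [x2] slide the crossings at [(f, h)] and [(g', h)] out of the way; those at [f'], [g]
   and [h] become adjacent and [q3_hhh] applies to them. *)
have x1 : Idh (ph (F3 (hsrc f) (hsrc g)) h) <|> (Idh (ph (F1 (hsrc g) (htgt h)) f) <|>
     (qhh (H12 (htgt h)) f' g <|> Idh (ph (F2 (htgt f') (htgt h)) g')))
   </> (qhh (H13 (hsrc g)) f h <|> (Idh (ph (F1 (hsrc g) (htgt h)) f') <|>
     (Idh (ph (F2 (htgt f') (htgt h)) g) <|> Idh (ph (F2 (htgt f') (htgt h)) g'))))
   = qhh (H13 (hsrc g)) f h <|> (Idh (ph (F2 (htgt f) (htgt h)) g) <|>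
     (Idh (ph (F1 (hsrc g') (htgt h)) f') <|> Idh (ph (F2 (htgt f') (htgt h)) g')))
   </> (Idh (ph (F1 (hsrc g) (hsrc h)) f) <|> (Idh (ph (F3 (htgt f) (hsrc g)) h) <|>
     (qhh (H12 (htgt h)) f' g <|> Idh (ph (F2 (htgt f') (htgt h)) g')))).
  rewrite -!(@sqhA _ (Idh _) (Idh _)); try bd.
  rewrite -!sq_id1h_hcomp; try beq.
  symmetry; apply: exchange; bd.
have x2 : Idh (ph (F1 (hsrc g) (hsrc h)) f) <|> (Idh (ph (F2 (htgt f) (hsrc h)) g) <|>
     (Idh (ph (F1 (hsrc g') (hsrc h)) f') <|> qhh (H23 (htgt f')) g' h))
   </> (Idh (ph (F1 (hsrc g) (hsrc h)) f) <|> (qhh (H12 (hsrc h)) f' g <|>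
      (Idh (ph (F2 (htgt f') (hsrc h)) g') <|> Idh (ph (F3 (htgt f') (htgt g')) h))))
   = Idh (ph (F1 (hsrc g) (hsrc h)) f) <|> (qhh (H12 (hsrc h)) f' g <|>
      (Idh (ph (F3 (htgt f') (htgt g)) h) <|> Idh (ph (F2 (htgt f') (htgt h)) g')))
   </> (Idh (ph (F1 (hsrc g) (hsrc h)) f) <|> (Idh (ph (F1 (hsrc g) (hsrc h)) f') <|>
     (Idh (ph (F2 (htgt f') (hsrc h)) g) <|> qhh (H23 (htgt f')) g' h))).
  rewrite -!whiskl; try bd.
  congr (_ <|> _).
  rewrite -!(@sqhA _ (Idh _) (Idh _)); try bd.
  rewrite -!sq_id1h_hcomp; try beq.
  symmetry; apply: exchange; bd.
rewrite x1.
rewrite [RHS]sqvA; try bd.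
rewrite x2.
vL; congr (_ </> _).
vR; congr (_ </> _).
rewrite -!whiskl; try bd.
congr (_ <|> _).
hL.
rewrite -!whiskr; try bd.
congr (_ <|> _).
have := q3_hhh H f' g h; rewrite -e -e' => h0.
rewrite -[LHS]sqvA; try bd.
rewrite -[RHS]sqvA; try bd.
exact: h0.
Qed.

(** Each ternary axiom serves a law in which both factors of [A ** B] move: [q3_vvh] gives vertical
    composition, [q3_hhv] horizontal composition of the [hv] cells, [q3_vhv] and [q3_hvv] their
    naturality, [q3_vhh] and [q3_hvh] the naturality of the interchange cell, and [q3_hhh] its
    multiplicativity. The other laws come from [H13] and [H23] alone. *)
Definition curry : quasi2 (fun z => glue (H12 z)) (fun xy : ob (A ** B) => F3 (fst xy) (snd xy)).
Proof.
refine (@Quasi2 (A ** B) C E _ _ (fun f h => curry_hh (fst f) (snd f) h)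
  (fun f w => curry_hv (fst f) (snd f) w) (fun u h => curry_vh (fst u) (snd u) h)
  _ _ _ _ _ _ _ _ _ _ _ _ _ _ _ _ _ _ _ _ _ _ _ _ _ _ _).
- move=> [x y] z; exact (q3_ob1 x y z).
- move=> [f g] h; exact (curry_hh_glob f g h).
- move=> [f g] w; rewrite /curry_hv /=; bd.
- move=> [f g] w; rewrite /curry_hv /=; bd.
- move=> [f g] w; rewrite /curry_hv /=; bd.
- move=> [f g] w; rewrite /curry_hv /=; bd.
- move=> [u v] h; rewrite /curry_vh /=; bd.
- move=> [u v] h; rewrite /curry_vh /=; bd.
- move=> [u v] h; rewrite /curry_vh /=; bd.
- move=> [u v] h; rewrite /curry_vh /=; bd.
- move=> [u v] w /=.
  have := qvv (H13 (vsrc v)) u w => e1.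
  have := qvv (H23 (vtgt u)) v w => e2.
  rewrite vcompA; try beq. rewrite e2.
  rewrite -vcompA; try beq. rewrite e1.
  rewrite vcompA; beq.
- move=> [f g] z; exact (curry_hh_hid_r f g z).
- move=> [x y] h; exact (curry_hh_hid_l x y h).
- move=> [x y] w; exact (curry_hv_hid x y w).
- move=> [u v] z; exact (curry_vh_hid u v z).
- move=> [f g] z; exact (curry_hv_vid f g z).
- move=> [x y] h; exact (curry_vh_vid x y h).
- move=> [f g] h h' e; exact (curry_hh_hcomp_r f g e).
- move=> [f g] [f' g'] h e; exact (curry_hh_hcomp_l h (f_equal fst e) (f_equal snd e)).
- move=> [f g] [f' g'] w e; exact (curry_hv_hcomp w (f_equal fst e) (f_equal snd e)).
- move=> [u v] h h' e; exact (curry_vh_hcomp u v e).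
- move=> [f g] w w' e; exact: curry_hv_vcomp.
- move=> [u v] [u' v'] h e; exact (curry_vh_vcomp h (f_equal fst e) (f_equal snd e)).
- move=> [f g] c; exact (curry_hh_sq_r f g c).
- move=> [a b] h; exact (curry_hh_sq_l a b h).
- move=> [u v] c; exact (curry_vh_sq u v c).
- move=> [a b] w; exact (curry_hv_sq a b w).
Defined.
End Curry.

(** * Currying in four variables *)

Section Curry4.
Variables (A B C D E : double_category)
    (F1 : ob B -> ob C -> ob D -> psfunctor A E)
    (F2 : ob A -> ob C -> ob D -> psfunctor B E)
    (F3 : ob A -> ob B -> ob D -> psfunctor C E)
    (F4 : ob A -> ob B -> ob C -> psfunctor D E)
  (H12 : forall z w, quasi2 (fun y => F1 y z w) (fun x => F2 x z w))
  (H13 : forall y w, quasi2 (fun z => F1 y z w) (fun x => F3 x y w))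
  (H14 : forall y z, quasi2 (fun w => F1 y z w) (fun x => F4 x y z))
  (H23 : forall x w, quasi2 (fun z => F2 x z w) (fun y => F3 x y w))
  (H24 : forall x z, quasi2 (fun w => F2 x z w) (fun y => F4 x y z))
  (H34 : forall x y, quasi2 (fun w => F3 x y w) (fun z => F4 x y z))
  (H123 : forall w, quasi3_ax (fun z => H12 z w) (fun y => H13 y w) (fun x => H23 x w))
  (H124 : forall z, quasi3_ax (fun w => H12 z w) (fun y => H14 y z) (fun x => H24 x z))
  (H134 : forall y, quasi3_ax (fun w => H13 y w) (fun z => H14 y z) (fun x => H34 x y))
  (H234 : forall x, quasi3_ax (fun w => H23 x w) (fun z => H24 x z) (fun y => H34 x y)).

Lemma q4_ob1 x y z w : pob (F1 y z w) x = pob (F4 x y z) w.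
Proof. exact: (q_ob (H14 y z)). Qed.
Lemma q4_ob2 x y z w : pob (F2 x z w) y = pob (F4 x y z) w.
Proof. exact: (q_ob (H24 x z)). Qed.
Lemma q4_ob3 x y z w : pob (F3 x y w) z = pob (F4 x y z) w.
Proof. exact: (q_ob (H34 x y)). Qed.
Ltac ob_step ::= first [rewrite q4_ob1 | rewrite q4_ob2 | rewrite q4_ob3].

(** Both sides reverse the order of [k], [h] and the pair [f], [g]. The hexagon of [H234] at the
    target of [f] ([x3]) and that of [H134] at the source of [g] ([x4]) combine, once the exchanges
    [x1] and [x2] have brought the cells into position. *)
Lemma curry4_hhh f g h k :
  Idh (ph (F4 (hsrc f) (hsrc g) (hsrc h)) k) <|> curry_hh (fun y => H13 y (htgt k)) (fun x =>
    H23 x (htgt k)) f g h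
  </> (curry_hh (fun y => H14 y (hsrc h)) (fun x => H24 x (hsrc h)) f g k <|>
    Idh (ph (F3 (htgt f) (htgt g) (htgt k)) h))
  </> (Idh (ph (F1 (hsrc g) (hsrc h) (hsrc k)) f ;h ph (F2 (htgt f) (hsrc h) (hsrc k)) g) <|>
    qhh (H34 (htgt f) (htgt g)) h k)
  = qhh (H34 (hsrc f) (hsrc g)) h k <|> Idh (ph (F1 (hsrc g) (htgt h) (htgt k)) f ;h
    ph (F2 (htgt f) (htgt h) (htgt k)) g)
  </> (Idh (ph (F3 (hsrc f) (hsrc g) (hsrc k)) h) <|> curry_hh (fun y => H14 y (htgt h)) (fun x =>
    H24 x (htgt h)) f g k)
  </> (curry_hh (fun y => H13 y (hsrc k)) (fun x => H23 x (hsrc k)) f g h <|>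
    Idh (ph (F4 (htgt f) (htgt g) (htgt h)) k)).
Proof.
rewrite /curry_hh.
rewrite !sq_id1h_hcomp; try beq.
rewrite !whiskl; [|bd|bd|bd|bd|bd|bd].
rewrite !whiskr; [|bd|bd|bd|bd|bd|bd].
vL; hR.
have x1 : Idh (ph (F4 (hsrc f) (hsrc g) (hsrc h)) k) <|>
  (Idh (ph (F1 (hsrc g) (hsrc h) (htgt k)) f) <|> qhh (H23 (htgt f) (htgt k)) g h)
  </> (qhh (H14 (hsrc g) (hsrc h)) f k <|> (Idh (ph (F2 (htgt f) (hsrc h) (htgt k)) g) <|>
    Idh (ph (F3 (htgt f) (htgt g) (htgt k)) h)))
  = qhh (H14 (hsrc g) (hsrc h)) f k <|> (Idh (ph (F3 (htgt f) (hsrc g) (htgt k)) h) <|>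
    Idh (ph (F2 (htgt f) (htgt h) (htgt k)) g))
  </> (Idh (ph (F1 (hsrc g) (hsrc h) (hsrc k)) f) <|>
    (Idh (ph (F4 (htgt f) (hsrc g) (hsrc h)) k) <|> qhh (H23 (htgt f) (htgt k)) g h)).
  rewrite -!(@sqhA _ (Idh _) (Idh _)); try bd.
  rewrite -!sq_id1h_hcomp; try beq.
  symmetry; apply: exchange; bd.
have x2 : qhh (H13 (hsrc g) (hsrc k)) f h <|> (Idh (ph (F4 (htgt f) (hsrc g) (htgt h)) k) <|>
  Idh (ph (F2 (htgt f) (htgt h) (htgt k)) g))
  </> (Idh (ph (F1 (hsrc g) (hsrc h) (hsrc k)) f) <|>
    (Idh (ph (F3 (htgt f) (hsrc g) (hsrc k)) h) <|> qhh (H24 (htgt f) (htgt h)) g k))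
  = Idh (ph (F3 (hsrc f) (hsrc g) (hsrc k)) h) <|> (Idh (ph (F1 (hsrc g) (htgt h) (hsrc k)) f) <|>
    qhh (H24 (htgt f) (htgt h)) g k)
  </> (qhh (H13 (hsrc g) (hsrc k)) f h <|> (Idh (ph (F2 (htgt f) (htgt h) (hsrc k)) g) <|>
    Idh (ph (F4 (htgt f) (htgt g) (htgt h)) k))).
  rewrite -!(@sqhA _ (Idh _) (Idh _)); try bd.
  rewrite -!sq_id1h_hcomp; try beq.
  apply: exchange; bd.
have x3 : Idh (ph (F1 (hsrc g) (hsrc h) (hsrc k)) f) <|>
  (Idh (ph (F4 (htgt f) (hsrc g) (hsrc h)) k) <|> qhh (H23 (htgt f) (htgt k)) g h)
  </> (Idh (ph (F1 (hsrc g) (hsrc h) (hsrc k)) f) <|> (qhh (H24 (htgt f) (hsrc h)) g k <|>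
    Idh (ph (F3 (htgt f) (htgt g) (htgt k)) h)))
  </> (Idh (ph (F1 (hsrc g) (hsrc h) (hsrc k)) f) <|>
    (Idh (ph (F2 (htgt f) (hsrc h) (hsrc k)) g) <|> qhh (H34 (htgt f) (htgt g)) h k))
  = Idh (ph (F1 (hsrc g) (hsrc h) (hsrc k)) f) <|> (qhh (H34 (htgt f) (hsrc g)) h k <|>
    Idh (ph (F2 (htgt f) (htgt h) (htgt k)) g))
  </> (Idh (ph (F1 (hsrc g) (hsrc h) (hsrc k)) f) <|>
    (Idh (ph (F3 (htgt f) (hsrc g) (hsrc k)) h) <|> qhh (H24 (htgt f) (htgt h)) g k))
  </> (Idh (ph (F1 (hsrc g) (hsrc h) (hsrc k)) f) <|> (qhh (H23 (htgt f) (hsrc k)) g h <|>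
    Idh (ph (F4 (htgt f) (htgt g) (htgt h)) k))).
  by rewrite -!whiskl; try bd; rewrite (q3_hhh (H234 (htgt f)) g h k).
have x4 : Idh (ph (F4 (hsrc f) (hsrc g) (hsrc h)) k) <|> (qhh (H13 (hsrc g) (htgt k)) f h <|>
  Idh (ph (F2 (htgt f) (htgt h) (htgt k)) g))
  </> (qhh (H14 (hsrc g) (hsrc h)) f k <|> (Idh (ph (F3 (htgt f) (hsrc g) (htgt k)) h) <|>
    Idh (ph (F2 (htgt f) (htgt h) (htgt k)) g)))
  </> (Idh (ph (F1 (hsrc g) (hsrc h) (hsrc k)) f) <|> (qhh (H34 (htgt f) (hsrc g)) h k <|>
    Idh (ph (F2 (htgt f) (htgt h) (htgt k)) g)))
  = qhh (H34 (hsrc f) (hsrc g)) h k <|> (Idh (ph (F1 (hsrc g) (htgt h) (htgt k)) f) <|>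
    Idh (ph (F2 (htgt f) (htgt h) (htgt k)) g))
  </> (Idh (ph (F3 (hsrc f) (hsrc g) (hsrc k)) h) <|> (qhh (H14 (hsrc g) (htgt h)) f k <|>
    Idh (ph (F2 (htgt f) (htgt h) (htgt k)) g)))
  </> (qhh (H13 (hsrc g) (hsrc k)) f h <|> (Idh (ph (F4 (htgt f) (hsrc g) (htgt h)) k) <|>
    Idh (ph (F2 (htgt f) (htgt h) (htgt k)) g))).
  by hL; rewrite -!whiskr; try bd; rewrite (q3_hhh (H134 (hsrc g)) f h k).
rewrite (@sqvA _ _ (_ <|> (_ <|> qhh (H23 _ _) _ _))); try bd.
rewrite x1; vL.
rewrite (@sqvA _ _ _ (_ <|> (qhh (H24 _ _) _ _ <|> _))); try bd.
rewrite (@sqvA _ _ _ (_ <|> (_ <|> qhh (H34 _ _) _ _))); try bd.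
rewrite x3; vL; rewrite x4.
rewrite (@sqvA _ _ (qhh (H13 _ _) _ _ <|> _)); try bd.
by rewrite x2; vL.
Qed.

Lemma curry4_hvh f g v k :
  curry_hh (fun y => H14 y (vsrc v)) (fun x => H24 x (vsrc v)) f g k
  </> (curry_hv (fun y => H13 y (hsrc k)) (fun x => H23 x (hsrc k)) f g v <|>
    qvh (H34 (htgt f) (htgt g)) v k)
  = qvh (H34 (hsrc f) (hsrc g)) v k <|> curry_hv (fun y => H13 y (htgt k)) (fun x =>
    H23 x (htgt k)) f g v
  </> curry_hh (fun y => H14 y (vtgt v)) (fun x => H24 x (vtgt v)) f g k.
Proof.
rewrite /curry_hh /curry_hv.
have x1 : Idh (ph (F1 (hsrc g) (vsrc v) (hsrc k)) f) <|> qhh (H24 (htgt f) (vsrc v)) g k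
   </> (qhv (H13 (hsrc g) (hsrc k)) f v <|> (qhv (H23 (htgt f) (hsrc k)) g v <|>
     qvh (H34 (htgt f) (htgt g)) v k))
   = qhv (H13 (hsrc g) (hsrc k)) f v <|> (qvh (H34 (htgt f) (hsrc g)) v k <|>
     qhv (H23 (htgt f) (htgt k)) g v)
   </> (Idh (ph (F1 (hsrc g) (vtgt v) (hsrc k)) f) <|> qhh (H24 (htgt f) (vtgt v)) g k).
  rewrite !interchange; try bd.
  rewrite idh_sqv ?sqv_idh; try bd.
  by rewrite (q3_hvh (H234 (htgt f)) g v k).
have x2 : qhh (H14 (hsrc g) (vsrc v)) f k <|> Idh (ph (F2 (htgt f) (vsrc v) (htgt k)) g)
   </> (qhv (H13 (hsrc g) (hsrc k)) f v <|> qvh (H34 (htgt f) (hsrc g)) v k <|>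
     qhv (H23 (htgt f) (htgt k)) g v)
   = qvh (H34 (hsrc f) (hsrc g)) v k <|> qhv (H13 (hsrc g) (htgt k)) f v <|>
     qhv (H23 (htgt f) (htgt k)) g v
   </> (qhh (H14 (hsrc g) (vtgt v)) f k <|> Idh (ph (F2 (htgt f) (vtgt v) (htgt k)) g)).
  rewrite !interchange; try bd.
  rewrite idh_sqv ?sqv_idh; try bd.
  by rewrite (q3_hvh (H134 (hsrc g)) f v k).
hR; vR; rewrite x1; vL; hL; rewrite x2; vR; by hR.
Qed.

Lemma curry4_hhv f g h w :
  curry_hh (fun y => H13 y (vsrc w)) (fun x => H23 x (vsrc w)) f g h
  </> (curry_hv (fun y => H14 y (hsrc h)) (fun x => H24 x (hsrc h)) f g w <|>
    qhv (H34 (htgt f) (htgt g)) h w)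
  = qhv (H34 (hsrc f) (hsrc g)) h w <|> curry_hv (fun y => H14 y (htgt h)) (fun x =>
    H24 x (htgt h)) f g w
  </> curry_hh (fun y => H13 y (vtgt w)) (fun x => H23 x (vtgt w)) f g h.
Proof.
rewrite /curry_hh /curry_hv.
have x1 : Idh (ph (F1 (hsrc g) (hsrc h) (vsrc w)) f) <|> qhh (H23 (htgt f) (vsrc w)) g h
   </> (qhv (H14 (hsrc g) (hsrc h)) f w <|> (qhv (H24 (htgt f) (hsrc h)) g w <|>
     qhv (H34 (htgt f) (htgt g)) h w))
   = qhv (H14 (hsrc g) (hsrc h)) f w <|> (qhv (H34 (htgt f) (hsrc g)) h w <|>
     qhv (H24 (htgt f) (htgt h)) g w)
   </> (Idh (ph (F1 (hsrc g) (hsrc h) (vtgt w)) f) <|> qhh (H23 (htgt f) (vtgt w)) g h).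
  rewrite !interchange; try bd.
  rewrite idh_sqv ?sqv_idh; try bd.
  by rewrite (q3_hhv (H234 (htgt f)) g h w).
have x2 : qhh (H13 (hsrc g) (vsrc w)) f h <|> Idh (ph (F2 (htgt f) (htgt h) (vsrc w)) g)
   </> (qhv (H14 (hsrc g) (hsrc h)) f w <|> qhv (H34 (htgt f) (hsrc g)) h w <|>
     qhv (H24 (htgt f) (htgt h)) g w)
   = qhv (H34 (hsrc f) (hsrc g)) h w <|> qhv (H14 (hsrc g) (htgt h)) f w <|>
     qhv (H24 (htgt f) (htgt h)) g w
   </> (qhh (H13 (hsrc g) (vtgt w)) f h <|> Idh (ph (F2 (htgt f) (htgt h) (vtgt w)) g)).
  rewrite !interchange; try bd.
  rewrite idh_sqv ?sqv_idh; try bd.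
  by rewrite (q3_hhv (H134 (hsrc g)) f h w).
hR; vR; rewrite x1; vL; hL; rewrite x2; vR; by hR.
Qed.

Lemma curry4_vhh u v h k :
  qhh (H34 (vsrc u) (vsrc v)) h k
  </> (curry_vh (fun y => H13 y (hsrc k)) (fun x => H23 x (hsrc k)) u v h <|> curry_vh (fun y =>
    H14 y (htgt h)) (fun x => H24 x (htgt h)) u v k)
  = curry_vh (fun y => H14 y (hsrc h)) (fun x => H24 x (hsrc h)) u v k <|> curry_vh (fun y =>
    H13 y (htgt k)) (fun x => H23 x (htgt k)) u v h
  </> qhh (H34 (vtgt u) (vtgt v)) h k.
Proof.
rewrite /curry_vh -!interchange; try bd.
vL; rewrite (q3_vhh (H134 (vsrc v)) u h k); vR.
by rewrite (q3_vhh (H234 (vtgt u)) v h k).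
Qed.

Lemma curry4_vvh u v w k :
  curry_vh (fun y => H14 y (vsrc w)) (fun x => H24 x (vsrc w)) u v k </>
    qvh (H34 (vtgt u) (vtgt v)) w k
  = qvh (H34 (vsrc u) (vsrc v)) w k </> curry_vh (fun y => H14 y (vtgt w)) (fun x =>
    H24 x (vtgt w)) u v k.
Proof.
rewrite /curry_vh; vR; rewrite (q3_vvh (H234 (vtgt u)) v w k).
by vL; rewrite (q3_vvh (H134 (vsrc v)) u w k).
Qed.

Lemma curry4_vhv u v h w :
  curry_vh (fun y => H13 y (vsrc w)) (fun x => H23 x (vsrc w)) u v h </>
    qhv (H34 (vtgt u) (vtgt v)) h w
  = qhv (H34 (vsrc u) (vsrc v)) h w </> curry_vh (fun y => H13 y (vtgt w)) (fun x =>
    H23 x (vtgt w)) u v h.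
Proof.
rewrite /curry_vh; vR; rewrite (q3_vhv (H234 (vtgt u)) v h w).
by vL; rewrite (q3_vhv (H134 (vsrc v)) u h w).
Qed.

Lemma curry4_hvv f g v w :
  curry_hv (fun y => H13 y (vsrc w)) (fun x => H23 x (vsrc w)) f g v </> curry_hv (fun y =>
    H14 y (vtgt v)) (fun x => H24 x (vtgt v)) f g w
  = curry_hv (fun y => H14 y (vsrc v)) (fun x => H24 x (vsrc v)) f g w </> curry_hv (fun y =>
    H13 y (vtgt w)) (fun x => H23 x (vtgt w)) f g v.
Proof.
rewrite /curry_hv !interchange; try bd.
by rewrite (q3_hvv (H134 (hsrc g)) f v w) (q3_hvv (H234 (htgt f)) g v w).
Qed.

(** [H123] and [H124] supply the two curried quasi-functors; each of the seven axioms is then the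
    axiom of [H134] for the first factor pasted with that of [H234] for the second. *)
Lemma curry4_ax : quasi3_ax (A := A ** B) (fun w => curry (H123 w)) (fun z => curry (H124 z))
   (fun xy => H34 (fst xy) (snd xy)).
Proof.
split.
- move=> [f g]; exact (curry4_hhh f g).
- move=> [f g]; exact (curry4_hvh f g).
- move=> [f g]; exact (curry4_hhv f g).
- move=> [u v]; exact (curry4_vhh u v).
- move=> [u v]; exact (curry4_vvh u v).
- move=> [u v]; exact (curry4_vhv u v).
- move=> [f g]; exact (curry4_hvv f g).
Qed.

End Curry4.

(** * Squares over a pseudofunctor *)

Section Inverse.
Variable D : double_category.
Implicit Types (f g : hcell D) (a b : sq D).

(* Unspecified when [a] has no vertical inverse. *)
Definition vinv a : sq D := epsilon (inhabits a) (fun b =>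
  bot a = top b /\ bot b = top a /\ a </> b = Idh (top a) /\ b </> a = Idh (bot a)).

Lemma vinvP f g a : inv_globular f g a ->
  a </> vinv a = Idh f /\ vinv a </> a = Idh g /\
  inv_globular g f (vinv a).
Proof.
move=> ig; case: (ig) => ta ba la ra ex.
have := epsilon_spec (inhabits a) _ ex; rewrite -/(vinv a) => -[e1 [e2 [e3 e4]]].
rewrite -ta -ba; split => //; split => //.
have ht : htgt (bot a) = htgt (top a) by rewrite htgt_bot htgt_top ra vsrc_vid vtgt_vid.
have hs : hsrc (bot a) = hsrc (top a) by rewrite hsrc_bot hsrc_top la vsrc_vid vtgt_vid.
split => //.
- move: (lft_sqv e1); rewrite e3 lft_id1h la -ta vid_compl; last by rewrite -hsrc_top -e1 hs.
  by rewrite hs => ->.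
- move: (rgt_sqv e1); rewrite e3 rgt_id1h ra -ta vid_compl; last by rewrite -htgt_top -e1 ht.
  by rewrite ht => ->.
- by exists a; rewrite -e1 e2.
Qed.

(** The standard way to compare squares below: paste an invertible globular square underneath both,
    so that its inverse need not be manipulated. *)
Lemma vinv_cancel f g a x y : inv_globular f g a -> bot x = top a -> bot y = top a ->
  x </> a = y </> a -> x = y.
Proof.
move=> ig ex ey e; have [e1 [e2 e3]] := vinvP ig.
have ev : bot a = top (vinv a) by rewrite (ig_bot ig) (ig_top e3).
rewrite -(sqv1r x) -(sqv1r y) ex ey (ig_top ig) -e1 -!sqvA //; congruence.
Qed.
End Inverse.

Lemma pcomp_hid_l (A B : double_category) (P : psfunctor A B) x f (e : htgt (hid x) = hsrc f) :
  x = hsrc f -> punit P x <|> Idh (ph P f) </> pcomp P e = Idh (ph P f).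
Proof. by move=> ex; subst; exact: pcomp1l. Qed.

Section Over.
Variables (X E : double_category) (P : psfunctor X E).
Implicit Types (f g : hcell X) (a b : sq X) (s t : sq E) (l m : list (hcell X)).

(** The starting object is an argument because the empty list does not determine one. Composability
    is recorded apart, in [is_path]. *)
Fixpoint pathX x l : hcell X :=
  match l with [] => hid x | f :: l' => f ;h pathX (htgt f) l' end.
Fixpoint pathE x l : hcell E :=
  match l with [] => hid (pob P x) | f :: l' => ph P f ;h pathE (htgt f) l' end.
Fixpoint is_path x l y :=
  match l with [] => x = y | f :: l' => hsrc f = x /\ is_path (htgt f) l' y end.

(* The second branch is a junk value: totality lets [path_comp] recurse on bare lists. *)
Definition pcomp_total f g : sq E :=
  match excluded_middle_informative (htgt f = hsrc g) with
  | left e => pcomp P e | right _ => Idh (ph P f) end.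

Lemma pcomp_totalE f g (e : htgt f = hsrc g) : pcomp_total f g = pcomp P e.
Proof.
rewrite /pcomp_total; case: excluded_middle_informative => [e'|//]; exact: pcomp_irr.
Qed.

(** Ending every list with a unitor keeps the recursion uniform; on a singleton [pcomp1r] cancels
    it, see [path_comp1]. *)
Fixpoint path_comp x l : sq E :=
  match l with
  | [] => punit P x
  | f :: l' => Idh (ph P f) <|> path_comp (htgt f) l' </> pcomp_total f (pathX (htgt f) l')
  end.

Lemma pathX_ends x l y : is_path x l y -> hsrc (pathX x l) = x /\ htgt (pathX x l) = y.
Proof.
elim: l x => [|f l IH] x /=; first by move=> ->; rewrite hsrc_hid htgt_hid.
by move=> [<- /IH [e1 e2]]; rewrite hsrc_hcomp ?htgt_hcomp.
Qed.

Lemma pathE_ends x l y : is_path x l y -> hsrc (pathE x l) = pob P x /\ htgt (pathE x l) = pob P y.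
Proof.
elim: l x => [|f l IH] x /=; first by move=> ->; rewrite hsrc_hid htgt_hid.
by move=> [<- /IH [e1 e2]]; rewrite hsrc_hcomp ?htgt_hcomp ?ph_src ?ph_tgt ?e1 ?e2.
Qed.

Lemma is_path_cat x l y m z : is_path x l y -> is_path y m z -> is_path x (l ++ m) z.
Proof.
elim: l x => [|f l IH] x /=; first by move=> ->.
by move=> [-> /IH h] /h.
Qed.

Lemma pathX_cat x l y m z : is_path x l y -> is_path y m z -> pathX x (l ++ m) = pathX x l ;h
  pathX y m.
Proof.
move=> wl wm; have [e1 e2] := pathX_ends wm.
elim: l x wl => [|f l IH] x /=; first by move=> ->; rewrite hid_compl.
move=> [_ wl]; have [e3 e4] := pathX_ends wl.
by rewrite (IH _ wl) hcompA ?e3 ?e4 ?e1.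
Qed.

Lemma pathE_cat x l y m z : is_path x l y -> is_path y m z -> pathE x (l ++ m) = pathE x l ;h
  pathE y m.
Proof.
move=> wl wm; have [e1 e2] := pathE_ends wm.
elim: l x wl => [|f l IH] x /=; first by move=> ->; rewrite hid_compl.
move=> [_ wl]; have [e3 e4] := pathE_ends wl.
by rewrite (IH _ wl) hcompA ?ph_tgt ?e3 ?e4 ?e1.
Qed.

Lemma path_comp_glob x l y : is_path x l y -> inv_globular (pathE x l) (ph P (pathX x l))
  (path_comp x l).
Proof.
elim: l x => [|f l IH] x /=; first by move=> _; exact: punit_glob.
move=> [_ wl]; have [e3 e4] := pathX_ends wl; have [e5 e6] := pathE_ends wl.
rewrite (pcomp_totalE (eq_sym e3)).
apply: inv_globular_sqv (pcomp_glob P (eq_sym e3)).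
by apply: inv_globular_sqh (inv_globular_idh _) (IH _ wl) _; rewrite ph_tgt e5.
Qed.

Lemma boundary_path_comp x l y : is_path x l y ->
  boundary (path_comp x l) (pathE x l) (ph P (pathX x l)) (vid (pob P x)) (vid (pob P y)).
Proof.
move=> wl; have [e5 e6] := pathE_ends wl.
by have := boundary_ig (path_comp_glob wl); rewrite e5 e6.
Qed.

(** This is the coherence theorem in the form that is needed: the induction step is [pcompA], and
    the empty list is the left unit law. *)
Lemma path_comp_cat x l y m z : is_path x l y -> is_path y m z ->
  path_comp x (l ++ m) = path_comp x l <|> path_comp y m </> pcomp_total (pathX x l) (pathX y m).
Proof.
move=> wl wm; have [e1 e2] := pathX_ends wm; have [e1' e2'] := pathE_ends wm.
have tm := boundary_path_comp wm.
elim: l x wl => [|f l IH] x /=.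
  move=> ->.
  have e : htgt (hid y) = hsrc (pathX y m) by rewrite htgt_hid e1.
  rewrite (pcomp_totalE e).
  transitivity (path_comp y m </> (punit P y <|> Idh (ph P (pathX y m)) </> pcomp P e)).
    by rewrite pcomp_hid_l // sqv_idh; bd.
  rewrite -sqvA; try bd.
  congr (_ </> _).
  transitivity ((Idh (hid (pob P y)) </> punit P y) <|> (path_comp y m </> Idh (ph P (pathX y m)))).
    rewrite -interchange; try bd.
    by rewrite -sq_id1v_vid idv_sqh; bd.
  by rewrite idh_sqv ?sqv_idh; bd.
move=> [_]; remember (htgt f) as x1 eqn:ex; symmetry in ex => wl.
have [e3 e4] := pathX_ends wl; have [e3' e4'] := pathE_ends wl.
have tl := boundary_path_comp wl.
have hl : htgt f = hsrc (pathX x1 l) by rewrite e3.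
have hm : htgt (pathX x1 l) = hsrc (pathX y m) by rewrite e1 e4.
have h1 : htgt f = hsrc (pathX x1 l ;h pathX y m) by rewrite hsrc_hcomp.
have h2 : htgt (f ;h pathX x1 l) = hsrc (pathX y m) by rewrite htgt_hcomp.
rewrite (IH _ wl) (pathX_cat wl wm) (pcomp_totalE hl) (pcomp_totalE hm) (pcomp_totalE h1)
  (pcomp_totalE h2).
rewrite whiskl; [|bd|bd|bd].
have -> : (Idh (ph P f) <|> path_comp x1 l </> pcomp P hl) <|> path_comp y m =
  (Idh (ph P f) <|> path_comp x1 l <|> path_comp y m) </> (pcomp P hl <|> Idh (ph P (pathX y m))).
  by rewrite interchange ?sqv_idh; bd.
rewrite !sqvA; try bd.
rewrite (pcompA _ hl hm h2 h1).
by rewrite -!sqhA; bd.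
Qed.

(* [s] lies over [a] when the iterated compositors along [l] and [m] carry [s] to [psq P a].  These
   compositors are invertible, so [s] is determined by [a], and an equation between pastings of such
   squares follows from the equation between the squares of [X] underneath. *)
Record over x l y m s a : Prop := Over {
  ov_path : is_path x l (vsrc (rgt a));
  ov_path' : is_path y m (vtgt (rgt a));
  ov_top : top s = pathE x l;
  ov_bot : bot s = pathE y m;
  ov_lft : lft s = pv P (lft a);
  ov_rgt : rgt s = pv P (rgt a);
  ov_topX : top a = pathX x l;
  ov_botX : bot a = pathX y m;
  ov_eq : s </> path_comp y m = path_comp x l </> psq P a }.

(** [path_comp_cat] splits both iterated compositors at the seam, and [pcomp_nat] carries the
    remaining compositor past [psq P]. *)
Lemma over_sqh x l y m s a x' l' y' m' t b :
  over x l y m s a -> over x' l' y' m' t b -> rgt a = lft b ->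
  over x (l ++ l') y (m ++ m') (s <|> t) (a <|> b).
Proof.
move=> [w1 w2 o1 o2 o3 o4 o5 o6 o7] [w1' w2' o1' o2' o3' o4' o5' o6' o7'] e.
have [p1 p2] := pathX_ends w1; have [p3 p4] := pathX_ends w2.
have [q1 q2] := pathE_ends w1; have [q3 q4] := pathE_ends w2.
have [p1' p2'] := pathX_ends w1'; have [p3' p4'] := pathX_ends w2'.
have [q1' q2'] := pathE_ends w1'; have [q3' q4'] := pathE_ends w2'.
have t1 := boundary_path_comp w1; have t2 := boundary_path_comp w2.
have t1' := boundary_path_comp w1'; have t2' := boundary_path_comp w2'.
have ex : vsrc (rgt a) = x' by rewrite e -p1' -o5' hsrc_top.
have ey : vtgt (rgt a) = y' by rewrite e -p3' -o6' hsrc_bot.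
have est : rgt s = lft t by rewrite o3' o4 e.
move: w1 w2 p2 p4 q2 q4 t1 t2; rewrite ex ey => w1 w2 p2 p4 q2 q4 t1 t2.
have h1 : htgt (pathX x l) = hsrc (pathX x' l') by rewrite p1'.
have h2 : htgt (pathX y m) = hsrc (pathX y' m') by rewrite p3'.
split; rewrite ?top_sqh ?bot_sqh ?lft_sqh ?rgt_sqh //.
- exact: is_path_cat w1 w1'.
- exact: is_path_cat w2 w2'.
- by rewrite (pathE_cat w1 w1') o1 o1'.
- by rewrite (pathE_cat w2 w2') o2 o2'.
- by rewrite (pathX_cat w1 w1') o5 o5'.
- by rewrite (pathX_cat w2 w2') o6 o6'.
have ts : boundary s (pathE x l) (pathE y m) (pv P (lft a)) (pv P (rgt a)) by [].
have tt : boundary t (pathE x' l') (pathE y' m') (pv P (lft b)) (pv P (rgt b)) by [].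
rewrite (path_comp_cat w1 w1') (path_comp_cat w2 w2') (pcomp_totalE h1) (pcomp_totalE h2).
have h1' : htgt (top a) = hsrc (top b) by rewrite o5 o5'.
have h2' : htgt (bot a) = hsrc (bot b) by rewrite o6 o6'.
have := pcomp_nat P h1' h2' e.
move: h1' h2'; rewrite o5 o5' o6 o6' => h1' h2'.
rewrite (pcomp_irr P h1' h1) (pcomp_irr P h2' h2) => en.
have ta : boundary (psq P a) (ph P (pathX x l)) (ph P (pathX y m)) (pv P (lft a)) (pv P (rgt a)).
  by rewrite -o5 -o6; exact: boundary_psq.
have tb : boundary (psq P b) (ph P (pathX x' l')) (ph P (pathX y' m')) (pv P (lft b))
  (pv P (rgt b)).
  by rewrite -o5' -o6'; exact: boundary_psq.
have tab : boundary (psq P (a <|> b)) (ph P (pathX x l ;h pathX x' l')) (ph P (pathX y m ;h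
  pathX y' m')) (pv P (lft a)) (pv P (rgt b)).
  by rewrite -o5 -o6 -o5' -o6' -top_sqh // -bot_sqh // -(lft_sqh e) -(rgt_sqh e); exact:
    boundary_psq.
rewrite -sqvA; [|bd|bd].
rewrite interchange; [|bd|bd|bd|bd].
rewrite o7 o7' [RHS]sqvA; [|bd|bd].
rewrite en -sqvA; [|bd|bd].
by rewrite interchange; [|bd|bd|bd|bd].
Qed.

Lemma over_sqv x l y m s a z n t b :
  over x l y m s a -> over y m z n t b -> over x l z n (s </> t) (a </> b).
Proof.
move=> [w1 w2 o1 o2 o3 o4 o5 o6 o7] [w1' w2' o1' o2' o3' o4' o5' o6' o7'].
have e : bot a = top b by rewrite o6 o5'.
have e' : bot s = top t by rewrite o2 o1'.
have er : vtgt (rgt a) = vsrc (rgt b) by rewrite -htgt_bot e htgt_top.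
have el : vtgt (lft a) = vsrc (lft b) by rewrite -hsrc_bot e hsrc_top.
have t1 := boundary_path_comp w1; have t2 := boundary_path_comp w2.
have t1' := boundary_path_comp w1'; have t2' := boundary_path_comp w2'.
split; rewrite ?top_sqv ?bot_sqv ?lft_sqv ?rgt_sqv ?vsrc_vcomp ?vtgt_vcomp ?pv_vcomp //;
  try by rewrite ?o3 ?o3' ?o4 ?o4'.
have hb : bot t = top (path_comp z n) by rewrite o2'; case: t2'.
have hb2 : top (psq P b) = ph P (pathX y m) by rewrite psq_top o5'.
have hb3 : top (psq P a) = ph P (pathX x l) by rewrite psq_top o5.
have hb4 : bot (psq P a) = top (psq P b) by rewrite psq_bot psq_top e.
have k1 : bot s = top (path_comp y m) by rewrite o2; case: t2.
have k2 : bot (path_comp y m) = top (psq P b) by rewrite hb2; case: t1' => _ [].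
have k3 : bot (path_comp x l) = top (psq P a) by rewrite hb3; case: t1 => _ [].
by rewrite psq_sqv // sqvA // o7' -sqvA // o7 sqvA.
Qed.

Lemma over_unique x l y m s t a : over x l y m s a -> over x l y m t a -> s = t.
Proof.
move=> [w1 w2 o1 o2 o3 o4 o5 o6 o7] [w1' w2' o1' o2' o3' o4' o5' o6' o7'].
have [e _ _ _ _] := path_comp_glob w2.
apply: (vinv_cancel (path_comp_glob w2)); rewrite ?o2 ?o2' ?o7 ?o7' //.
Qed.

Lemma path_comp1 f : path_comp (hsrc f) [f] = Idh (ph P f).
Proof.
have e : htgt f = hsrc (hid (htgt f)) by rewrite hsrc_hid.
by rewrite /= (pcomp_totalE e) pcomp1r.
Qed.

Lemma pathX1 f : pathX (hsrc f) [f] = f.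
Proof. by rewrite /= hcomp1r. Qed.

Lemma pathE1 f : pathE (hsrc f) [f] = ph P f.
Proof. by rewrite /= -ph_tgt hcomp1r. Qed.

Lemma over_psq a : over (hsrc (top a)) [top a] (hsrc (bot a)) [bot a] (psq P a) a.
Proof.
split; rewrite ?pathX1 ?pathE1 ?psq_top ?psq_bot ?psq_lft ?psq_rgt //.
- by rewrite /= htgt_top.
- by rewrite /= htgt_bot.
- by rewrite !path_comp1 idh_sqv ?sqv_idh ?psq_top ?psq_bot.
Qed.

Lemma over_idh f : over (hsrc f) [f] (hsrc f) [f] (Idh (ph P f)) (Idh f).
Proof. by have := over_psq (Idh f); rewrite psq_id1h top_id1h bot_id1h. Qed.

Lemma path_comp2 f g (e : htgt f = hsrc g) : path_comp (hsrc f) [f; g] = pcomp P e.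
Proof.
have -> : [f; g] = [f] ++ [g] by [].
have wf1 : is_path (hsrc f) [f] (htgt f) by [].
have wg : is_path (htgt f) [g] (htgt g) by [].
rewrite (path_comp_cat wf1 wg) pathX1 path_comp1 e path_comp1 pathX1 (pcomp_totalE e).
rewrite -sq_id1h_hcomp ?ph_src ?ph_tgt ?e // idh_sqv //; bd.
Qed.

(** Compositors and, in [over_punit], unitors lie over identities, hence they vanish from an
    equation once it has descended to [X]. *)
Lemma over_pcomp f g (e : htgt f = hsrc g) :
  over (hsrc f) [f; g] (hsrc (f ;h g)) [f ;h g] (pcomp P e) (Idh (f ;h g)).
Proof.
have [t1 [t2 [t3 t4]]] := boundary_pcomp P e.
split; rewrite ?pathX1 ?pathE1 ?path_comp1 ?(path_comp2 e) ?t1 ?t2 ?t3 ?t4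
  ?top_id1h ?bot_id1h ?lft_id1h ?rgt_id1h ?psq_id1h ?pv_vid ?vsrc_vid ?vtgt_vid /=
  ?hsrc_hcomp ?htgt_hcomp ?e ?hcomp1r //.
by rewrite -ph_tgt hcomp1r.
Qed.

Lemma over_punit x : over x [] x [hid x] (punit P x) (Idh (hid x)).
Proof.
have := pathX1 (hid x); have := pathE1 (hid x); have := path_comp1 (hid x); rewrite hsrc_hid =>
  e1 e2 e3.
have [t1 [t2 [t3 t4]]] := boundary_punit P x.
split; rewrite ?e1 ?e2 ?e3 ?t1 ?t2 ?t3 ?t4 ?top_id1h ?bot_id1h ?lft_id1h ?rgt_id1h ?psq_id1h
  ?pv_vid ?vsrc_vid ?vtgt_vid ?hsrc_hid ?htgt_hid //=; rewrite ?hsrc_hid ?htgt_hid //.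
Qed.

Lemma over_idv u : over (vsrc u) [] (vtgt u) [] (Idv (pv P u)) (Idv u).
Proof.
by split; rewrite ?top_id1v ?bot_id1v ?lft_id1v ?rgt_id1v ?pv_src ?pv_tgt //= punit_nat.
Qed.

(** By [over_unique] this conjugate is the only candidate for a square over [a] along the given
    factorisations; it provides the interchange cells of the composite quasi-functor. *)
Definition push_sq (l m : list (hcell X)) a : sq E :=
  path_comp (hsrc (top a)) l </> psq P a </> vinv (path_comp (hsrc (bot a)) m).

Lemma over_push_sq l m a :
  is_path (hsrc (top a)) l (htgt (top a)) -> is_path (hsrc (bot a)) m (htgt (bot a)) ->
  top a = pathX (hsrc (top a)) l -> bot a = pathX (hsrc (bot a)) m ->
  over (hsrc (top a)) l (hsrc (bot a)) m (push_sq l m a) a.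
Proof.
rewrite /push_sq; move: (hsrc (top a)) (hsrc (bot a)) => x y w1 w2 e1 e2.
have t1 := boundary_path_comp w1; have t2 := boundary_path_comp w2.
have [i1 [i2 i3]] := vinvP (path_comp_glob w2).
have t3 : boundary (vinv (path_comp y m)) (ph P (pathX y m)) (pathE y m) (vid (pob P y))
  (vid (pob P (htgt (bot a)))).
  have [k1 k2] := pathX_ends w2.
  by have := boundary_ig i3; rewrite ph_src ph_tgt k1 k2.
have t4 : boundary (psq P a) (ph P (pathX x l)) (ph P (pathX y m)) (pv P (lft a)) (pv P (rgt a)).
  by rewrite -e1 -e2; exact: boundary_psq.
have [h1 h2] := pathX_ends w1; have [h3 h4] := pathX_ends w2.
have hl : x = vsrc (lft a) by rewrite -h1 -e1 hsrc_top.
have hl' : vtgt (lft a) = y by rewrite -h3 -e2 hsrc_bot.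
split; rewrite -?htgt_top -?htgt_bot //; try bd.
- eapply boundary_lft; [typ|]. by rewrite !hl -hl' vid_compl ?pv_src // vid_compr ?pv_tgt.
rewrite sqvA; [|bd|bd].
by rewrite i2 sqv_idh; bd.
Qed.

End Over.

(** In this lemma and the next two, indices that should coincide are related by equations: the
    tactic [ov] produces them only up to normalisation, where unification would fail. *)
Lemma over_sqv_eq (X E : double_category) (P : psfunctor X E) x l y m s a y' m' z n t b :
  over P x l y m s a -> over P y' m' z n t b -> y = y' -> m = m' ->
  over P x l z n (s </> t) (a </> b).
Proof. by move=> o o' e e'; subst; exact: over_sqv o o'. Qed.

Lemma over_eq (X E : double_category) (P : psfunctor X E) x l y m s a x' l' y' m' t b :
  over P x l y m s a -> over P x' l' y' m' t b -> a = b -> x = x' -> l = l' -> y = y' -> m = m' ->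
  s = t.
Proof. by move=> o o' *; subst; exact: over_unique o o'. Qed.

Lemma over_conv (X E : double_category) (P : psfunctor X E) x l y m s a x' l' y' m' b :
  over P x l y m s a -> a = b -> x = x' -> l = l' -> y = y' -> m = m' -> over P x' l' y' m' s b.
Proof. by move=> o *; subst. Qed.

Lemma over_idp (X E : double_category) (P : psfunctor X E) x l y : is_path x l y ->
  over P x l x l (Idh (pathE P x l)) (Idh (pathX x l)).
Proof.
move=> w; have [e1 e2] := pathX_ends w; have [e3 e4] := pathE_ends P w.
have t := boundary_path_comp P w.
split; rewrite ?psq_id1h; try bd.
- by rewrite !lft_id1h pv_vid e3 e1.
- by rewrite !rgt_id1h pv_vid e4 e2.
- by rewrite idh_sqv ?sqv_idh; bd.
Qed.

Lemma over_idh2 (X E : double_category) (P : psfunctor X E) f g : htgt f = hsrc g ->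
  over P (hsrc f) [f; g] (hsrc f) [f; g] (Idh (ph P f ;h ph P g)) (Idh (f ;h g)).
Proof.
move=> e; have w : is_path (hsrc f) [f; g] (htgt g) by [].
have := over_idp P w; rewrite /= -ph_tgt !hcomp1r //.
Qed.

Lemma over_psq_boundary (X E : double_category) (P : psfunctor X E) a f g u v :
  boundary a f g u v ->
  over P (hsrc f) [f] (hsrc g) [g] (psq P a) a.
Proof. by move=> [<- [<- _]]; exact: over_psq. Qed.

Ltac ov_atom := fail.
Ltac ov := lazymatch goal with
 | |- over _ _ _ _ _ (_ <|> _) _ => eapply over_sqh; [ov|ov|bd]
 | |- over _ _ _ _ _ (_ </> _) _ => eapply over_sqv_eq; [ov|ov|beq|beq]
 | |- over _ _ _ _ _ (Idh (_ ;h _)) _ => eapply over_idh2; beq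
 | |- over _ _ _ _ _ (Idh _) _ => eapply over_idh
 | |- over _ _ _ _ _ (Idv _) _ => eapply over_idv
 | |- over _ _ _ _ _ (psq _ _) _ => eapply over_psq_boundary; typ
 | |- _ => ov_atom
 end.
(** [ov] shows, by recursion on a pasting in [E], that it lies over the parallel pasting in [X].
    Applied to both sides of an equation, it leaves the corresponding equation in [X]. *)
Ltac by_over P := eapply (@over_eq _ _ P); [ov|ov| |beq|beq|beq|beq].

Lemma psq_glob (X E : double_category) (P : psfunctor X E) f g a :
  inv_globular f g a -> inv_globular (ph P f) (ph P g) (psq P a).
Proof.
move=> [t b l r [c [c1 [c2 [c3 c4]]]]].
split; rewrite ?psq_top ?psq_bot ?psq_lft ?psq_rgt ?t ?b ?l ?r ?pv_vid ?ph_src ?ph_tgt //.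
by exists (psq P c); rewrite !psq_top !psq_bot -!psq_sqv // c3 c4 !psq_id1h -c1 c2 ?b ?t.
Qed.

(** * Composition with a pseudofunctor *)

Section Compose.
Variables (A X E : double_category) (F : psfunctor A X) (P : psfunctor X E).

Definition comp_pcomp f g (e : htgt f = hsrc g) : sq E :=
  pcomp P (eq_trans (ph_tgt F f) (eq_trans (f_equal (pob F) e) (eq_sym (ph_src F g)))) </>
    psq P (pcomp F e).
Definition comp_punit x : sq E := punit P (pob F x) </> psq P (punit F x).

(** The factor [pcomp P] lies over an identity, so the composite compositor lies over that of [F].
    The coherence axioms of [comp_ps] thereby reduce to those of [F]. *)
Lemma over_comp_pcomp f g (e : htgt f = hsrc g) :
  over P (hsrc (ph F f)) [ph F f; ph F g] (hsrc (ph F (f ;h g))) [ph F (f ;h g)]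
    (comp_pcomp e) (pcomp F e).
Proof.
rewrite /comp_pcomp; eapply over_conv.
  eapply over_sqv_eq; [eapply over_pcomp|eapply over_psq_boundary; typ|beq|beq].
all: try beq.
by rewrite idh_sqv; bd.
Qed.

Lemma over_comp_punit x :
  over P (pob F x) [] (hsrc (ph F (hid x))) [ph F (hid x)] (comp_punit x) (punit F x).
Proof.
rewrite /comp_punit; eapply over_conv.
  eapply over_sqv_eq; [eapply over_punit|eapply over_psq_boundary; typ|beq|beq].
all: try beq.
by rewrite idh_sqv; bd.
Qed.
Ltac ov_atom ::= lazymatch goal with
 | |- over _ _ _ _ _ (comp_pcomp _) _ => apply over_comp_pcomp
 | |- over _ _ _ _ _ (comp_punit _) _ => apply over_comp_punit
 end.

Definition comp_ps : psfunctor A E.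
Proof.
refine (@PsFunctor A E (fun x => pob P (pob F x)) (fun f => ph P (ph F f)) (fun u => pv P (pv F u))
 (fun a => psq P (psq F a)) comp_pcomp comp_punit _ _ _ _ _ _ _ _ _ _ _ _ _ _ _ _ _ _ _).
- move=> f; beq.
- move=> f; beq.
- move=> f; beq.
- move=> f; beq.
- move=> f; bd.
- move=> f; bd.
- move=> f; bd.
- move=> f; bd.
- by move=> x; rewrite !pv_vid.
- by move=> u v e; rewrite !pv_vcomp ?pv_src ?pv_tgt ?e.
- by move=> f; rewrite !psq_id1h.
- by move=> a b e; rewrite !psq_sqv ?psq_bot ?psq_top ?e.
- move=> f g e; apply: inv_globular_sqv; [exact: pcomp_glob | exact/psq_glob/pcomp_glob].
- move=> x; apply: inv_globular_sqv; [exact: punit_glob | exact/psq_glob/punit_glob].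
- move=> a b e e' er; by_over P; exact: pcomp_nat.
- move=> u; by_over P; exact: punit_nat.
- move=> f g h e1 e2 e12 e21; by_over P; exact: pcompA.
- move=> f e; by_over P; exact: pcomp1l.
- move=> f e; by_over P; exact: pcomp1r.
Defined.
End Compose.

Ltac by_overp P := cbn [ph pv psq pob pcomp punit comp_ps]; by_over P.

Section Push.
Variables (A B X E : double_category) (F : ob B -> psfunctor A X) (G : ob A -> psfunctor B X).
Variables (P : psfunctor X E) (H : quasi2 F G).
Ltac ob_step ::= rewrite (q_ob H).

(** [psq P (qhh H K k)] runs between images of composites; compositors of [P] must be pasted on both
    ends to reach composites of images. *)
Definition push_hh K k : sq E :=
  push_sq P [ph (G (hsrc K)) k; ph (F (htgt k)) K] [ph (F (hsrc k)) K; ph (G (htgt K)) k]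
    (qhh H K k).

Lemma over_push_hh K k :
  over P (hsrc (ph (G (hsrc K)) k)) [ph (G (hsrc K)) k; ph (F (htgt k)) K]
    (hsrc (ph (F (hsrc k)) K)) [ph (F (hsrc k)) K; ph (G (htgt K)) k] (push_hh K k) (qhh H K k).
Proof.
have [t [b [l r]]] := boundary_qhh H K k.
have e1 : hsrc (top (qhh H K k)) = pob (G (hsrc K)) (hsrc k) by rewrite hsrc_top l vsrc_vid.
have e2 : hsrc (bot (qhh H K k)) = pob (G (hsrc K)) (hsrc k) by rewrite hsrc_bot l vtgt_vid.
have e3 : htgt (top (qhh H K k)) = pob (G (htgt K)) (htgt k) by rewrite htgt_top r vsrc_vid.
have e4 : htgt (bot (qhh H K k)) = pob (G (htgt K)) (htgt k) by rewrite htgt_bot r vtgt_vid.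
eapply over_conv; [eapply over_push_sq; rewrite ?e1 ?e2 ?e3 ?e4 /=| | | | |];
  rewrite ?e1 ?e2 ?t ?b //; try beq.
all: by split; [beq|split; beq].
Qed.

Lemma push_hh_glob K k : inv_globular
  (ph P (ph (G (hsrc K)) k) ;h ph P (ph (F (htgt k)) K))
  (ph P (ph (F (hsrc k)) K) ;h ph P (ph (G (htgt K)) k)) (push_hh K k).
Proof.
have ig := qhh_glob H K k.
have [w1 w2 ot ob _ _ otX obX _] := over_push_hh K k.
move: w1 w2 ot ob otX obX; rewrite /push_hh /push_sq.
set l := [_; _]; set m := [_; _]; set x := hsrc _; set y := hsrc _ => w1 w2.
have ex : hsrc (top (qhh H K k)) = x by rewrite (ig_top ig) /x; beq.
have ey : hsrc (bot (qhh H K k)) = y by rewrite (ig_bot ig) /y; beq.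
rewrite ex ey => ot ob otX obX.
have [_ [_ i3]] := vinvP (path_comp_glob P w2).
eapply inv_globular_conv.
  apply: (inv_globular_sqv (g := ph P (pathX y m))); first apply: inv_globular_sqv.
  - exact: path_comp_glob w1.
  - rewrite -otX -obX; apply: psq_glob; rewrite (ig_top ig) (ig_bot ig); exact: ig.
  - exact: i3.
- by rewrite /x /l /= -ph_tgt hcomp1r.
- by rewrite /y /m /= -ph_tgt hcomp1r.
Qed.

Ltac ov_atom ::= lazymatch goal with
 | |- over _ _ _ _ _ (comp_pcomp _ _ _) _ => eapply over_comp_pcomp
 | |- over _ _ _ _ _ (comp_punit _ _ _) _ => eapply over_comp_punit
 | |- over _ _ _ _ _ (push_hh _ _) _ => eapply over_push_hh
 end.

(** Every cell lies over the cell of [H] with the same role, so each pasting axiom is the same axiom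
    of [H]. *)
Definition push2 : quasi2 (fun y => comp_ps (F y) P) (fun x => comp_ps (G x) P).
Proof.
refine (@Quasi2 A B E _ _ push_hh (fun K u => psq P (qhv H K u)) (fun U k => psq P (qvh H U k))
  _ _ _ _ _ _ _ _ _ _ _ _ _ _ _ _ _ _ _ _ _ _ _ _ _ _ _).
- by move=> x y /=; rewrite (q_ob H).
- exact: push_hh_glob.
- move=> K u /=; rewrite psq_top; congr (ph P _); bd.
- move=> K u /=; rewrite psq_bot; congr (ph P _); bd.
- move=> K u /=; rewrite psq_lft; congr (pv P _); bd.
- move=> K u /=; rewrite psq_rgt; congr (pv P _); bd.
- move=> K u /=; rewrite psq_top; congr (ph P _); bd.
- move=> K u /=; rewrite psq_bot; congr (ph P _); bd.
- move=> K u /=; rewrite psq_lft; congr (pv P _); bd.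
- move=> K u /=; rewrite psq_rgt; congr (pv P _); bd.
- move=> U u /=. rewrite -!pv_vcomp ?(qvv H) //; beq.
- move=> K y; by_overp P; exact: qhh_hid_r.
- move=> x k; by_overp P; exact: qhh_hid_l.
- move=> x u; by_overp P; exact: qhv_hid.
- move=> U y; by_overp P; exact: qvh_hid.
- move=> K y; by_overp P; exact: qhv_vid.
- move=> x k; by_overp P; exact: qvh_vid.
- move=> K k k' e; by_overp P; exact: qhh_hcomp_r.
- move=> K K' k e; by_overp P; exact: qhh_hcomp_l.
- move=> K K' u e; by_overp P; exact: qhv_hcomp.
- move=> U k k' e; by_overp P; exact: qvh_hcomp.
- move=> K u u' e; by_overp P; exact: qhv_vcomp.
- move=> U U' k e; by_overp P; exact: qvh_vcomp.
- move=> K w; by_overp P; exact: qhh_sq_r.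
- move=> z k; by_overp P; exact: qhh_sq_l.
- move=> U w; by_overp P; exact: qvh_sq.
- move=> z u; by_overp P; exact: qhv_sq.
Defined.
End Push.

(** * Restricting a pseudofunctor to its slots *)

(** Kept apart from [psfunctor] so that preservation of horizontal composition is an equation,
    usable for rewriting and stable under composing inclusions. *)
Record strict_functor (A X : double_category) := StrictFunctor {
  sf_ob : ob A -> ob X;
  sf_h : hcell A -> hcell X;
  sf_v : vcell A -> vcell X;
  sf_sq : sq A -> sq X;
  sf_h_src : forall f, hsrc (sf_h f) = sf_ob (hsrc f);
  sf_h_tgt : forall f, htgt (sf_h f) = sf_ob (htgt f);
  sf_v_src : forall f, vsrc (sf_v f) = sf_ob (vsrc f);
  sf_v_tgt : forall f, vtgt (sf_v f) = sf_ob (vtgt f);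
  sf_sq_top : forall a, top (sf_sq a) = sf_h (top a);
  sf_sq_bot : forall a, bot (sf_sq a) = sf_h (bot a);
  sf_sq_lft : forall a, lft (sf_sq a) = sf_v (lft a);
  sf_sq_rgt : forall a, rgt (sf_sq a) = sf_v (rgt a);
  sf_h_hid : forall x, sf_h (hid x) = hid (sf_ob x);
  sf_v_vid : forall x, sf_v (vid x) = vid (sf_ob x);
  sf_h_hcomp : forall f g, htgt f = hsrc g -> sf_h (f ;h g) = sf_h f ;h sf_h g;
  sf_v_vcomp : forall f g, vtgt f = vsrc g -> sf_v (f ;v g) = sf_v f ;v sf_v g;
  sf_sq_idh : forall f, sf_sq (Idh f) = Idh (sf_h f);
  sf_sq_idv : forall f, sf_sq (Idv f) = Idv (sf_v f);
  sf_sq_sqh : forall a b, rgt a = lft b -> sf_sq (a <|> b) = sf_sq a <|> sf_sq b;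
  sf_sq_sqv : forall a b, bot a = top b -> sf_sq (a </> b) = sf_sq a </> sf_sq b
}.

Lemma pair_fun_eq (S T : Type) (x x' : S) (y y' : T) : x = x' -> y = y' -> (x, y) = (x', y').
Proof. by move=> -> ->. Qed.

Definition sf_id X : strict_functor X X.
Proof. by refine (@StrictFunctor X X (fun x => x) (fun x => x) (fun x => x) (fun x =>
  x) _ _ _ _ _ _ _ _ _ _ _ _ _ _ _ _). Defined.

Definition sf_comp A X Y (J : strict_functor A X) (K : strict_functor X Y) : strict_functor A Y.
Proof.
refine (@StrictFunctor A Y (fun x => sf_ob K (sf_ob J x)) (fun x => sf_h K (sf_h J x)) (fun x =>
  sf_v K (sf_v J x))
  (fun x => sf_sq K (sf_sq J x)) _ _ _ _ _ _ _ _ _ _ _ _ _ _ _ _); intros;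
rewrite ?(sf_h_src, sf_h_tgt, sf_v_src, sf_v_tgt, sf_sq_top, sf_sq_bot, sf_sq_lft, sf_sq_rgt,
  sf_h_hid, sf_v_vid, sf_sq_idh, sf_sq_idv) //.
- by rewrite sf_h_hcomp // sf_h_hcomp // sf_h_src sf_h_tgt H.
- by rewrite sf_v_vcomp // sf_v_vcomp // sf_v_src sf_v_tgt H.
- by rewrite sf_sq_sqh // sf_sq_sqh // sf_sq_lft sf_sq_rgt H.
- by rewrite sf_sq_sqv // sf_sq_sqv // sf_sq_top sf_sq_bot H.
Defined.

Ltac const_laws := rewrite ?(hsrc_hid, htgt_hid, vsrc_vid, vtgt_vid, top_id1h, bot_id1h, lft_id1h,
  rgt_id1h,
   hid_hcomp, vid_vcomp, sq_id1v_vid, idhid_sqh, idh_sqv) //.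

Definition incl1 A B (y : ob B) : strict_functor A (A ** B).
Proof.
refine (@StrictFunctor A (A ** B) (fun x => (x, y)) (fun f => (f, hid y)) (fun f => (f, vid y))
  (fun f => (f, Idh (hid y))) _ _ _ _ _ _ _ _ _ _ _ _ _ _ _ _); intros; apply: pair_fun_eq => //=;
    const_laws.
Defined.
Definition incl2 A B (x : ob A) : strict_functor B (A ** B).
Proof.
refine (@StrictFunctor B (A ** B) (fun y => (x, y)) (fun f => (hid x, f)) (fun f => (vid x, f))
  (fun f => (Idh (hid x), f)) _ _ _ _ _ _ _ _ _ _ _ _ _ _ _ _); intros; apply: pair_fun_eq => //=;
    const_laws.
Defined.
Definition sf_prod A B C (J : strict_functor A B) : strict_functor (A ** C) (B ** C).
Proof.
refine (@StrictFunctor (A ** C) (B ** C) (prod_map (sf_ob J) (fun x => x)) (prod_map (sf_h J)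
  (fun x => x))
  (prod_map (sf_v J) (fun x => x)) (prod_map (sf_sq J) (fun x => x)) _ _ _ _ _ _ _ _ _ _ _ _ _ _ _
    _);
 move=> [a b]; try (move=> [c d] e; have [e1 e2] : _ /\ _ := conj (f_equal fst e) (f_equal snd e));
 apply: pair_fun_eq => //=;
 rewrite ?(sf_h_src, sf_h_tgt, sf_v_src, sf_v_tgt, sf_sq_top, sf_sq_bot, sf_sq_lft, sf_sq_rgt,
   sf_h_hid, sf_v_vid, sf_sq_idh, sf_sq_idv) //.
- exact: sf_h_hcomp.
- exact: sf_v_vcomp.
- exact: sf_sq_sqh.
- exact: sf_sq_sqv.
Defined.
(** Products associate to the left, so a slot other than the last is frozen inside the left
    factor. *)
Definition incl13 A B C y : strict_functor (A ** C) (A ** B ** C) := sf_prod C (incl1 A y).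
Definition incl23 A B C x : strict_functor (B ** C) (A ** B ** C) := sf_prod C (incl2 B x).

Definition psfunctor_of A X (J : strict_functor A X) : psfunctor A X.
Proof.
refine (@PsFunctor A X (sf_ob J) (sf_h J) (sf_v J) (sf_sq J) (fun f g _ => Idh (sf_h J (f ;h g)))
  (fun x => Idh (sf_h J (hid x))) (sf_h_src J) (sf_h_tgt J) (sf_v_src J) (sf_v_tgt J)
  (sf_sq_top J) (sf_sq_bot J) (sf_sq_lft J) (sf_sq_rgt J) (sf_v_vid J) (@sf_v_vcomp _ _ J)
    (sf_sq_idh J) (@sf_sq_sqv _ _ J)
  _ _ _ _ _ _ _).
- by move=> f g e; rewrite -sf_h_hcomp //; exact: inv_globular_idh.
- by move=> x; rewrite sf_h_hid; exact: inv_globular_idh.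
- move=> a b e e' er; rewrite -sf_sq_sqh // -top_sqh // -bot_sqh // idh_sqv ?sqv_idh ?sf_sq_top
    ?sf_sq_bot //.
- by move=> u; rewrite -sf_sq_idv idh_sqv ?sqv_idh ?sf_sq_top ?sf_sq_bot ?top_id1v ?bot_id1v.
- move=> f g h e1 e2 e12 e21.
  rewrite -!sf_sq_idh -!sf_sq_sqh -?sf_sq_sqv; try bd.
  rewrite -!sq_id1h_hcomp //.
  by rewrite !idh_sqv ?top_id1h ?hcompA.
- move=> f e; rewrite -!sf_sq_idh -sf_sq_sqh; try bd.
  rewrite -sf_sq_sqv; try bd. congr (sf_sq J _).
  rewrite -!sq_id1h_hcomp //.
  by rewrite idh_sqv; bd.
- move=> f e; rewrite -!sf_sq_idh -sf_sq_sqh; try bd.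
  rewrite -sf_sq_sqv; try bd. congr (sf_sq J _).
  rewrite -!sq_id1h_hcomp //.
  by rewrite idh_sqv; bd.
Defined.

(** A slot is reached through several composites of inclusions, for instance through [A ** B] or
    through [A ** C], which agree cell by cell. A comparison on cells covers them all without
    equations between functors. Identities are written as images under [J], so that pastings can be
    pulled back along [J]. *)
Record is_strict A X (P : psfunctor A X) (J : strict_functor A X) : Prop := IsStrict {
  st_ob : forall x, pob P x = sf_ob J x;
  st_h : forall f, ph P f = sf_h J f;
  st_v : forall u, pv P u = sf_v J u;
  st_sq : forall a, psq P a = sf_sq J a;
  st_comp : forall f g (e : htgt f = hsrc g), pcomp P e = sf_sq J (Idh (f ;h g));
  st_unit : forall x, punit P x = sf_sq J (Idh (hid x)) }.

Section Pairs.
Variables (A B X : double_category) (J : strict_functor (A ** B) X).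
Lemma sf_sq_h2 a a' b b' : rgt a = lft a' -> rgt b = lft b' ->
  sf_sq J (a, b) <|> sf_sq J (a', b') = sf_sq J (a <|> a', b <|> b').
Proof. by move=> e e'; rewrite -sf_sq_sqh //=; exact: pair_fun_eq. Qed.
Lemma sf_sq_v2 a a' b b' : bot a = top a' -> bot b = top b' ->
  sf_sq J (a, b) </> sf_sq J (a', b') = sf_sq J (a </> a', b </> b').
Proof. by move=> e e'; rewrite -sf_sq_sqv //=; exact: pair_fun_eq. Qed.
Lemma sf_sq_idh2 f g : Idh (sf_h J (f, g)) = sf_sq J (Idh f, Idh g).
Proof. by rewrite -sf_sq_idh. Qed.
Lemma sf_sq_idv2 f g : Idv (sf_v J (f, g)) = sf_sq J (Idv f, Idv g).
Proof. by rewrite -sf_sq_idv. Qed.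
End Pairs.

Ltac nsq := repeat match goal with
 | |- context [Idh ?f <|> Idh ?g] => rewrite -(@sq_id1h_hcomp _ f g); [|beq]
 | |- context [Idv (vid ?x)] => rewrite sq_id1v_vid
 | |- context [Idh ?f </> ?a] => rewrite (@idh_sqv _ f a); [|bd]
 | |- context [?a </> Idh ?f] => rewrite (@sqv_idh _ f a); [|bd]
 | |- context [Idh (hid ?x) <|> ?a] => rewrite (@idhid_sqh _ x a); [|bd]
 | |- context [?a <|> Idh (hid ?x)] => rewrite (@sqh_idhid _ x a); [|bd]
 | |- context [Idv ?u <|> ?a] => rewrite (@idv_sqh _ u a); [|bd]
 | |- context [?a <|> Idv ?u] => rewrite (@sqh_idv _ u a); [|bd]
 | |- context [Idv ?u </> Idv ?v] => rewrite -(@sq_id1v_vcomp _ u v); [|beq]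
 end.
Ltac pull := repeat match goal with
 | |- context [sf_sq ?J (?a, ?b) <|> sf_sq ?J (?c, ?d)] => rewrite (@sf_sq_h2 _ _ _ J a c b d);
   [|bd|bd]
 | |- context [sf_sq ?J (?a, ?b) </> sf_sq ?J (?c, ?d)] => rewrite (@sf_sq_v2 _ _ _ J a c b d);
   [|bd|bd]
 end.
(** Both sides are gathered into one image under [J] and compared factor by factor, where [nsq]
    removes the identities. *)
Ltac pairs := pull; match goal with |- sf_sq ?J _ = sf_sq ?J _ => congr (sf_sq J _) end; apply:
  pair_fun_eq; nsq; beq.

Record is_strict2 A B X (F : ob B -> psfunctor A X) (G : ob A -> psfunctor B X) (H : quasi2 F G)
  (J : strict_functor (A ** B) X) : Prop := IsStrict2 {
  st_hh : forall K k, qhh H K k = sf_sq J (Idh K, Idh k);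
  st_hv : forall K u, qhv H K u = sf_sq J (Idh K, Idv u);
  st_vh : forall U k, qvh H U k = sf_sq J (Idv U, Idh k) }.

Section Strict2.
Variables (A B X : double_category) (J : strict_functor (A ** B) X).
Variables (F : ob B -> psfunctor A X) (G : ob A -> psfunctor B X).
Hypothesis hF : forall y, is_strict (F y) (sf_comp (incl1 A y) J).
Hypothesis hG : forall x, is_strict (G x) (sf_comp (incl2 B x) J).

Lemma sF_ob x y : pob (F y) x = sf_ob J (x, y). Proof. exact: st_ob (hF y) x. Qed.
Lemma sG_ob x y : pob (G x) y = sf_ob J (x, y). Proof. exact: st_ob (hG x) y. Qed.
Lemma sF_h f y : ph (F y) f = sf_h J (f, hid y). Proof. exact: st_h (hF y) f. Qed.
Lemma sG_h f x : ph (G x) f = sf_h J (hid x, f). Proof. exact: st_h (hG x) f. Qed.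
Lemma sF_v f y : pv (F y) f = sf_v J (f, vid y). Proof. exact: st_v (hF y) f. Qed.
Lemma sG_v f x : pv (G x) f = sf_v J (vid x, f). Proof. exact: st_v (hG x) f. Qed.
Lemma sF_sq f y : psq (F y) f = sf_sq J (f, Idh (hid y)). Proof. exact: st_sq (hF y) f. Qed.
Lemma sG_sq f x : psq (G x) f = sf_sq J (Idh (hid x), f). Proof. exact: st_sq (hG x) f. Qed.
Lemma sF_comp f g y (e : htgt f = hsrc g) : pcomp (F y) e = sf_sq J (Idh (f ;h g), Idh (hid y)).
Proof. exact: st_comp (hF y) f g e. Qed.
Lemma sG_comp f g x (e : htgt f = hsrc g) : pcomp (G x) e = sf_sq J (Idh (hid x), Idh (f ;h g)).
Proof. exact: st_comp (hG x) f g e. Qed.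
Lemma sF_unit x y : punit (F y) x = sf_sq J (Idh (hid x), Idh (hid y)). Proof. exact:
  st_unit (hF y) x. Qed.
Lemma sG_unit x y : punit (G x) y = sf_sq J (Idh (hid x), Idh (hid y)). Proof. exact:
  st_unit (hG x) y. Qed.
Definition strict_red := (sF_h, sG_h, sF_v, sG_v, sF_sq, sG_sq, sF_comp, sG_comp, sF_unit, sG_unit,
  sf_sq_idh2 J, sf_sq_idv2 J).

(** In a product, moving along [k] and then [K], or along [K] and then [k], gives the same 1h-cell
    [(K, k)]. The interchange cell can therefore be an identity, and each axiom is a computation
    with identities in one factor at a time. *)
Definition strict_quasi2 : quasi2 F G.
Proof.
refine (@Quasi2 A B X F G (fun K k => sf_sq J (Idh K, Idh k)) (fun K u => sf_sq J (Idh K, Idv u))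
  (fun U k => sf_sq J (Idv U, Idh k))
  _ _ _ _ _ _ _ _ _ _ _ _ _ _ _ _ _ _ _ _ _ _ _ _ _ _ _).
all: intros; rewrite ?sF_ob ?sG_ob ?strict_red.
- by [].
- rewrite -sf_sq_idh2 -!sf_h_hcomp /=; try (apply: pair_fun_eq => /=; beq).
  eapply inv_globular_conv; [exact: inv_globular_idh | |]; congr (sf_h J _); apply: pair_fun_eq =>
    /=; beq.
- rewrite sf_sq_top; congr (sf_h J _); apply: pair_fun_eq => /=; beq.
- rewrite sf_sq_bot; congr (sf_h J _); apply: pair_fun_eq => /=; beq.
- rewrite sf_sq_lft; congr (sf_v J _); apply: pair_fun_eq => /=; beq.
- rewrite sf_sq_rgt; congr (sf_v J _); apply: pair_fun_eq => /=; beq.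
- rewrite sf_sq_top; congr (sf_h J _); apply: pair_fun_eq => /=; beq.
- rewrite sf_sq_bot; congr (sf_h J _); apply: pair_fun_eq => /=; beq.
- rewrite sf_sq_lft; congr (sf_v J _); apply: pair_fun_eq => /=; beq.
- rewrite sf_sq_rgt; congr (sf_v J _); apply: pair_fun_eq => /=; beq.
- rewrite -!sf_v_vcomp /=; try (apply: pair_fun_eq => /=; beq).
  congr (sf_v J _); apply: pair_fun_eq => /=; beq.
all: pairs.
Defined.

Lemma strict_quasi2_strict : is_strict2 strict_quasi2 J.
Proof. by []. Qed.
End Strict2.

Section Strict3.
Variables (A B C X : double_category) (J : strict_functor (A ** B ** C) X).
Variables (F1 : ob B -> ob C -> psfunctor A X) (F2 : ob A -> ob C -> psfunctor B X)
  (F3 : ob A -> ob B -> psfunctor C X)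
    (H12 : forall z, quasi2 (fun y => F1 y z) (fun x => F2 x z))
    (H13 : forall y, quasi2 (fun z => F1 y z) (fun x => F3 x y))
    (H23 : forall x, quasi2 (fun z => F2 x z) (fun y => F3 x y)).
Hypothesis hF1 : forall y z, is_strict (F1 y z) (sf_comp (incl1 A y) (sf_comp (incl1 _ z) J)).
Hypothesis hF2 : forall x z, is_strict (F2 x z) (sf_comp (incl2 B x) (sf_comp (incl1 _ z) J)).
Hypothesis hF3 : forall x y, is_strict (F3 x y) (sf_comp (incl2 C ((x, y) : ob (A ** B))) J).
Hypothesis h12 : forall z, is_strict2 (H12 z) (sf_comp (incl1 _ z) J).
Hypothesis h13 : forall y, is_strict2 (H13 y) (sf_comp (incl13 A C y) J).
Hypothesis h23 : forall x, is_strict2 (H23 x) (sf_comp (incl23 B C x) J).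

Lemma s3_F1 f y z : ph (F1 y z) f = sf_h J ((f, hid y), hid z). Proof. exact: st_h (hF1 y z) f. Qed.
Lemma s3_F2 f x z : ph (F2 x z) f = sf_h J ((hid x, f), hid z). Proof. exact: st_h (hF2 x z) f. Qed.
Lemma s3_F3 f x y : ph (F3 x y) f = sf_h J ((hid x, hid y), f). Proof. exact: st_h (hF3 x y) f. Qed.
Lemma s3_hh12 f g z : qhh (H12 z) f g = sf_sq J ((Idh f, Idh g), Idh (hid z)). Proof. exact:
  (st_hh (h12 z) f g). Qed.
Lemma s3_hh13 f g z : qhh (H13 z) f g = sf_sq J ((Idh f, Idh (hid z)), Idh g). Proof. exact:
  (st_hh (h13 z) f g). Qed.
Lemma s3_hh23 f g z : qhh (H23 z) f g = sf_sq J ((Idh (hid z), Idh f), Idh g). Proof. exact: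
  (st_hh (h23 z) f g). Qed.
Lemma s3_hv12 f g z : qhv (H12 z) f g = sf_sq J ((Idh f, Idv g), Idh (hid z)). Proof. exact:
  (st_hv (h12 z) f g). Qed.
Lemma s3_hv13 f g z : qhv (H13 z) f g = sf_sq J ((Idh f, Idh (hid z)), Idv g). Proof. exact:
  (st_hv (h13 z) f g). Qed.
Lemma s3_hv23 f g z : qhv (H23 z) f g = sf_sq J ((Idh (hid z), Idh f), Idv g). Proof. exact:
  (st_hv (h23 z) f g). Qed.
Lemma s3_vh12 f g z : qvh (H12 z) f g = sf_sq J ((Idv f, Idh g), Idh (hid z)). Proof. exact:
  (st_vh (h12 z) f g). Qed.
Lemma s3_vh13 f g z : qvh (H13 z) f g = sf_sq J ((Idv f, Idh (hid z)), Idh g). Proof. exact: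
  (st_vh (h13 z) f g). Qed.
Lemma s3_vh23 f g z : qvh (H23 z) f g = sf_sq J ((Idh (hid z), Idv f), Idh g). Proof. exact:
  (st_vh (h23 z) f g). Qed.

Lemma sf_sq_h3 a a' b b' c c' : rgt a = lft a' -> rgt b = lft b' -> rgt c = lft c' ->
  sf_sq J ((a, b), c) <|> sf_sq J ((a', b'), c') = sf_sq J ((a <|> a', b <|> b'), c <|> c').
Proof. by move=> e e' e''; rewrite -sf_sq_sqh //=; apply: pair_fun_eq => //; exact:
  pair_fun_eq. Qed.
Lemma sf_sq_v3 a a' b b' c c' : bot a = top a' -> bot b = top b' -> bot c = top c' ->
  sf_sq J ((a, b), c) </> sf_sq J ((a', b'), c') = sf_sq J ((a </> a', b </> b'), c </> c').
Proof. by move=> e e' e''; rewrite -sf_sq_sqv //=; apply: pair_fun_eq => //; exact: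
  pair_fun_eq. Qed.
Lemma sf_sq_idh3 f g h : Idh (sf_h J ((f, g), h)) = sf_sq J ((Idh f, Idh g), Idh h).
Proof. by rewrite -sf_sq_idh. Qed.

Ltac pull3 := repeat match goal with
 | |- context [sf_sq J ((?a, ?b), ?c) <|> sf_sq J ((?a', ?b'), ?c')] =>
   rewrite (@sf_sq_h3 a a' b b' c c'); [|bd|bd|bd]
 | |- context [sf_sq J ((?a, ?b), ?c) </> sf_sq J ((?a', ?b'), ?c')] =>
   rewrite (@sf_sq_v3 a a' b b' c c'); [|bd|bd|bd]
 end.

Lemma strict_quasi3 : quasi3_ax H12 H13 H23.
Proof.
split; intros; rewrite ?(s3_F1, s3_F2, s3_F3, s3_hh12, s3_hh13, s3_hh23, s3_hv12, s3_hv13, s3_hv23,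
  s3_vh12, s3_vh13, s3_vh23, sf_sq_idh3); pull3;
match goal with |- sf_sq ?J _ = sf_sq ?J _ => congr (sf_sq J _) end; apply: pair_fun_eq; try apply:
  pair_fun_eq; nsq; beq.
Qed.
End Strict3.

Section Push3.
Variables (A B C X E : double_category) (P : psfunctor X E).
Variables (F1 : ob B -> ob C -> psfunctor A X) (F2 : ob A -> ob C -> psfunctor B X)
    (F3 : ob A -> ob B -> psfunctor C X)
    (H12 : forall z, quasi2 (fun y => F1 y z) (fun x => F2 x z))
    (H13 : forall y, quasi2 (fun z => F1 y z) (fun x => F3 x y))
    (H23 : forall x, quasi2 (fun z => F2 x z) (fun y => F3 x y)).
Hypothesis H : quasi3_ax H12 H13 H23.
Ltac ob_step ::= first [rewrite (q3_ob1 H13) | rewrite (q3_ob2 H23)].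
Ltac ov_atom ::= lazymatch goal with
 | |- over _ _ _ _ _ (comp_pcomp _ _ _) _ => eapply over_comp_pcomp
 | |- over _ _ _ _ _ (comp_punit _ _ _) _ => eapply over_comp_punit
 | |- over _ _ _ _ _ (push_hh _ _ _ _) _ => eapply over_push_hh
 end.
Ltac by_overp P ::= cbn [ph pv psq pob pcomp punit comp_ps push2 qhh qhv qvh]; by_over P.

Lemma push3 : quasi3_ax (fun z => push2 P (H12 z)) (fun y => push2 P (H13 y)) (fun x =>
  push2 P (H23 x)).
Proof.
split; intros.
- by_overp P; exact: (q3_hhh H f g h).
- by_overp P; exact: (q3_hvh H f v h).
- by_overp P; exact: (q3_hhv H f g w).
- by_overp P; exact: (q3_vhh H u g h).
- by_overp P; exact: (q3_vvh H u v h).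
- by_overp P; exact: (q3_vhv H u g w).
- by_overp P; exact: (q3_hvv H f v w).
Qed.
End Push3.

Lemma psfunctor_of_strict_eq A X (J J' : strict_functor A X) :
  (forall x, sf_ob J x = sf_ob J' x) -> (forall f, sf_h J f = sf_h J' f) ->
  (forall u, sf_v J u = sf_v J' u) -> (forall a, sf_sq J a = sf_sq J' a) ->
    is_strict (psfunctor_of J) J'.
Proof.
move=> e1 e2 e3 e4; split=> //=.
- by move=> f g _; rewrite e2 sf_sq_idh.
- by move=> x; rewrite e2 sf_sq_idh.
Qed.
Ltac strict := first [exact: strict_quasi2_strict | apply: psfunctor_of_strict_eq => ?; cbn;
  reflexivity].

(** * The quasi-functors formed by the slot inclusions *)

Section Universal3.
Variables (A B C E : double_category) (P : psfunctor (A ** B ** C) E).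
Let X := A ** B ** C.
Definition univ3F1 y z : psfunctor A X := psfunctor_of (sf_comp (incl1 A y) (incl1 (A ** B) z)).
Definition univ3F2 x z : psfunctor B X := psfunctor_of (sf_comp (incl2 B x) (incl1 (A ** B) z)).
Definition univ3F3 x y : psfunctor C X := psfunctor_of (incl2 C ((x, y) : ob (A ** B))).

Definition univ3H12 z : quasi2 (fun y => univ3F1 y z) (fun x => univ3F2 x z).
Proof. apply: (strict_quasi2 (J := incl1 (A ** B) z)); move=> ?; strict. Defined.
Definition univ3H13 y : quasi2 (fun z => univ3F1 y z) (fun x => univ3F3 x y).
Proof. apply: (strict_quasi2 (J := incl13 A C y)); move=> ?; strict. Defined.
Definition univ3H23 x : quasi2 (fun z => univ3F2 x z) (fun y => univ3F3 x y).
Proof. apply: (strict_quasi2 (J := incl23 B C x)); move=> ?; strict. Defined.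

Lemma univ3_ax : quasi3_ax univ3H12 univ3H13 univ3H23.
Proof. by apply: (strict_quasi3 (J := sf_id X)); try (move=> *; strict). Qed.

Definition restr3 : quasi3 A B C E := Quasi3 (push3 P univ3_ax).
End Universal3.

Section Universal4.
Variables (A B C D E : double_category) (P : psfunctor (A ** B ** C ** D) E).
Let X := A ** B ** C ** D.
Definition univ4J1 y z w : strict_functor A X := sf_comp (incl1 A y) (sf_comp (incl1 (A ** B) z)
  (incl1 (A ** B ** C) w)).
Definition univ4J2 x z w : strict_functor B X := sf_comp (incl2 B x) (sf_comp (incl1 (A ** B) z)
  (incl1 (A ** B ** C) w)).
Definition univ4J3 x y w : strict_functor C X := sf_comp (incl2 C ((x, y) : ob (A ** B)))
  (incl1 (A ** B ** C) w).
Definition univ4J4 x y z : strict_functor D X := incl2 D ((x, y, z) : ob (A ** B ** C)).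
Definition univ4J12 z w : strict_functor (A ** B) X :=
  sf_comp (incl1 (A ** B) z) (incl1 (A ** B ** C) w).
Definition univ4J13 y w : strict_functor (A ** C) X :=
  sf_comp (incl13 A C y) (incl1 (A ** B ** C) w).
Definition univ4J14 y z : strict_functor (A ** D) X := sf_comp (incl13 A D y) (incl13 (A ** B) D z).
Definition univ4J23 x w : strict_functor (B ** C) X :=
  sf_comp (incl23 B C x) (incl1 (A ** B ** C) w).
Definition univ4J24 x z : strict_functor (B ** D) X := sf_comp (incl23 B D x) (incl13 (A ** B) D z).
Definition univ4J34 x y : strict_functor (C ** D) X := incl23 C D ((x, y) : ob (A ** B)).

Definition univ4F1 y z w := psfunctor_of (univ4J1 y z w).
Definition univ4F2 x z w := psfunctor_of (univ4J2 x z w).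
Definition univ4F3 x y w := psfunctor_of (univ4J3 x y w).
Definition univ4F4 x y z := psfunctor_of (univ4J4 x y z).

Definition univ4H12 z w : quasi2 (fun y => univ4F1 y z w) (fun x => univ4F2 x z w).
Proof. apply: (strict_quasi2 (J := univ4J12 z w)); move=> ?; strict. Defined.
Definition univ4H13 y w : quasi2 (fun z => univ4F1 y z w) (fun x => univ4F3 x y w).
Proof. apply: (strict_quasi2 (J := univ4J13 y w)); move=> ?; strict. Defined.
Definition univ4H14 y z : quasi2 (fun w => univ4F1 y z w) (fun x => univ4F4 x y z).
Proof. apply: (strict_quasi2 (J := univ4J14 y z)); move=> ?; strict. Defined.
Definition univ4H23 x w : quasi2 (fun z => univ4F2 x z w) (fun y => univ4F3 x y w).
Proof. apply: (strict_quasi2 (J := univ4J23 x w)); move=> ?; strict. Defined.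
Definition univ4H24 x z : quasi2 (fun w => univ4F2 x z w) (fun y => univ4F4 x y z).
Proof. apply: (strict_quasi2 (J := univ4J24 x z)); move=> ?; strict. Defined.
Definition univ4H34 x y : quasi2 (fun w => univ4F3 x y w) (fun z => univ4F4 x y z).
Proof. apply: (strict_quasi2 (J := univ4J34 x y)); move=> ?; strict. Defined.

Lemma univ4_123 w : quasi3_ax (fun z => univ4H12 z w) (fun y => univ4H13 y w) (fun x =>
  univ4H23 x w).
Proof. by apply: (strict_quasi3 (J := incl1 (A ** B ** C) w)); try (move=> *; strict). Qed.
Lemma univ4_124 z : quasi3_ax (fun w => univ4H12 z w) (fun y => univ4H14 y z) (fun x =>
  univ4H24 x z).
Proof. by apply: (strict_quasi3 (J := incl13 (A ** B) D z)); try (move=> *; strict). Qed.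
Lemma univ4_134 y : quasi3_ax (fun w => univ4H13 y w) (fun z => univ4H14 y z) (fun x =>
  univ4H34 x y).
Proof. by apply: (strict_quasi3 (J := sf_prod D (incl13 A C y))); try (move=> *; strict). Qed.
Lemma univ4_234 x : quasi3_ax (fun w => univ4H23 x w) (fun z => univ4H24 x z) (fun y =>
  univ4H34 x y).
Proof. by apply: (strict_quasi3 (J := sf_prod D (incl23 B C x))); try (move=> *; strict). Qed.

Definition restr4 : quasi4 A B C D E :=
  Quasi4 (fun w => push3 P (univ4_123 w)) (fun z => push3 P (univ4_124 z))
    (fun y => push3 P (univ4_134 y)) (fun x => push3 P (univ4_234 x)).
End Universal4.

(** * Gluing the restriction of a pseudofunctor *)

(** Gluing turns one value of [P] into a composite of several. The list [l f] records the 1h-cells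
    of [X] whose images make up [ph Q f], so that [Q] agrees with [P] along [J] up to iterated
    compositors. *)
Record over_strict (A X E : double_category) (P : psfunctor X E) (Q : psfunctor A E) (J :
  strict_functor A X)
  (l : hcell A -> list (hcell X)) : Prop := OverStrict {
  oj_ob : forall x, pob Q x = pob P (sf_ob J x);
  oj_v : forall u, pv Q u = pv P (sf_v J u);
  oj_path : forall f, is_path (sf_ob J (hsrc f)) (l f) (sf_ob J (htgt f));
  oj_X : forall f, pathX (sf_ob J (hsrc f)) (l f) = sf_h J f;
  oj_E : forall f, pathE P (sf_ob J (hsrc f)) (l f) = ph Q f;
  oj_sq : forall a, over P (sf_ob J (hsrc (top a))) (l (top a)) (sf_ob J (hsrc (bot a)))
    (l (bot a)) (psq Q a) (sf_sq J a);
  oj_comp : forall f g (e : htgt f = hsrc g),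
    over P (sf_ob J (hsrc f)) (l f ++ l g) (sf_ob J (hsrc f)) (l (f ;h g)) (pcomp Q e)
      (sf_sq J (Idh (f ;h g)));
  oj_unit : forall x, over P (sf_ob J x) [] (sf_ob J x) (l (hid x)) (punit Q x)
    (sf_sq J (Idh (hid x)))
}.

Lemma oj_idh A X E (P : psfunctor X E) (Q : psfunctor A E) (J : strict_functor A X) l :
  over_strict P Q J l ->
  forall f, over P (sf_ob J (hsrc f)) (l f) (sf_ob J (hsrc f)) (l f) (Idh (ph Q f))
    (sf_sq J (Idh f)).
Proof. by move=> o f; have := oj_sq o (Idh f); rewrite top_id1h bot_id1h psq_id1h. Qed.

Lemma comp_ps_over A X E (P : psfunctor X E) (R : psfunctor A X) (J : strict_functor A X) :
  is_strict R J ->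
  over_strict P (comp_ps R P) J (fun f => [sf_h J f]).
Proof.
move=> st; split.
- by move=> x; rewrite /= (st_ob st).
- by move=> x; rewrite /= (st_v st).
- by move=> f; rewrite /= sf_h_src sf_h_tgt.
- by move=> f; rewrite -sf_h_src pathX1.
- by move=> f; rewrite -sf_h_src pathE1 /= (st_h st).
- by move=> a; have := over_psq P (sf_sq J a); rewrite sf_sq_top sf_sq_bot !sf_h_src /= (st_sq st).
- move=> f g e; have := @over_comp_pcomp A X E R P f g e; rewrite (st_comp st) !(st_h st) !sf_h_src.
  by rewrite hsrc_hcomp.
- by move=> x; have := over_comp_punit R P x; rewrite (st_unit st) (st_h st) (st_ob st) sf_h_src
    hsrc_hid.
Qed.

Record over_strict2 (A B X E : double_category) (P : psfunctor X E) (F : ob B -> psfunctor A E)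
  (G : ob A -> psfunctor B E) (H : quasi2 F G) (J : strict_functor (A ** B) X) (lF : ob B ->
    hcell A -> list (hcell X))
  (lG : ob A -> hcell B -> list (hcell X)) : Prop := OverStrict2 {
  o2_hh : forall K k, over P (sf_ob J (hsrc K, hsrc k)) (lG (hsrc K) k ++ lF (htgt k) K)
     (sf_ob J (hsrc K, hsrc k)) (lF (hsrc k) K ++ lG (htgt K) k) (qhh H K k)
       (sf_sq J (Idh K, Idh k));
  o2_hv : forall K u, over P (sf_ob J (hsrc K, vsrc u)) (lF (vsrc u) K)
     (sf_ob J (hsrc K, vtgt u)) (lF (vtgt u) K) (qhv H K u) (sf_sq J (Idh K, Idv u));
  o2_vh : forall U k, over P (sf_ob J (vsrc U, hsrc k)) (lG (vsrc U) k)
     (sf_ob J (vtgt U, hsrc k)) (lG (vtgt U) k) (qvh H U k) (sf_sq J (Idv U, Idh k))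
}.

Lemma hsrc_pair A B (f : hcell A) (g : hcell B) : @hsrc (A ** B) (f, g) = (hsrc f, hsrc g).
Proof. by []. Qed.

Lemma push2_over A B X E (P : psfunctor X E) (F : ob B -> psfunctor A X)
  (G : ob A -> psfunctor B X) (H : quasi2 F G) (J : strict_functor (A ** B) X) :
  (forall y, is_strict (F y) (sf_comp (incl1 A y) J)) ->
  (forall x, is_strict (G x) (sf_comp (incl2 B x) J)) -> is_strict2 H J ->
  over_strict2 P (push2 P H) J (fun y f => [sf_h J (f, hid y)]) (fun x g => [sf_h J (hid x, g)]).
Proof.
move=> hF hG h; split.
- move=> K k; have := over_push_hh P H K k.
  by rewrite (st_hh h) !(sF_h hF) !(sG_h hG) !sf_h_src !hsrc_pair !hsrc_hid.
- move=> K k; have := over_psq P (qhv H K k).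
  by rewrite qhv_top qhv_bot !(sF_h hF) !sf_h_src !hsrc_pair !hsrc_hid /= (st_hv h).
- move=> K k; have := over_psq P (qvh H K k).
  by rewrite qvh_top qvh_bot !(sG_h hG) !sf_h_src !hsrc_pair !hsrc_hid /= (st_vh h).
Qed.

(** The squares of the two factors are kept as separate arguments, so that the square underneath is
    built factor by factor and can be simplified there. *)
Lemma over_h2 A B X E (P : psfunctor X E) (J : strict_functor (A ** B) X) p q p' q' l m l' m' s t a
  b a' b' :
  over P (sf_ob J p) l (sf_ob J q) m s (sf_sq J (a, b)) -> over P (sf_ob J p') l' (sf_ob J q') m' t
    (sf_sq J (a', b')) ->
  rgt a = lft a' -> rgt b = lft b' ->
  over P (sf_ob J p) (l ++ l') (sf_ob J q) (m ++ m') (s <|> t) (sf_sq J (a <|> a', b <|> b')).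
Proof.
move=> o o' e e'; rewrite -sf_sq_h2 //; apply: over_sqh o o' _.
by rewrite sf_sq_lft sf_sq_rgt; congr (sf_v J _); exact: pair_fun_eq.
Qed.

Lemma over_v2 A B X E (P : psfunctor X E) (J : strict_functor (A ** B) X) p q p' q' l m l' m' s t a
  b a' b' :
  over P (sf_ob J p) l (sf_ob J q) m s (sf_sq J (a, b)) -> over P (sf_ob J p') l' (sf_ob J q') m' t
    (sf_sq J (a', b')) ->
  q = p' -> m = l' -> bot a = top a' -> bot b = top b' ->
  over P (sf_ob J p) l (sf_ob J q') m' (s </> t) (sf_sq J (a </> a', b </> b')).
Proof. by move=> o o' e e' *; subst; rewrite -sf_sq_v2 //; apply: over_sqv o o'. Qed.

Lemma over_conv2 A B X E (P : psfunctor X E) (J : strict_functor (A ** B) X) p q p' q' l m l' m' s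
  a b a' b' :
  over P (sf_ob J p) l (sf_ob J q) m s (sf_sq J (a, b)) -> a = a' -> b = b' -> p = p' -> l = l' ->
    q = q' -> m = m' ->
  over P (sf_ob J p') l' (sf_ob J q') m' s (sf_sq J (a', b')).
Proof. by move=> o *; subst. Qed.

Ltac peq := first [reflexivity | apply: pair_fun_eq => /=; beq].
Ltac leq := first [reflexivity | solve [nrm; rewrite -?app_assoc ?app_nil_r; reflexivity]].
Ltac ovj := lazymatch goal with
 | |- over _ _ _ _ _ (_ <|> _) _ => eapply over_h2; [ovj|ovj|bd|bd]
 | |- over _ _ _ _ _ (_ </> _) _ => eapply over_v2; [ovj|ovj|peq|leq|bd|bd]
 | |- _ => ov_atom
 end.
Ltac by_ovj := eapply over_conv2; [ovj| | |peq|leq|peq|leq].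

Section GlueOver.
Variables (A B X E : double_category) (P : psfunctor X E).
Variables (F : ob B -> psfunctor A E) (G : ob A -> psfunctor B E) (H : quasi2 F G) (J :
  strict_functor (A ** B) X).
Variables (lF : ob B -> hcell A -> list (hcell X)) (lG : ob A -> hcell B -> list (hcell X)).
Hypothesis oF : forall y, over_strict P (F y) (sf_comp (incl1 A y) J) (lF y).
Hypothesis oG : forall x, over_strict P (G x) (sf_comp (incl2 B x) J) (lG x).
Hypothesis oH : over_strict2 P H J lF lG.

Let oF_sq y a : over P (sf_ob J (hsrc (top a), y)) (lF y (top a)) (sf_ob J (hsrc (bot a), y))
  (lF y (bot a))
  (psq (F y) a) (sf_sq J (a, Idh (hid y))).
Proof. exact: (oj_sq (oF y) a). Qed.
Let oG_sq x a : over P (sf_ob J (x, hsrc (top a))) (lG x (top a)) (sf_ob J (x, hsrc (bot a)))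
  (lG x (bot a))
  (psq (G x) a) (sf_sq J (Idh (hid x), a)).
Proof. exact: (oj_sq (oG x) a). Qed.
Let oF_id y f : over P (sf_ob J (hsrc f, y)) (lF y f) (sf_ob J (hsrc f, y)) (lF y f)
  (Idh (ph (F y) f)) (sf_sq J (Idh f, Idh (hid y))).
Proof. exact: (oj_idh (oF y) f). Qed.
Let oG_id x f : over P (sf_ob J (x, hsrc f)) (lG x f) (sf_ob J (x, hsrc f)) (lG x f)
  (Idh (ph (G x) f)) (sf_sq J (Idh (hid x), Idh f)).
Proof. exact: (oj_idh (oG x) f). Qed.
Let oF_comp y f g (e : htgt f = hsrc g) : over P (sf_ob J (hsrc f, y)) (lF y f ++ lF y g)
  (sf_ob J (hsrc f, y))
  (lF y (f ;h g)) (pcomp (F y) e) (sf_sq J (Idh (f ;h g), Idh (hid y))).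
Proof. exact: (oj_comp (oF y) e). Qed.
Let oG_comp x f g (e : htgt f = hsrc g) : over P (sf_ob J (x, hsrc f)) (lG x f ++ lG x g)
  (sf_ob J (x, hsrc f))
  (lG x (f ;h g)) (pcomp (G x) e) (sf_sq J (Idh (hid x), Idh (f ;h g))).
Proof. exact: (oj_comp (oG x) e). Qed.
Let oF_unit y x : over P (sf_ob J (x, y)) [] (sf_ob J (x, y)) (lF y (hid x)) (punit (F y) x)
  (sf_sq J (Idh (hid x), Idh (hid y))).
Proof. exact: (oj_unit (oF y) x). Qed.
Let oG_unit y x : over P (sf_ob J (x, y)) [] (sf_ob J (x, y)) (lG x (hid y)) (punit (G x) y)
  (sf_sq J (Idh (hid x), Idh (hid y))).
Proof. exact: (oj_unit (oG x) y). Qed.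

Ltac ov_atom ::= lazymatch goal with
 | |- over _ _ _ _ _ (Idh _) _ => first [eapply oF_id | eapply oG_id]
 | |- over _ _ _ _ _ (psq _ _) _ => first [eapply oF_sq | eapply oG_sq]
 | |- over _ _ _ _ _ (pcomp _ _) _ => first [eapply oF_comp | eapply oG_comp]
 | |- over _ _ _ _ _ (punit _ _) _ => first [eapply oF_unit | eapply oG_unit]
 | |- over _ _ _ _ _ (qhh _ _ _) _ => eapply (o2_hh oH)
 | |- over _ _ _ _ _ (qhv _ _ _) _ => eapply (o2_hv oH)
 | |- over _ _ _ _ _ (qvh _ _ _) _ => eapply (o2_vh oH)
 end.

(** The cells of [glue H] are pastings of cells that already lie over images of [J], and lists
    concatenate under horizontal composition; being over is thus inherited. *)
Lemma glue_over : over_strict P (glue H) J (fun f => lF (hsrc (snd f)) (fst f) ++ lG (htgt (fst f))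
  (snd f)).
Proof.
have wF f y : is_path (sf_ob J (hsrc f, y)) (lF y f) (sf_ob J (htgt f, y)) by exact:
  (oj_path (oF y) f).
have wG f x : is_path (sf_ob J (x, hsrc f)) (lG x f) (sf_ob J (x, htgt f)) by exact:
  (oj_path (oG x) f).
split.
- by move=> [x y] /=; exact: (oj_ob (oF y) x).
- move=> [u v] /=; rewrite (oj_v (oF _)) (oj_v (oG _)) -pv_vcomp /= -?sf_v_vcomp ?sf_v_src
    ?sf_v_tgt //=.
  all: rewrite /prod_map2 /prod_map /=; repeat congr (_ _); try (apply: pair_fun_eq); try beq.
- move=> [f g] /=; exact: is_path_cat (wF _ _) (wG _ _).
- move=> [f g] /=; rewrite (pathX_cat (wF f (hsrc g)) (wG g (htgt f))).
  have -> : pathX (sf_ob J (hsrc f, hsrc g)) (lF (hsrc g) f) = sf_h J (f, hid (hsrc g)) by exact: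
    (oj_X (oF (hsrc g)) f).
  have -> : pathX (sf_ob J (htgt f, hsrc g)) (lG (htgt f) g) = sf_h J (hid (htgt f), g) by exact:
    (oj_X (oG (htgt f)) g).
  rewrite -sf_h_hcomp /=; last peq.
  by congr (sf_h J _); peq.
- move=> [f g] /=; rewrite (pathE_cat P (wF f (hsrc g)) (wG g (htgt f))).
  have -> : pathE P (sf_ob J (hsrc f, hsrc g)) (lF (hsrc g) f) = ph (F (hsrc g)) f by exact:
    (oj_E (oF (hsrc g)) f).
  by have -> : pathE P (sf_ob J (htgt f, hsrc g)) (lG (htgt f) g) = ph (G (htgt f)) g by exact:
    (oj_E (oG (htgt f)) g).
(* [by_ovj] computes the square underneath; it is [a] in one factor and [b] in the other, each
   pasted with identities that [nsq] removes. *)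
- move=> [a b]; rewrite /= /glue_sq; by_ovj; nsq; reflexivity.
- move=> [f g] [f' g'] e; case: (e) => e1 e2; rewrite /= /glue_comp; by_ovj; nsq; beq.
- move=> [x y] /=; by_ovj; nsq; beq.
Qed.
End GlueOver.

Section Triples.
Variables (A B C X E : double_category) (P : psfunctor X E) (J : strict_functor (A ** B ** C) X).

Lemma over_h3 p q p' q' l m l' m' s t a b c a' b' c' :
  over P (sf_ob J p) l (sf_ob J q) m s (sf_sq J ((a, b), c)) -> over P (sf_ob J p') l' (sf_ob J q')
    m' t (sf_sq J ((a', b'), c')) ->
  rgt a = lft a' -> rgt b = lft b' -> rgt c = lft c' ->
  over P (sf_ob J p) (l ++ l') (sf_ob J q) (m ++ m') (s <|> t) (sf_sq J ((a <|> a', b <|>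
    b'), c <|> c')).
Proof. by move=> o o' e e' e''; apply: (over_h2 o o') => //; exact: pair_fun_eq. Qed.

Lemma over_v3 p q p' q' l m l' m' s t a b c a' b' c' :
  over P (sf_ob J p) l (sf_ob J q) m s (sf_sq J ((a, b), c)) -> over P (sf_ob J p') l' (sf_ob J q')
    m' t (sf_sq J ((a', b'), c')) ->
  q = p' -> m = l' -> bot a = top a' -> bot b = top b' -> bot c = top c' ->
  over P (sf_ob J p) l (sf_ob J q') m' (s </> t) (sf_sq J ((a </> a', b </> b'), c </> c')).
Proof. by move=> o o' e e' *; apply: (over_v2 o o') => //; exact: pair_fun_eq. Qed.

Lemma over_conv3 p q p' q' l m l' m' s a b c a' b' c' :
  over P (sf_ob J p) l (sf_ob J q) m s (sf_sq J ((a, b), c)) -> a = a' -> b = b' -> c = c' ->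
  p = p' -> l = l' -> q = q' -> m = m' ->
  over P (sf_ob J p') l' (sf_ob J q') m' s (sf_sq J ((a', b'), c')).
Proof. by move=> o *; subst. Qed.
End Triples.

Ltac peq3 := first [reflexivity | apply: pair_fun_eq; [apply: pair_fun_eq; beq | beq]].
Ltac ovj3 := lazymatch goal with
 | |- over _ _ _ _ _ (_ <|> _) _ => eapply over_h3; [ovj3|ovj3|bd|bd|bd]
 | |- over _ _ _ _ _ (_ </> _) _ => eapply over_v3; [ovj3|ovj3|peq3|leq|bd|bd|bd]
 | |- _ => ov_atom
 end.
Ltac by_ovj3 := eapply over_conv3; [ovj3| | | |peq3|leq|peq3|leq].

Section CurryOver.
Variables (A B C X E : double_category) (P : psfunctor X E) (J : strict_functor (A ** B ** C) X).
Variables (F1 : ob B -> ob C -> psfunctor A E) (F2 : ob A -> ob C -> psfunctor B E)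
    (F3 : ob A -> ob B -> psfunctor C E)
    (H12 : forall z, quasi2 (fun y => F1 y z) (fun x => F2 x z))
    (H13 : forall y, quasi2 (fun z => F1 y z) (fun x => F3 x y))
    (H23 : forall x, quasi2 (fun z => F2 x z) (fun y => F3 x y)).
Hypothesis H : quasi3_ax H12 H13 H23.
Variables (l1 : ob B -> ob C -> hcell A -> list (hcell X)) (l2 : ob A -> ob C -> hcell B ->
  list (hcell X))
  (l3 : ob A -> ob B -> hcell C -> list (hcell X)).
Hypothesis oF1 : forall y z, over_strict P (F1 y z) (sf_comp (incl1 A y) (sf_comp (incl1 _ z) J))
  (l1 y z).
Hypothesis oF2 : forall x z, over_strict P (F2 x z) (sf_comp (incl2 B x) (sf_comp (incl1 _ z) J))
  (l2 x z).
Hypothesis o13 : forall y, over_strict2 P (H13 y) (sf_comp (incl13 A C y) J) (fun z =>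
  l1 y z) (fun x => l3 x y).
Hypothesis o23 : forall x, over_strict2 P (H23 x) (sf_comp (incl23 B C x) J) (fun z =>
  l2 x z) (fun y => l3 x y).

Let oF1_id y z f : over P (sf_ob J ((hsrc f, y), z)) (l1 y z f) (sf_ob J ((hsrc f, y), z))
  (l1 y z f)
  (Idh (ph (F1 y z) f)) (sf_sq J ((Idh f, Idh (hid y)), Idh (hid z))).
Proof. exact: (oj_idh (oF1 y z) f). Qed.
Let oF2_id x z f : over P (sf_ob J ((x, hsrc f), z)) (l2 x z f) (sf_ob J ((x, hsrc f), z))
  (l2 x z f)
  (Idh (ph (F2 x z) f)) (sf_sq J ((Idh (hid x), Idh f), Idh (hid z))).
Proof. exact: (oj_idh (oF2 x z) f). Qed.
Let o13_hh y K k : over P (sf_ob J ((hsrc K, y), hsrc k)) (l3 (hsrc K) y k ++ l1 y (htgt k) K)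
     (sf_ob J ((hsrc K, y), hsrc k)) (l1 y (hsrc k) K ++ l3 (htgt K) y k) (qhh (H13 y) K k)
       (sf_sq J ((Idh K, Idh (hid y)), Idh k)).
Proof. exact: (o2_hh (o13 y) K k). Qed.
Let o13_hv y K u : over P (sf_ob J ((hsrc K, y), vsrc u)) (l1 y (vsrc u) K)
     (sf_ob J ((hsrc K, y), vtgt u)) (l1 y (vtgt u) K) (qhv (H13 y) K u)
       (sf_sq J ((Idh K, Idh (hid y)), Idv u)).
Proof. exact: (o2_hv (o13 y) K u). Qed.
Let o13_vh y U k : over P (sf_ob J ((vsrc U, y), hsrc k)) (l3 (vsrc U) y k)
     (sf_ob J ((vtgt U, y), hsrc k)) (l3 (vtgt U) y k) (qvh (H13 y) U k)
       (sf_sq J ((Idv U, Idh (hid y)), Idh k)).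
Proof. exact: (o2_vh (o13 y) U k). Qed.
Let o23_hh x K k : over P (sf_ob J ((x, hsrc K), hsrc k)) (l3 x (hsrc K) k ++ l2 x (htgt k) K)
     (sf_ob J ((x, hsrc K), hsrc k)) (l2 x (hsrc k) K ++ l3 x (htgt K) k) (qhh (H23 x) K k)
       (sf_sq J ((Idh (hid x), Idh K), Idh k)).
Proof. exact: (o2_hh (o23 x) K k). Qed.
Let o23_hv x K u : over P (sf_ob J ((x, hsrc K), vsrc u)) (l2 x (vsrc u) K)
     (sf_ob J ((x, hsrc K), vtgt u)) (l2 x (vtgt u) K) (qhv (H23 x) K u)
       (sf_sq J ((Idh (hid x), Idh K), Idv u)).
Proof. exact: (o2_hv (o23 x) K u). Qed.
Let o23_vh x U k : over P (sf_ob J ((x, vsrc U), hsrc k)) (l3 x (vsrc U) k)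
     (sf_ob J ((x, vtgt U), hsrc k)) (l3 x (vtgt U) k) (qvh (H23 x) U k)
       (sf_sq J ((Idh (hid x), Idv U), Idh k)).
Proof. exact: (o2_vh (o23 x) U k). Qed.

Ltac ov_atom ::= lazymatch goal with
 | |- over _ _ _ _ _ (Idh _) _ => first [eapply oF1_id | eapply oF2_id]
 | |- over _ _ _ _ _ (qhh _ _ _) _ => first [eapply o13_hh | eapply o23_hh]
 | |- over _ _ _ _ _ (qhv _ _ _) _ => first [eapply o13_hv | eapply o23_hv]
 | |- over _ _ _ _ _ (qvh _ _ _) _ => first [eapply o13_vh | eapply o23_vh]
 end.

Lemma curry_over : over_strict2 P (curry H) J
  (fun z f => l1 (hsrc (snd f)) z (fst f) ++ l2 (htgt (fst f)) z (snd f))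
  (fun xy h => l3 (fst xy) (snd xy) h).
Proof.
split.
- move=> [f g] h; rewrite /= /curry_hh; by_ovj3; nsq; beq.
- move=> [f g] h; rewrite /= /curry_hv; by_ovj3; nsq; beq.
- move=> [f g] h; rewrite /= /curry_vh; by_ovj3; nsq; beq.
Qed.
End CurryOver.

Section Counit.
Variables (X E : double_category) (P Q : psfunctor X E) (l : hcell X -> list (hcell X)).
Hypothesis o : over_strict P Q (sf_id X) l.

(** When [J] is the identity, the defining equation [ov_eq] at a square is naturality of the
    iterated compositors; at compositors and unitors it gives the other two coherence axioms. *)
Lemma counit_vst : is_vst Q P (fun x => vid (pob Q x)) (fun f => path_comp P (hsrc f) (l f)).
Proof.
have w f : is_path (hsrc f) (l f) (htgt f) := oj_path o f.
have eX f : pathX (hsrc f) (l f) = f := oj_X o f.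
have eE f : pathE P (hsrc f) (l f) = ph Q f := oj_E o f.
have t f : boundary (path_comp P (hsrc f) (l f)) (ph Q f) (ph P f) (vid (pob P (hsrc f)))
  (vid (pob P (htgt f))).
  by have := boundary_path_comp P (w f); rewrite eX eE.
have eo x : pob Q x = pob P x := oj_ob o x.
have ev u : pv Q u = pv P u := oj_v o u.
split.
- by move=> x; rewrite vsrc_vid.
- by move=> x; rewrite vtgt_vid eo.
- by move=> f; case: (t f).
- by move=> f; case: (t f) => _ [].
- by move=> f; case: (t f) => _ [_ [-> _]]; rewrite eo.
- by move=> f; case: (t f) => _ [_ [_ ->]]; rewrite eo.
- move=> u; rewrite !eo ev vid_compl ?vid_compr ?pv_src ?pv_tgt //.
- move=> f g e; have := oj_comp o e => /= o1.
  have eh : hsrc (f ;h g) = hsrc f by rewrite hsrc_hcomp.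
  rewrite eh (ov_eq o1).
  have w2 : is_path (htgt f) (l g) (htgt g) by rewrite e.
  have tf := t f; have := t g; rewrite -e => tg.
  rewrite (path_comp_cat P (w f) w2) eX.
  have -> : pathX (htgt f) (l g) = g by rewrite e eX.
  rewrite (pcomp_totalE P e) psq_id1h sqv_idh; [by rewrite e|bd].
- move=> x; have := ov_eq (oj_unit o x); rewrite /= hsrc_hid => ->.
  rewrite psq_id1h sq_id1v_vid eo; case: (boundary_punit P x) => et [eb _].
  by rewrite idh_sqv ?sqv_idh.
- by move=> a; exact: ov_eq (oj_sq o a).
Qed.

Lemma counit_glob f : inv_globular (ph Q f) (ph P f) (path_comp P (hsrc f) (l f)).
Proof.
have := path_comp_glob P (oj_path o f : is_path (hsrc f) (l f) (htgt f)).
by rewrite (oj_X o f) (oj_E o f).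
Qed.
End Counit.

(** The inclusions compute, so strictness of each slot holds by [reflexivity] on each kind of
    cell. *)
Ltac strict_eq := apply: psfunctor_of_strict_eq => ?; cbn; reflexivity.
Ltac strict_comp := cbv beta; match goal with |- over_strict ?P (comp_ps ?R _) ?J _ =>
  exact (comp_ps_over P (ltac:(strict_eq) : is_strict R J)) end.
Ltac strict_push := cbv beta; match goal with |- over_strict2 ?P (@push2 ?A ?B _ _ ?F ?G _ ?H) ?J _
  _ =>
  exact (push2_over P (ltac:(move=> ?; strict_eq) :
    forall y, is_strict (F y) (sf_comp (incl1 A y) J))
   (ltac:(move=> ?; strict_eq) : forall x, is_strict (G x) (sf_comp (incl2 B x) J))
   (ltac:(split; intros; cbn; reflexivity) : is_strict2 H J)) end.

Section Restr3Over.
Variables (A B C E : double_category) (P : psfunctor (A ** B ** C) E).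
Let X := A ** B ** C.

Let l1 (y : ob B) (z : ob C) (f : hcell A) : list (hcell X) := [((f, hid y), hid z)].
Let l2 (x : ob A) (z : ob C) (g : hcell B) : list (hcell X) := [((hid x, g), hid z)].
Let l3 (x : ob A) (y : ob B) (h : hcell C) : list (hcell X) := [((hid x, hid y), h)].

Lemma restr3_over : exists l, over_strict P (glue (curry (push3 P (univ3_ax A B C)))) (sf_id X) l.
Proof.
eexists; apply: (@glue_over (A ** B) C X E P _ _ _ (sf_id X)
  (fun z f => l1 (hsrc (snd f)) z (fst f) ++ l2 (htgt (fst f)) z (snd f))
  (fun xy h => l3 (fst xy) (snd xy) h)).
- move=> z; apply: (@glue_over A B X E P _ _ _ (sf_comp (incl1 (A ** B) z) (sf_id X)) (fun y f =>
    l1 y z f) (fun x g => l2 x z g)).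
  + move=> y; strict_comp.
  + move=> x; strict_comp.
  + strict_push.
- move=> [x y]; strict_comp.
- apply: (curry_over _ (l1 := l1) (l2 := l2) (l3 := l3)).
  + move=> y z; strict_comp.
  + move=> x z; strict_comp.
  + move=> y; strict_push.
  + move=> x; strict_push.
Qed.
End Restr3Over.

Section Restr4Over.
Variables (A B C D E : double_category) (P : psfunctor (A ** B ** C ** D) E).
Let X := A ** B ** C ** D.
Let l1 (y : ob B) (z : ob C) (w : ob D) (f : hcell A) : list (hcell X) :=
  [(((f, hid y), hid z), hid w)].
Let l2 (x : ob A) (z : ob C) (w : ob D) (g : hcell B) : list (hcell X) :=
  [(((hid x, g), hid z), hid w)].
Let l3 (x : ob A) (y : ob B) (w : ob D) (h : hcell C) : list (hcell X) :=
  [(((hid x, hid y), h), hid w)].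
Let l4 (x : ob A) (y : ob B) (z : ob C) (k : hcell D) : list (hcell X) :=
  [(((hid x, hid y), hid z), k)].
Let l12 z w (f : hcell (A ** B)) := l1 (hsrc (snd f)) z w (fst f) ++ l2 (htgt (fst f)) z w (snd f).

(** Needed twice in [restr4_over]: inside the glued functor on the first three slots, and for the
    first slot of the outer curried quasi-functor. *)
Lemma glue12_over z w :
  over_strict P (glue (push2 P (univ4H12 A B z w)))
   (sf_comp (incl1 (A ** B) z) (sf_comp (incl1 (A ** B ** C) w) (sf_id X))) (l12 z w).
Proof.
apply: (@glue_over A B X E P _ _ _ (sf_comp (incl1 (A ** B) z) (sf_comp (incl1 (A ** B ** C) w)
  (sf_id X)))
  (fun y f => l1 y z w f) (fun x g => l2 x z w g)).
- move=> y; strict_comp.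
- move=> x; strict_comp.
- strict_push.
Qed.

Lemma restr4_over : exists l, over_strict P
  (glue (curry (curry4_ax (fun w => push3 P (univ4_123 A B C w)) (fun z =>
    push3 P (univ4_124 A B D z))
    (fun y => push3 P (univ4_134 A C D y)) (fun x => push3 P (univ4_234 B C D x))))) (sf_id X) l.
Proof.
eexists; apply: (@glue_over (A ** B ** C) D X E P _ _ _ (sf_id X)
  (fun w f => l12 (hsrc (snd f)) w (fst f) ++ l3 (fst (htgt (fst f))) (snd (htgt (fst f))) w
    (snd f))
  (fun xyz k => l4 (fst (fst xyz)) (snd (fst xyz)) (snd xyz) k)).
- move=> w; apply: (@glue_over (A ** B) C X E P _ _ _ (sf_comp (incl1 (A ** B ** C) w) (sf_id X))
    (fun z f => l12 z w f) (fun xy h => l3 (fst xy) (snd xy) w h)).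
  + move=> z; exact: glue12_over.
  + move=> [x y]; strict_comp.
  + apply: (@curry_over A B C X E P (sf_comp (incl1 (A ** B ** C) w) (sf_id X)) _ _ _ _ _ _ _
      (fun y z f => l1 y z w f) (fun x z g => l2 x z w g) (fun x y h => l3 x y w h)).
    * move=> y z; strict_comp.
    * move=> x z; strict_comp.
    * move=> y; strict_push.
    * move=> x; strict_push.
- move=> [[x y] z]; strict_comp.
- apply: (@curry_over (A ** B) C D X E P (sf_id X) _ _ _ _ _ _ _
   (fun z w f => l12 z w f) (fun xy w h => l3 (fst xy) (snd xy) w h) (fun xy z k =>
     l4 (fst xy) (snd xy) z k)).
  + move=> z w; exact: glue12_over.
  + move=> [x y] w; strict_comp.
  + move=> z; apply: (@curry_over A B D X E P (sf_comp (incl13 (A ** B) D z) (sf_id X)) _ _ _ _ _ _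
      _
      (fun y w f => l1 y z w f) (fun x w g => l2 x z w g) (fun x y h => l4 x y z h)).
    * move=> y w; strict_comp.
    * move=> x w; strict_comp.
    * move=> y; strict_push.
    * move=> x; strict_push.
  + move=> [x y]; strict_push.
Qed.
End Restr4Over.

(** One unitor slides above the other, and the lower one cancels against the compositor by the left
    unit law. *)
Lemma punit2 (A B : double_category) (P : psfunctor A B) x (e : htgt (hid x) = hsrc (hid x)) :
  punit P x <|> punit P x </> pcomp P e = punit P x.
Proof.
have e' := e; have h := pcomp_hid_l P (x := x) (f := hid x) e.
transitivity (punit P x </> (punit P x <|> Idh (ph P (hid x)) </> pcomp P e)).
  rewrite -sqvA; try bd. congr (_ </> _).
  transitivity ((Idh (hid (pob P x)) </> punit P x) <|> (punit P x </> Idh (ph P (hid x)))).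
    by rewrite idh_sqv ?sqv_idh; bd.
  rewrite -interchange; try bd.
  by rewrite -sq_id1v_vid idv_sqh; bd.
by rewrite h ?hsrc_hid // sqv_idh; bd.
Qed.

(** * Vertical strict transformations *)

Section SlotInclusions.
Variables (A B E : double_category) (F : ob B -> psfunctor A E) (G : ob A -> psfunctor B E).
Variable H : quasi2 F G.
Ltac ob_step ::= rewrite (q_ob H).

(* The invertible cells H(K,y) => (glue H)(K,1_y) and H(x,k) => (glue H)(1_x,k). *)
Definition inF K y : sq E := Idh (ph (F y) K) <|> punit (G (htgt K)) y.
Definition inG x k : sq E := punit (F (hsrc k)) x <|> Idh (ph (G x) k).

Lemma inF_glob K y : inv_globular (ph (F y) K) (ph (F y) K ;h ph (G (htgt K)) (hid y)) (inF K y).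
Proof.
eapply inv_globular_conv.
  apply: inv_globular_sqh; [exact: inv_globular_idh | exact: punit_glob | beq].
all: beq.
Qed.

Lemma inG_glob x k : inv_globular (ph (G x) k) (ph (F (hsrc k)) (hid x) ;h ph (G x) k) (inG x k).
Proof.
eapply inv_globular_conv.
  apply: inv_globular_sqh; [exact: punit_glob | exact: inv_globular_idh | beq].
all: beq.
Qed.

(** With [inF_unit] and [inF_sq], this is what conjugating a transformation by [inF] requires;
    [resF_vst] combines them with the axioms of the glued transformation. *)
Lemma inF_comp f g y (e : htgt f = hsrc g) (e1 : htgt (hid y) = hsrc (hid y)) :
  pcomp (F y) e </> inF (f ;h g) y = inF f y <|> inF g y </> glue_comp H e e1.
Proof.
rewrite /inF /glue_comp hsrc_hid.
have -> : htgt (f ;h g) = htgt g by beq.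
rewrite sqh_middle; try bd.
rewrite -sqvA; try bd.
rewrite interchange3; try bd.
rewrite e (qhh_hid_r H) !sqv_idh ?idh_sqv; try bd.
rewrite -sqh_middle; try bd.
rewrite interchange; try bd.
rewrite punit2 -?sq_id1h_hcomp ?idh_sqv; try bd.
transitivity ((pcomp (F y) e <|> Idh (hid (pob (G (htgt g)) y))) </> (Idh (ph (F y) (f ;h g)) <|>
  punit (G (htgt g)) y)).
  by rewrite sqh_idhid; bd.
by rewrite interchange ?sqv_idh ?idh_sqv; bd.
Qed.

Lemma inG_comp x f g (e : htgt (hid x) = hsrc (hid x)) (e1 : htgt f = hsrc g) :
  pcomp (G x) e1 </> inG x (f ;h g) = inG x f <|> inG x g </> glue_comp H e e1.
Proof.
rewrite /inG /glue_comp htgt_hid.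
have -> : hsrc (f ;h g) = hsrc f by beq.
rewrite sqh_middle; try bd.
rewrite -sqvA; try bd.
rewrite interchange3; try bd.
rewrite -e1 (qhh_hid_l H) !sqv_idh ?idh_sqv; try bd.
rewrite -sqh_middle; try bd.
rewrite interchange; try bd.
rewrite punit2 -?sq_id1h_hcomp ?idh_sqv; try bd.
transitivity ((Idh (hid (pob (F (hsrc f)) x)) <|> pcomp (G x) e1) </> (punit (F (hsrc f)) x <|>
  Idh (ph (G x) (f ;h g)))).
  by rewrite idhid_sqh; bd.
by rewrite interchange ?sqv_idh ?idh_sqv; bd.
Qed.

Lemma inF_unit x y : punit (F y) x </> inF (hid x) y = punit (F y) x <|> punit (G x) y.
Proof.
rewrite /inF htgt_hid.
transitivity ((punit (F y) x <|> Idh (hid (pob (G x) y))) </> (Idh (ph (F y) (hid x)) <|>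
  punit (G x) y)).
  by rewrite sqh_idhid; bd.
by rewrite interchange ?sqv_idh ?idh_sqv; bd.
Qed.

Lemma inG_unit x y : punit (G x) y </> inG x (hid y) = punit (F y) x <|> punit (G x) y.
Proof.
rewrite /inG hsrc_hid.
transitivity ((Idh (hid (pob (F y) x)) <|> punit (G x) y) </> (punit (F y) x <|>
  Idh (ph (G x) (hid y)))).
  by rewrite idhid_sqh; bd.
by rewrite interchange ?sqv_idh ?idh_sqv; bd.
Qed.

Lemma inF_sq a y : psq (F y) a </> inF (bot a) y = inF (top a) y </> glue_sq H a (Idh (hid y)).
Proof.
rewrite /inF /glue_sq top_id1h lft_id1h hsrc_hid qhv_vid psq_id1h.
rewrite -(sq_id1h_hcomp (f := ph (F y) (bot a))); try bd.
rewrite (sqv_idh (f := ph (F y) (bot a) ;h ph (G (htgt (bot a))) (hid y))); try bd.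
rewrite interchange; try bd.
rewrite idh_sqv; try bd.
rewrite htgt_top (qvh_hid H) -htgt_bot.
transitivity ((psq (F y) a <|> Idv (pv (F y) (rgt a))) </> (Idh (ph (F y) (bot a)) <|>
  punit (G (htgt (bot a))) y)).
  by rewrite sqh_idv; bd.
by rewrite interchange ?sqv_idh ?htgt_bot; bd.
Qed.

Lemma inG_sq x b : psq (G x) b </> inG x (bot b) = inG x (top b) </> glue_sq H (Idh (hid x)) b.
Proof.
rewrite /inG /glue_sq bot_id1h rgt_id1h htgt_hid qvh_vid psq_id1h.
rewrite -(sq_id1h_hcomp (g := ph (G x) (top b))); try bd.
rewrite (idh_sqv (f := ph (F (hsrc (top b))) (hid x) ;h ph (G x) (top b))); try bd.
rewrite interchange; try bd.
rewrite idh_sqv; try bd.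
rewrite hsrc_top (qhv_hid H) -hsrc_bot.
transitivity ((Idv (pv (G x) (lft b)) <|> psq (G x) b) </> (punit (F (hsrc (bot b))) x <|>
  Idh (ph (G x) (bot b)))).
  by rewrite idv_sqh; bd.
by rewrite interchange ?sqv_idh ?hsrc_bot; bd.
Qed.

(** Up to [inF], a mixed cell is the value of the glued functor on the square [(Idh K, Idv u)].
    Naturality of a transformation at that square thus yields its compatibility with the mixed
    cell. *)
Lemma inF_qhv K u : qhv H K u </> inF K (vtgt u) = inF K (vsrc u) </> glue_sq H (Idh K) (Idv u).
Proof.
rewrite /inF /glue_sq top_id1v lft_id1v bot_id1h rgt_id1h hsrc_hid qvh_vid psq_id1h.
rewrite -(sq_id1h_hcomp (f := ph (F (vsrc u)) K)); try bd.
rewrite (idh_sqv (f := ph (F (vsrc u)) K ;h ph (G (htgt K)) (hid (vsrc u)))); try bd.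
rewrite interchange; try bd.
rewrite idh_sqv; try bd.
rewrite punit_nat.
transitivity ((qhv H K u <|> Idv (pv (G (htgt K)) u)) </> (Idh (ph (F (vtgt u)) K) <|>
  punit (G (htgt K)) (vtgt u))).
  by rewrite sqh_idv; bd.
by rewrite interchange ?sqv_idh; bd.
Qed.

Lemma inG_qvh U k : qvh H U k </> inG (vtgt U) k = inG (vsrc U) k </> glue_sq H (Idv U) (Idh k).
Proof.
rewrite /inG /glue_sq top_id1h lft_id1h bot_id1v rgt_id1v htgt_hid qhv_vid psq_id1h.
rewrite -(sq_id1h_hcomp (g := ph (G (vtgt U)) k)); try bd.
rewrite (sqv_idh (f := ph (F (hsrc k)) (hid (vtgt U)) ;h ph (G (vtgt U)) k)); try bd.
rewrite interchange; try bd.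
rewrite idh_sqv; try bd.
rewrite punit_nat.
transitivity ((Idv (pv (F (hsrc k)) U) <|> qvh H U k) </> (punit (F (hsrc k)) (vtgt U) <|>
  Idh (ph (G (vtgt U)) k))).
  by rewrite idv_sqh; bd.
by rewrite interchange ?sqv_idh; bd.
Qed.

(** In this order the interchange cell occurs only at identities, so the unit laws cancel
    everything. It allows a glued transformation to be recovered from its restrictions. *)
Lemma in_FG K k (e : htgt K = hsrc (hid (htgt K))) (e' : htgt (hid (hsrc k)) = hsrc k) :
  inF K (hsrc k) <|> inG (htgt K) k </> glue_comp H e e' = Idh (ph (F (hsrc k)) K ;h
    ph (G (htgt K)) k).
Proof.
rewrite /inF /inG /glue_comp hsrc_hid htgt_hid.
rewrite sqh_middle; try bd.
rewrite -sqvA; try bd.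
rewrite interchange3; try bd.
(* At two identities the interchange cell only swaps the unitors of the two one-variable
   functors. *)
have -> : punit (G (htgt K)) (hsrc k) <|> punit (F (hsrc k)) (htgt K) </>
  qhh H (hid (htgt K)) (hid (hsrc k))
   = punit (F (hsrc k)) (htgt K) <|> punit (G (htgt K)) (hsrc k).
  have := qhh_hid_r H (hid (htgt K)) (hsrc k); rewrite hsrc_hid htgt_hid => h.
  transitivity (((Idh (hid (pob (G (htgt K)) (hsrc k))) </> punit (G (htgt K)) (hsrc k)) <|>
    (punit (F (hsrc k)) (htgt K) </> Idh (ph (F (hsrc k)) (hid (htgt K))))) </>
      qhh H (hid (htgt K)) (hid (hsrc k))).
    by rewrite idh_sqv ?sqv_idh; bd.
  rewrite -interchange; try bd.
  rewrite sqvA; try bd.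
  rewrite h idhid_sqh; try bd.
  transitivity ((punit (F (hsrc k)) (htgt K) <|> Idh (hid (pob (G (htgt K)) (hsrc k)))) </>
    (Idh (ph (F (hsrc k)) (hid (htgt K))) <|> punit (G (htgt K)) (hsrc k))).
    by rewrite sqh_idhid; bd.
  by rewrite interchange ?sqv_idh ?idh_sqv; bd.
rewrite !sqv_idh; try bd.
rewrite -sqh_middle; try bd.
rewrite interchange; try bd.
by rewrite pcomp1r pcomp1l sq_id1h_hcomp; bd.
Qed.

(** In the opposite order the compositor leaves the interchange cell behind; so respecting the glued
    compositors forces a transformation to respect [qhh]. *)
Lemma in_GF K k (e : htgt (hid (hsrc K)) = hsrc K) (e' : htgt k = hsrc (hid (htgt k))) :
  inG (hsrc K) k <|> inF K (htgt k) </> glue_comp H e e' = qhh H K k.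
Proof.
rewrite /inF /inG /glue_comp.
rewrite sqh_middle; try bd.
rewrite -sqvA; try bd.
rewrite interchange3; try bd.
rewrite -(sq_id1h_hcomp (f := ph (G (hsrc K)) k)); try bd.
rewrite !sqv_idh ?idh_sqv; try bd.
transitivity ((Idh (hid (pob (G (hsrc K)) (hsrc k))) </> punit (F (hsrc k)) (hsrc K)) <|>
  (qhh H K k </> Idh (ph (F (hsrc k)) K ;h ph (G (htgt K)) k)) <|>
  (Idh (hid (pob (G (htgt K)) (htgt k))) </> punit (G (htgt K)) (htgt k)) </>
    (pcomp (F (hsrc k)) e <|> pcomp (G (htgt K)) e')).
  by rewrite !idh_sqv ?sqv_idh; bd.
rewrite -interchange3; try bd.
rewrite idhid_sqh ?sqh_idhid; try bd.
rewrite sqvA; try bd.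
rewrite sq_id1h_hcomp; try bd.
rewrite -sqh_middle; try bd.
rewrite interchange; try bd.
by rewrite pcomp1r pcomp1l -sq_id1h_hcomp ?sqv_idh; bd.
Qed.
Lemma inF_boundary K y : boundary (inF K y) (ph (F y) K)
  (ph (F y) K ;h ph (G (htgt K)) (hid y)) (vid (pob (G (hsrc K)) y)) (vid (pob (G (htgt K)) y)).
Proof. rewrite /inF; bd. Qed.
Lemma inG_boundary x k : boundary (inG x k) (ph (G x) k)
  (ph (F (hsrc k)) (hid x) ;h ph (G x) k) (vid (pob (G x) (hsrc k))) (vid (pob (G x) (htgt k))).
Proof. rewrite /inG; bd. Qed.
Lemma vinF_boundary K y : boundary (vinv (inF K y))
  (ph (F y) K ;h ph (G (htgt K)) (hid y)) (ph (F y) K) (vid (pob (G (hsrc K)) y))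
    (vid (pob (G (htgt K)) y)).
Proof.
have [_ [_ ig]] := vinvP (inF_glob K y).
eapply boundary_conv; [exact: (boundary_ig ig)|beq|beq|beq|beq].
Qed.
Lemma vinG_boundary x k : boundary (vinv (inG x k))
  (ph (F (hsrc k)) (hid x) ;h ph (G x) k) (ph (G x) k) (vid (pob (G x) (hsrc k)))
    (vid (pob (G x) (htgt k))).
Proof.
have [_ [_ ig]] := vinvP (inG_glob x k).
eapply boundary_conv; [exact: (boundary_ig ig)|beq|beq|beq|beq].
Qed.
End SlotInclusions.

Lemma boundary_vst (A B : double_category) (F G : psfunctor A B) t0 t1 : is_vst F G t0 t1 ->
  forall f, boundary (t1 f) (ph F f) (ph G f) (t0 (hsrc f)) (t0 (htgt f)).
Proof. by move=> t f; split; rewrite ?(vst_top t) ?(vst_bot t) ?(vst_lft t) ?(vst_rgt t). Qed.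

Section GlueVst.
Variables (A B E : double_category) (F F' : ob B -> psfunctor A E) (G G' : ob A -> psfunctor B E).
Variables (H : quasi2 F G) (H' : quasi2 F' G').
Variables (r0 : ob A -> ob B -> vcell E) (s : hcell A -> ob B -> sq E) (t : ob A -> hcell B ->
  sq E).
Hypothesis hs : forall y, is_vst (F y) (F' y) (fun x => r0 x y) (fun K => s K y).
Hypothesis ht : forall x, is_vst (G x) (G' x) (fun y => r0 x y) (fun k => t x k).
Hypothesis hq : quasi2_vst H H' s t.

Lemma r0_src x y : vsrc (r0 x y) = pob (G x) y. Proof. exact: (vst_src (ht x) y). Qed.
Lemma r0_tgt x y : vtgt (r0 x y) = pob (G' x) y. Proof. exact: (vst_tgt (ht x) y). Qed.
Lemma s_boundary K y : boundary (s K y) (ph (F y) K) (ph (F' y) K) (r0 (hsrc K) y) (r0 (htgt K) y).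
Proof. exact: (boundary_vst (hs y) K). Qed.
Lemma t_boundary x k : boundary (t x k) (ph (G x) k) (ph (G' x) k) (r0 x (hsrc k)) (r0 x (htgt k)).
Proof. exact: (boundary_vst (ht x) k). Qed.
Ltac ob_step ::= first [rewrite (q_ob H) | rewrite (q_ob H') | rewrite r0_src | rewrite r0_tgt].
Ltac typ_atom ::= first [apply s_boundary | apply t_boundary].

(** The compositors meet the components in three columns, and the middle one is [q2v_hh]; naturality
    at squares uses [q2v_hv] and [q2v_vh] for the mixed cells inside [glue_sq]. *)
Lemma glue_vst : is_vst (glue H) (glue H') (fun xy => r0 (fst xy) (snd xy))
  (fun f => s (fst f) (hsrc (snd f)) <|> t (htgt (fst f)) (snd f)).
Proof.
split.
- move=> [x y] /=; beq.
- move=> [x y] /=; beq.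
- move=> [f g] /=; bd.
- move=> [f g] /=; bd.
- move=> [f g] /=; bd.
- move=> [f g] /=; bd.
- move=> [u v] /=.
  have e1 := vst_nat_v (hs (vsrc v)) u; have e2 := vst_nat_v (ht (vtgt u)) v.
  rewrite vcompA; try beq. rewrite e2.
  rewrite -vcompA; try beq. rewrite e1.
  rewrite vcompA; beq.
- move=> [f g] [f' g'] e; case: (e) => e1 e2; rewrite /= /glue_comp.
  have -> : hsrc (g ;h g') = hsrc g by beq.
  have -> : htgt (f ;h f') = htgt f' by beq.
  rewrite sqvA; try bd.
  rewrite (@interchange _ (pcomp _ _)); try bd.
  rewrite (vst_comp (hs (hsrc g)) (f_equal fst e)) (vst_comp (ht (htgt f')) (f_equal snd e)).
  rewrite -interchange; try bd.
  rewrite -!sqvA; try bd.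
  congr (_ </> _).
  rewrite !sqh_middle; try bd.
  rewrite !interchange3; try bd.
  rewrite (q2v_hh hq) e1 -e2 idh_sqv ?sqv_idh; try bd.
  by rewrite idh_sqv; bd.
- move=> [x y] /=; rewrite hsrc_hid htgt_hid interchange; try bd.
  rewrite (vst_unit (hs y)) (vst_unit (ht x)) -interchange; try bd.
  by rewrite idv_sqh; bd.
- move=> [a b] /=; rewrite /glue_sq.
  rewrite sqvA; try bd.
  rewrite interchange; try bd.
  rewrite (vst_nat_sq (ht (htgt (bot a)))) hsrc_bot (q2v_hv hq).
  rewrite -interchange; try bd.
  rewrite -sqvA; try bd.
  rewrite interchange; try bd.
  rewrite htgt_bot (q2v_vh hq) -htgt_bot.
  have := vst_nat_sq (hs (hsrc (top b))) a; rewrite hsrc_top => ->.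
  rewrite -interchange; try bd.
  rewrite sqvA; try bd.
Qed.
End GlueVst.

Section GlueFull.
Variables (A B E : double_category) (F F' : ob B -> psfunctor A E) (G G' : ob A -> psfunctor B E).
Variables (H : quasi2 F G) (H' : quasi2 F' G').
Variables (th0 : ob (A ** B) -> vcell E) (th1 : hcell (A ** B) -> sq E).
Hypothesis th : is_vst (glue H) (glue H') th0 th1.

Lemma th0_src x y : vsrc (th0 (x, y)) = pob (G x) y.
Proof. by rewrite (vst_src th) /= (q_ob H). Qed.
Lemma th0_tgt x y : vtgt (th0 (x, y)) = pob (G' x) y.
Proof. by rewrite (vst_tgt th) /= (q_ob H'). Qed.
Lemma th1_boundary f g : boundary (th1 (f, g)) (ph (F (hsrc g)) f ;h ph (G (htgt f)) g)
  (ph (F' (hsrc g)) f ;h ph (G' (htgt f)) g) (th0 (hsrc f, hsrc g)) (th0 (htgt f, htgt g)).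
Proof. exact: (boundary_vst th (f, g)). Qed.
Ltac ob_step ::= first [rewrite (q_ob H) | rewrite (q_ob H') | rewrite th0_src | rewrite th0_tgt].
Ltac typ_atom ::= first [apply th1_boundary | apply (inF_boundary H) | apply (inF_boundary H')
  | apply (inG_boundary H)
  | apply (inG_boundary H') | apply (vinF_boundary H') | apply (vinG_boundary H')].

Definition resF K y : sq E := inF F G K y </> th1 (K, hid y) </> vinv (inF F' G' K y).
Definition resG x k : sq E := inG F G x k </> th1 (hid x, k) </> vinv (inG F' G' x k).

Lemma resF_boundary K y : boundary (resF K y) (ph (F y) K) (ph (F' y) K) (th0 (hsrc K, y))
  (th0 (htgt K, y)).
Proof. rewrite /resF; bd. Qed.
Lemma resG_boundary x k : boundary (resG x k) (ph (G x) k) (ph (G' x) k) (th0 (x, hsrc k))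
  (th0 (x, htgt k)).
Proof. rewrite /resG; bd. Qed.

(** The characterisation used from here on: it mentions no inverse, and [inF] is cancelled at the
    end of each argument. *)
Lemma resF_in K y : resF K y </> inF F' G' K y = inF F G K y </> th1 (K, hid y).
Proof.
have [_ [e _]] := vinvP (inF_glob H' K y).
by rewrite /resF sqvA ?e ?sqv_idh; bd.
Qed.
Lemma resG_in x k : resG x k </> inG F' G' x k = inG F G x k </> th1 (hid x, k).
Proof.
have [_ [e _]] := vinvP (inG_glob H' x k).
by rewrite /resG sqvA ?e ?sqv_idh; bd.
Qed.

(** Composability is given in each variable rather than as an equation between pairs, which lets
    identities be inserted in one variable only. *)
Lemma th1_comp f f' g g' (e : htgt f = hsrc f') (e' : htgt g = hsrc g') :
  glue_comp H e e' </> th1 (f ;h f', g ;h g') = th1 (f, g) <|> th1 (f', g') </> glue_comp H' e e'.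
Proof.
have e2 : @htgt (A ** B) (f, g) = @hsrc (A ** B) (f', g') by apply: (f_equal2 pair).
have := vst_comp th e2; rewrite /=.
by rewrite (proof_irrelevance _ (f_equal fst e2) e) (proof_irrelevance _ (f_equal snd e2) e').
Qed.

Lemma th1_sq a b : glue_sq H a b </> th1 (bot a, bot b) = th1 (top a, top b) </> glue_sq H' a b.
Proof. exact: (vst_nat_sq th (a, b)). Qed.

Lemma th1_unit x y : punit (F y) x <|> punit (G x) y </> th1 (hid x, hid y)
  = Idv (th0 (x, y)) </> (punit (F' y) x <|> punit (G' x) y).
Proof. exact: (vst_unit th (x, y)). Qed.

Lemma th0_natF u y : pv (F y) u ;v th0 (vtgt u, y) = th0 (vsrc u, y) ;v pv (F' y) u.
Proof.
have := vst_nat_v th (u, vid y); rewrite /= /prod_map /= vsrc_vid vtgt_vid !pv_vid.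
rewrite (vid_compr (u := pv (F y) u)); try beq.
Qed.
Lemma th0_natG u x : pv (G x) u ;v th0 (x, vtgt u) = th0 (x, vsrc u) ;v pv (G' x) u.
Proof.
have := vst_nat_v th (vid x, u); rewrite /= /prod_map /= vsrc_vid vtgt_vid !pv_vid.
rewrite (vid_compl (u := pv (G x) u)); try beq.
Qed.

Ltac typ_atom ::= first [apply th1_boundary | apply (inF_boundary H) | apply (inF_boundary H')
  | apply (inG_boundary H)
  | apply (inG_boundary H') | apply (vinF_boundary H') | apply (vinG_boundary H')
  | apply resF_boundary | apply resG_boundary | apply boundary_glue_comp | apply boundary_glue_sq].

Lemma resF_vst y : is_vst (F y) (F' y) (fun x => th0 (x, y)) (fun K => resF K y).
Proof.
split.
- move=> x; beq.
- move=> x; beq.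
- by move=> f; case: (resF_boundary f y).
- by move=> f; case: (resF_boundary f y) => _ [].
- by move=> f; case: (resF_boundary f y) => _ [_ []].
- by move=> f; case: (resF_boundary f y) => _ [_ []].
- move=> u; exact: th0_natF.
- move=> f g e.
  have e1 : htgt (hid y) = hsrc (hid y) by beq.
  apply: (vinv_cancel (inF_glob H' (f ;h g) y)); try bd.
  rewrite sqvA ?resF_in; try bd.
  rewrite -sqvA; try bd.
  rewrite (inF_comp H e e1).
  (* [(f ;h g, hid y)] is the composite of [(f, hid y)] and [(g, hid y)], because [hid y ;h hid y]
     collapses. *)
  have := th1_comp e e1; rewrite hid_hcomp => hc.
  rewrite sqvA ?hc; try bd.
  rewrite -sqvA; try bd.
  rewrite interchange -?resF_in -?interchange; try bd.
  rewrite sqvA -?(inF_comp H' e e1); try bd.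
  by rewrite -sqvA; bd.
- move=> x.
  apply: (vinv_cancel (inF_glob H' (hid x) y)); try bd.
  rewrite sqvA ?resF_in; try bd.
  rewrite -sqvA; try bd.
  rewrite (inF_unit H) th1_unit sqvA; try bd.
  by rewrite (inF_unit H').
- move=> a.
  apply: (vinv_cancel (inF_glob H' (bot a) y)); try bd.
  rewrite sqvA ?resF_in; try bd.
  rewrite -sqvA; try bd.
  rewrite (inF_sq H) sqvA; try bd.
  have := th1_sq a (Idh (hid y)); rewrite bot_id1h top_id1h => ->.
  rewrite -sqvA; try bd.
  rewrite -resF_in sqvA; try bd.
  by rewrite -(inF_sq H') sqvA; bd.
Qed.

Lemma resG_vst x : is_vst (G x) (G' x) (fun y => th0 (x, y)) (fun k => resG x k).
Proof.
split.
- move=> y; beq.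
- move=> y; beq.
- by move=> f; case: (resG_boundary x f).
- by move=> f; case: (resG_boundary x f) => _ [].
- by move=> f; case: (resG_boundary x f) => _ [_ []].
- by move=> f; case: (resG_boundary x f) => _ [_ []].
- move=> u; exact: th0_natG.
- move=> f g e.
  have e1 : htgt (hid x) = hsrc (hid x) by beq.
  apply: (vinv_cancel (inG_glob H' x (f ;h g))); try bd.
  rewrite sqvA ?resG_in; try bd.
  rewrite -sqvA; try bd.
  rewrite (inG_comp H e1 e).
  have := th1_comp e1 e; rewrite hid_hcomp => hc.
  rewrite sqvA ?hc; try bd.
  rewrite -sqvA; try bd.
  rewrite interchange -?resG_in -?interchange; try bd.
  rewrite sqvA -?(inG_comp H' e1 e); try bd.
  by rewrite -sqvA; bd.
- move=> y.
  apply: (vinv_cancel (inG_glob H' x (hid y))); try bd.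
  rewrite sqvA ?resG_in; try bd.
  rewrite -sqvA; try bd.
  rewrite (inG_unit H) th1_unit sqvA; try bd.
  by rewrite (inG_unit H').
- move=> a.
  apply: (vinv_cancel (inG_glob H' x (bot a))); try bd.
  rewrite sqvA ?resG_in; try bd.
  rewrite -sqvA; try bd.
  rewrite (inG_sq H) sqvA; try bd.
  have := th1_sq (Idh (hid x)) a; rewrite bot_id1h top_id1h => ->.
  rewrite -sqvA; try bd.
  rewrite -resG_in sqvA; try bd.
  by rewrite -(inG_sq H') sqvA; bd.
Qed.

(** [(K, k)] factors as [(K, hid _)] followed by [(hid _, k)], and by [in_FG] the compositor of this
    factorisation undoes the two inclusions. *)
Lemma res_hh K k : resF K (hsrc k) <|> resG (htgt K) k = th1 (K, k).
Proof.
have e : htgt K = hsrc (hid (htgt K)) by beq.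
have e' : htgt (hid (hsrc k)) = hsrc k by beq.
transitivity (resF K (hsrc k) <|> resG (htgt K) k </> (inF F' G' K (hsrc k) <|>
  inG F' G' (htgt K) k </> glue_comp H' e e')).
  by rewrite (in_FG H') sqv_idh; bd.
rewrite -sqvA; try bd.
rewrite interchange; try bd.
rewrite resF_in resG_in -interchange; try bd.
rewrite sqvA; try bd.
rewrite -th1_comp -sqvA; try bd.
by rewrite (in_FG H) idh_sqv ?hid_compr ?hid_compl; bd.
Qed.

Lemma res_quasi2 : quasi2_vst H H' resF resG.
Proof.
split.
(* Here [(K, k)] is factored in the opposite order, and by [in_GF] that factorisation produces the
   interchange cells. *)
- move=> K k; rewrite res_hh.
  have e : htgt (hid (hsrc K)) = hsrc K by beq.
  have e' : htgt k = hsrc (hid (htgt k)) by beq.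
  rewrite -(in_GF H e e') -(in_GF H' e e').
  have := th1_comp e e'; rewrite hid_compl ?hid_compr // => h.
  rewrite sqvA ?h; try bd.
  rewrite -sqvA; try bd.
  rewrite interchange; try bd.
  rewrite -resF_in -resG_in -interchange; try bd.
  by rewrite sqvA; bd.
- move=> K u.
  apply: (vinv_cancel (inF_glob H' K (vtgt u))); try bd.
  rewrite sqvA ?resF_in; try bd.
  rewrite -sqvA; try bd.
  rewrite (inF_qhv H) sqvA; try bd.
  have := th1_sq (Idh K) (Idv u); rewrite bot_id1h top_id1h bot_id1v top_id1v => ->.
  rewrite -sqvA; try bd.
  rewrite -resF_in sqvA; try bd.
  by rewrite -(inF_qhv H') sqvA; bd.
- move=> U k.
  apply: (vinv_cancel (inG_glob H' (vtgt U) k)); try bd.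
  rewrite sqvA ?resG_in; try bd.
  rewrite -sqvA; try bd.
  rewrite (inG_qvh H) sqvA; try bd.
  have := th1_sq (Idv U) (Idh k); rewrite bot_id1h top_id1h bot_id1v top_id1v => ->.
  rewrite -sqvA; try bd.
  rewrite -resG_in sqvA; try bd.
  by rewrite -(inG_qvh H') sqvA; bd.
Qed.
End GlueFull.

(** * Transformations between curried quasi-functors *)

Section CurrySlotInclusions.
Variables (A B C E : double_category)
    (F1 : ob B -> ob C -> psfunctor A E)
    (F2 : ob A -> ob C -> psfunctor B E)
    (F3 : ob A -> ob B -> psfunctor C E)
    (H12 : forall z, quasi2 (fun y => F1 y z) (fun x => F2 x z))
    (H13 : forall y, quasi2 (fun z => F1 y z) (fun x => F3 x y))
    (H23 : forall x, quasi2 (fun z => F2 x z) (fun y => F3 x y)).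
Ltac ob_step ::= first [rewrite (q3_ob1 H13) | rewrite (q3_ob2 H23)].
Notation in1 f y z := (inF (fun y => F1 y z) (fun x => F2 x z) f y).
Notation in2 x g z := (inG (fun y => F1 y z) (fun x => F2 x z) x g).

Lemma boundary_curry_hh f g h : boundary (curry_hh H13 H23 f g h)
  (ph (F3 (hsrc f) (hsrc g)) h ;h (ph (F1 (hsrc g) (htgt h)) f ;h ph (F2 (htgt f) (htgt h)) g))
  (ph (F1 (hsrc g) (hsrc h)) f ;h ph (F2 (htgt f) (hsrc h)) g ;h ph (F3 (htgt f) (htgt g)) h)
  (vid (pob (F3 (hsrc f) (hsrc g)) (hsrc h))) (vid (pob (F3 (htgt f) (htgt g)) (htgt h))).
Proof. rewrite /curry_hh; bd. Qed.
Lemma boundary_curry_hv f g w : boundary (curry_hv H13 H23 f g w)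
  (ph (F1 (hsrc g) (vsrc w)) f ;h ph (F2 (htgt f) (vsrc w)) g)
  (ph (F1 (hsrc g) (vtgt w)) f ;h ph (F2 (htgt f) (vtgt w)) g)
  (pv (F3 (hsrc f) (hsrc g)) w) (pv (F3 (htgt f) (htgt g)) w).
Proof. rewrite /curry_hv; bd. Qed.

(** At [(f, hid y)] the crossing with the second factor is at an identity, where [qhh_hid_l] reduces
    it to a unitor; the crossing with [f] is what survives. *)
Lemma curry_hh_in1 f y h :
  Idh (ph (F3 (hsrc f) y) h) <|> in1 f y (htgt h) </> curry_hh H13 H23 f (hid y) h
  = qhh (H13 y) f h </> (in1 f y (hsrc h) <|> Idh (ph (F3 (htgt f) y) h)).
Proof.
rewrite /inF /curry_hh hsrc_hid.
rewrite -sqhA; try bd.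
rewrite -sqvA; try bd.
rewrite (@interchange _ (_ <|> _)); try bd.
transitivity ((qhh (H13 y) f h <|> punit (F2 (htgt f) (htgt h)) y) </>
  (Idh (ph (F1 y (hsrc h)) f) <|> qhh (H23 (htgt f)) (hid y) h)).
  congr (_ </> _); congr (_ <|> _).
    by rewrite -sq_id1h_hcomp ?idh_sqv; bd.
  by rewrite sqv_idh; bd.
transitivity ((qhh (H13 y) f h <|> Idh (hid (pob (F3 (htgt f) y) (htgt h)))) </>
  (Idh (ph (F1 y (hsrc h)) f) <|>
   (Idh (ph (F3 (htgt f) y) h) <|> punit (F2 (htgt f) (htgt h)) y)) </>
     (Idh (ph (F1 y (hsrc h)) f) <|> qhh (H23 (htgt f)) (hid y) h)).
  congr (_ </> _).
  rewrite -(@sqhA _ (Idh _) (Idh _)); try bd.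
  rewrite interchange; try bd.
  rewrite -sq_id1h_hcomp; try bd.
  by rewrite sqv_idh ?idh_sqv; bd.
rewrite sqh_idhid; try bd.
rewrite sqvA; try bd.
congr (_ </> _).
rewrite interchange; try bd.
rewrite (qhh_hid_l (H23 (htgt f))) idh_sqv; try bd.
by rewrite -sqhA; bd.
Qed.

Lemma curry_hh_in2 x g h :
  Idh (ph (F3 x (hsrc g)) h) <|> in2 x g (htgt h) </> curry_hh H13 H23 (hid x) g h
  = qhh (H23 x) g h </> (in2 x g (hsrc h) <|> Idh (ph (F3 x (htgt g)) h)).
Proof.
rewrite /inG /curry_hh htgt_hid.
rewrite -sqhA; try bd.
rewrite -sqvA; try bd.
rewrite (@interchange _ (_ <|> _)); try bd.
rewrite (qhh_hid_l (H13 (hsrc g))) sqv_idh; try bd.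
rewrite sqhA; try bd.
rewrite interchange; try bd.
rewrite sqv_idh; try bd.
rewrite -sq_id1h_hcomp; try bd.
rewrite idh_sqv; try bd.
rewrite sqhA; try bd.
transitivity ((Idh (hid (pob (F3 x (hsrc g)) (hsrc h))) <|> qhh (H23 x) g h) </>
  (punit (F1 (hsrc g) (hsrc h)) x <|> (Idh (ph (F2 x (hsrc h)) g) <|> Idh (ph (F3 x (htgt g)) h)))).
  by rewrite interchange -?sq_id1h_hcomp ?idh_sqv ?sqv_idh; bd.
by rewrite idhid_sqh; bd.
Qed.

Lemma curry_hv_in1 f y w :
  in1 f y (vsrc w) </> curry_hv H13 H23 f (hid y) w = qhv (H13 y) f w </> in1 f y (vtgt w).
Proof.
rewrite /inF /curry_hv hsrc_hid interchange; try bd.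
rewrite (qhv_hid (H23 (htgt f))) idh_sqv; try bd.
transitivity ((qhv (H13 y) f w <|> Idv (pv (F3 (htgt f) y) w)) </> (Idh (ph (F1 y (vtgt w)) f) <|>
  punit (F2 (htgt f) (vtgt w)) y)).
  by rewrite interchange ?sqv_idh; bd.
by rewrite sqh_idv; bd.
Qed.

Lemma curry_hv_in2 x g w :
  in2 x g (vsrc w) </> curry_hv H13 H23 (hid x) g w = qhv (H23 x) g w </> in2 x g (vtgt w).
Proof.
rewrite /inG /curry_hv htgt_hid interchange; try bd.
rewrite (qhv_hid (H13 (hsrc g))) idh_sqv; try bd.
transitivity ((Idv (pv (F3 x (hsrc g)) w) <|> qhv (H23 x) g w) </>
  (punit (F1 (hsrc g) (vtgt w)) x <|> Idh (ph (F2 x (vtgt w)) g))).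
  by rewrite interchange ?sqv_idh; bd.
by rewrite idv_sqh; bd.
Qed.
End CurrySlotInclusions.

Section Curry3Vst.
Variables (A B C E : double_category)
    (F1 F1' : ob B -> ob C -> psfunctor A E)
    (F2 F2' : ob A -> ob C -> psfunctor B E)
    (F3 F3' : ob A -> ob B -> psfunctor C E)
    (H12 : forall z, quasi2 (fun y => F1 y z) (fun x => F2 x z))
    (H13 : forall y, quasi2 (fun z => F1 y z) (fun x => F3 x y))
    (H23 : forall x, quasi2 (fun z => F2 x z) (fun y => F3 x y))
    (H12' : forall z, quasi2 (fun y => F1' y z) (fun x => F2' x z))
    (H13' : forall y, quasi2 (fun z => F1' y z) (fun x => F3' x y))
    (H23' : forall x, quasi2 (fun z => F2' x z) (fun y => F3' x y)).
Variables (H : quasi3_ax H12 H13 H23) (H' : quasi3_ax H12' H13' H23').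
Variables (r0 : ob A -> ob B -> ob C -> vcell E) (r1 : hcell A -> ob B -> ob C -> sq E)
  (r2 : ob A -> hcell B -> ob C -> sq E) (r3 : ob A -> ob B -> hcell C -> sq E).
Hypothesis v1 : forall y z, is_vst (F1 y z) (F1' y z) (fun x => r0 x y z) (fun f => r1 f y z).
Hypothesis v2 : forall x z, is_vst (F2 x z) (F2' x z) (fun y => r0 x y z) (fun g => r2 x g z).
Hypothesis v3 : forall x y, is_vst (F3 x y) (F3' x y) (fun z => r0 x y z) (fun h => r3 x y h).
Hypothesis q13 : forall y, quasi2_vst (H13 y) (H13' y) (fun f z => r1 f y z) (fun x h => r3 x y h).
Hypothesis q23 : forall x, quasi2_vst (H23 x) (H23' x) (fun g z => r2 x g z) (fun y h => r3 x y h).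

Lemma r3_src x y z : vsrc (r0 x y z) = pob (F3 x y) z. Proof. exact: (vst_src (v3 x y) z). Qed.
Lemma r3_tgt x y z : vtgt (r0 x y z) = pob (F3' x y) z. Proof. exact: (vst_tgt (v3 x y) z). Qed.
Ltac ob_step ::= first [rewrite (q3_ob1 H13) | rewrite (q3_ob2 H23) | rewrite (q3_ob1 H13')
  | rewrite (q3_ob2 H23')
  | rewrite r3_src | rewrite r3_tgt].
Lemma r1_boundary f y z : boundary (r1 f y z) (ph (F1 y z) f) (ph (F1' y z) f) (r0 (hsrc f) y z)
  (r0 (htgt f) y z).
Proof. exact: (boundary_vst (v1 y z) f). Qed.
Lemma r2_boundary f y z : boundary (r2 y f z) (ph (F2 y z) f) (ph (F2' y z) f) (r0 y (hsrc f) z)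
  (r0 y (htgt f) z).
Proof. exact: (boundary_vst (v2 y z) f). Qed.
Lemma r3_boundary f y z : boundary (r3 y z f) (ph (F3 y z) f) (ph (F3' y z) f) (r0 y z (hsrc f))
  (r0 y z (htgt f)).
Proof. exact: (boundary_vst (v3 y z) f). Qed.
Ltac typ_atom ::= first [apply r1_boundary | apply r2_boundary | apply r3_boundary].

(** The cells of slot 3 pass the components of slot 2 by [q23] and then those of slot 1 by [q13],
    following the two rows of [curry_hh] upwards. *)
Lemma curry_vst : quasi2_vst (curry H) (curry H')
  (fun f z => r1 (fst f) (hsrc (snd f)) z <|> r2 (htgt (fst f)) (snd f) z) (fun xy h =>
    r3 (fst xy) (snd xy) h).
Proof.
split.
- move=> [f g] h; rewrite /= /curry_hh.
  rewrite sqvA; try bd.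
  rewrite (sqhA (c := r3 _ _ _)); try bd.
  rewrite (@interchange _ (Idh _)); try bd.
  rewrite (q2v_hh (q23 (htgt f))) idh_sqv; try bd.
  transitivity (qhh (H13 (hsrc g)) f h <|> Idh (ph (F2 (htgt f) (htgt h)) g) </>
    (r1 f (hsrc g) (hsrc h) <|> (r3 (htgt f) (hsrc g) h <|> r2 (htgt f) g (htgt h))
      </> (Idh (ph (F1' (hsrc g) (hsrc h)) f) <|> qhh (H23' (htgt f)) g h))).
    by rewrite (@interchange _ (r1 _ _ _)) ?sqv_idh; bd.
  rewrite -sqhA; try bd.
  rewrite -sqvA; try bd.
  rewrite interchange; try bd.
  rewrite (q2v_hh (q13 (hsrc g))) idh_sqv; try bd.
  rewrite -!sqvA; try bd.
  congr (_ </> _).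
  rewrite -sqhA; try bd.
  by rewrite interchange ?sqv_idh; bd.
- move=> [f g] w; rewrite /= /curry_hv !interchange; try bd.
  by rewrite (q2v_hv (q13 (hsrc g))) (q2v_hv (q23 (htgt f))).
- move=> [u v] h; rewrite /= /curry_vh sqvA; try bd.
  rewrite (q2v_vh (q23 (vtgt u))) -sqvA; try bd.
  by rewrite (q2v_vh (q13 (vsrc v))) -sqvA; bd.
Qed.
End Curry3Vst.

Section Curry3Full.
Variables (A B C E : double_category)
    (F1 F1' : ob B -> ob C -> psfunctor A E)
    (F2 F2' : ob A -> ob C -> psfunctor B E)
    (F3 F3' : ob A -> ob B -> psfunctor C E)
    (H12 : forall z, quasi2 (fun y => F1 y z) (fun x => F2 x z))
    (H13 : forall y, quasi2 (fun z => F1 y z) (fun x => F3 x y))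
    (H23 : forall x, quasi2 (fun z => F2 x z) (fun y => F3 x y))
    (H12' : forall z, quasi2 (fun y => F1' y z) (fun x => F2' x z))
    (H13' : forall y, quasi2 (fun z => F1' y z) (fun x => F3' x y))
    (H23' : forall x, quasi2 (fun z => F2' x z) (fun y => F3' x y)).
Variables (H : quasi3_ax H12 H13 H23) (H' : quasi3_ax H12' H13' H23').
Variables (r0 : ob (A ** B) -> ob C -> vcell E) (s : ob C -> hcell (A ** B) -> sq E)
  (t : ob (A ** B) -> hcell C -> sq E).
Hypothesis hs : forall z, is_vst (glue (H12 z)) (glue (H12' z)) (fun xy => r0 xy z) (s z).
Hypothesis ht : forall xy : ob (A ** B), is_vst (F3 (fst xy) (snd xy)) (F3' (fst xy) (snd xy))
  (fun z => r0 xy z) (t xy).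
Hypothesis hq : quasi2_vst (curry H) (curry H') (fun f z => s z f) t.

Notation in1 f y z := (inF (fun y => F1 y z) (fun x => F2 x z) f y).
Notation in2 x g z := (inG (fun y => F1 y z) (fun x => F2 x z) x g).
Notation in1' f y z := (inF (fun y => F1' y z) (fun x => F2' x z) f y).
Notation in2' x g z := (inG (fun y => F1' y z) (fun x => F2' x z) x g).
Notation res1 f y z := (resF (fun y => F1 y z) (fun y => F1' y z) (fun x => F2 x z) (fun x =>
  F2' x z) (s z) f y).
Notation res2 x g z := (resG (fun y => F1 y z) (fun y => F1' y z) (fun x => F2 x z) (fun x =>
  F2' x z) (s z) x g).

Let r0_src x y z : vsrc (r0 (x, y) z) = pob (F3 x y) z. Proof. exact: (vst_src (ht (x, y)) z). Qed.
Let r0_tgt x y z : vtgt (r0 (x, y) z) = pob (F3' x y) z. Proof. exact: (vst_tgt (ht (x, y)) z). Qed.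
Ltac ob_step ::= first [rewrite (q3_ob1 H13) | rewrite (q3_ob2 H23) | rewrite (q3_ob1 H13')
  | rewrite (q3_ob2 H23')
  | rewrite r0_src | rewrite r0_tgt].
Let s_boundary f g z : boundary (s z (f, g)) (ph (F1 (hsrc g) z) f ;h ph (F2 (htgt f) z) g)
  (ph (F1' (hsrc g) z) f ;h ph (F2' (htgt f) z) g) (r0 (hsrc f, hsrc g) z) (r0 (htgt f, htgt g) z).
Proof. exact: (boundary_vst (hs z) (f, g)). Qed.
Let t_boundary x y h : boundary (t (x, y) h) (ph (F3 x y) h) (ph (F3' x y) h) (r0 (x, y) (hsrc h))
  (r0 (x, y) (htgt h)).
Proof. exact: (boundary_vst (ht (x, y)) h). Qed.
Let res1_boundary K y z : boundary (res1 K y z) (ph (F1 y z) K) (ph (F1' y z) K) (r0 (hsrc K, y) z)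
  (r0 (htgt K, y) z).
Proof. exact: (resF_boundary (hs z)). Qed.
Let res2_boundary K y z : boundary (res2 y K z) (ph (F2 y z) K) (ph (F2' y z) K) (r0 (y, hsrc K) z)
  (r0 (y, htgt K) z).
Proof. exact: (resG_boundary (hs z)). Qed.
Let in1_boundary f y z : boundary (in1 f y z) (ph (F1 y z) f) (ph (F1 y z) f ;h
  ph (F2 (htgt f) z) (hid y))
  (vid (pob (F2 (hsrc f) z) y)) (vid (pob (F2 (htgt f) z) y)).
Proof. exact: (inF_boundary (H12 z)). Qed.
Let in1'_boundary f y z : boundary (in1' f y z) (ph (F1' y z) f) (ph (F1' y z) f ;h
  ph (F2' (htgt f) z) (hid y))
  (vid (pob (F2' (hsrc f) z) y)) (vid (pob (F2' (htgt f) z) y)).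
Proof. exact: (inF_boundary (H12' z)). Qed.
Let in2_boundary x g z : boundary (in2 x g z) (ph (F2 x z) g) (ph (F1 (hsrc g) z) (hid x) ;h
  ph (F2 x z) g)
  (vid (pob (F2 x z) (hsrc g))) (vid (pob (F2 x z) (htgt g))).
Proof. exact: (inG_boundary (H12 z)). Qed.
Let in2'_boundary x g z : boundary (in2' x g z) (ph (F2' x z) g) (ph (F1' (hsrc g) z) (hid x) ;h
  ph (F2' x z) g)
  (vid (pob (F2' x z) (hsrc g))) (vid (pob (F2' x z) (htgt g))).
Proof. exact: (inG_boundary (H12' z)). Qed.
Ltac typ_atom ::= first [apply s_boundary | apply t_boundary | apply res1_boundary | apply
  res2_boundary | apply in1_boundary
  | apply in2_boundary | apply in1'_boundary | apply in2'_boundary | apply boundary_curry_hh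
    | apply boundary_curry_hv ].

Let s_hh f g h : curry_hh H13 H23 f g h </> (s (hsrc h) (f, g) <|> t (htgt f, htgt g) h)
  = t (hsrc f, hsrc g) h <|> s (htgt h) (f, g) </> curry_hh H13' H23' f g h.
Proof. exact: (q2v_hh hq (f, g) h). Qed.
Let s_hv f g w : curry_hv H13 H23 f g w </> s (vtgt w) (f, g) = s (vsrc w) (f, g) </>
  curry_hv H13' H23' f g w.
Proof. exact: (q2v_hv hq (f, g) w). Qed.
Let s_vh u v h : curry_vh H13 H23 u v h </> t (vtgt u, vtgt v) h = t (vsrc u, vsrc v) h </>
  curry_vh H13' H23' u v h.
Proof. exact: (q2v_vh hq (u, v) h). Qed.
Let res1_in f y z : res1 f y z </> in1' f y z = in1 f y z </> s z (f, hid y).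
Proof. exact: (resF_in (hs z)). Qed.
Let res2_in x g z : res2 x g z </> in2' x g z = in2 x g z </> s z (hid x, g).
Proof. exact: (resG_in (hs z)). Qed.

(** Compatibility [hq] is evaluated at [(f, hid y)]; [curry_hh_in1] and [curry_hv_in1] transport it
    along the inclusion of slot 1, which is then cancelled. *)
Lemma curry_res13 y : quasi2_vst (H13 y) (H13' y) (fun f z => res1 f y z) (fun x h => t (x, y) h).
Proof.
split.
- move=> f h.
  have gl : inv_globular (ph (F1' y (hsrc h)) f ;h ph (F3' (htgt f) y) h)
     (ph (F1' y (hsrc h)) f ;h ph (F2' (htgt f) (hsrc h)) (hid y) ;h ph (F3' (htgt f) y) h)
     (in1' f y (hsrc h) <|> Idh (ph (F3' (htgt f) y) h)).
    by apply: inv_globular_sqh; [exact: (inF_glob (H12' (hsrc h))) | exact: inv_globular_idh | beq].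
  apply: (vinv_cancel gl); try bd.
  rewrite sqvA; try bd.
  rewrite interchange; try bd.
  rewrite res1_in.
  transitivity (qhh (H13 y) f h </> ((in1 f y (hsrc h) <|> Idh (ph (F3 (htgt f) y) h)) </>
    (s (hsrc h) (f, hid y) <|> t (htgt f, y) h))).
    by rewrite interchange ?idh_sqv ?sqv_idh; bd.
  rewrite -sqvA; try bd.
  rewrite -(curry_hh_in1 H13 H23) sqvA; try bd.
  have := s_hh f (hid y) h; rewrite hsrc_hid htgt_hid => ->.
  rewrite -sqvA; try bd.
  rewrite interchange; try bd.
  rewrite idh_sqv; try bd.
  rewrite -res1_in.
  rewrite -(@sqv_idh _ (ph (F3' (hsrc f) y) h) (t (hsrc f, y) h)); try bd.
  rewrite -interchange; try bd.
  rewrite sqvA; try bd.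
  rewrite (curry_hh_in1 H13' H23') sqv_idh; try bd.
  by rewrite sqvA; bd.
- move=> f w.
  apply: (vinv_cancel (inF_glob (H12' (vtgt w)) f y)); try bd.
  rewrite sqvA ?res1_in; try bd.
  rewrite -sqvA; try bd.
  rewrite -(curry_hv_in1 H13 H23) sqvA ?s_hv; try bd.
  rewrite -sqvA; try bd.
  rewrite -res1_in sqvA; try bd.
  by rewrite (curry_hv_in1 H13' H23') sqvA; bd.
- move=> u h.
  (* At a vertical identity in the second slot, the second factor of [curry_vh] is an identity. *)
  have := s_vh u (vid y) h.
  by rewrite /curry_vh vsrc_vid vtgt_vid !qvh_vid !sqv_idh; bd.
Qed.

Lemma curry_res23 x : quasi2_vst (H23 x) (H23' x) (fun g z => res2 x g z) (fun y h => t (x, y) h).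
Proof.
split.
- move=> g h.
  have gl : inv_globular (ph (F2' x (hsrc h)) g ;h ph (F3' x (htgt g)) h)
     (ph (F1' (hsrc g) (hsrc h)) (hid x) ;h ph (F2' x (hsrc h)) g ;h ph (F3' x (htgt g)) h)
     (in2' x g (hsrc h) <|> Idh (ph (F3' x (htgt g)) h)).
    by apply: inv_globular_sqh; [exact: (inG_glob (H12' (hsrc h))) | exact: inv_globular_idh | beq].
  apply: (vinv_cancel gl); try bd.
  rewrite sqvA; try bd.
  rewrite interchange; try bd.
  rewrite res2_in.
  transitivity (qhh (H23 x) g h </> ((in2 x g (hsrc h) <|> Idh (ph (F3 x (htgt g)) h)) </>
    (s (hsrc h) (hid x, g) <|> t (x, htgt g) h))).
    by rewrite interchange ?idh_sqv ?sqv_idh; bd.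
  rewrite -sqvA; try bd.
  rewrite -(curry_hh_in2 H13 H23) sqvA; try bd.
  have := s_hh (hid x) g h; rewrite hsrc_hid htgt_hid => ->.
  rewrite -sqvA; try bd.
  rewrite interchange; try bd.
  rewrite idh_sqv; try bd.
  rewrite -res2_in.
  rewrite -(@sqv_idh _ (ph (F3' x (hsrc g)) h) (t (x, hsrc g) h)); try bd.
  rewrite -interchange; try bd.
  rewrite sqvA; try bd.
  rewrite (curry_hh_in2 H13' H23') sqv_idh; try bd.
  by rewrite sqvA; bd.
- move=> g w.
  apply: (vinv_cancel (inG_glob (H12' (vtgt w)) x g)); try bd.
  rewrite sqvA ?res2_in; try bd.
  rewrite -sqvA; try bd.
  rewrite -(curry_hv_in2 H13 H23) sqvA ?s_hv; try bd.
  rewrite -sqvA; try bd.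
  rewrite -res2_in sqvA; try bd.
  by rewrite (curry_hv_in2 H13' H23') sqvA; bd.
- move=> v h.
  have := s_vh (vid x) v h.
  by rewrite /curry_vh vsrc_vid vtgt_vid !qvh_vid !idh_sqv; bd.
Qed.
End Curry3Full.

(** * The equivalences *)

Section Equivalence.
Variables (C D : category) (F : functor C D).
Definition full := forall X Y (g : chom (F X) (F Y)), exists f, fun_hom F f = g.
Definition faithful := forall X Y (f f' : chom X Y), fun_hom F f = fun_hom F f' -> f = f'.
Definition ess_surj := forall Y, exists X (i : chom (F X) Y), is_iso i.

(** The inverse functor conjugates by chosen isomorphisms and takes chosen preimages; faithfulness
    transfers all its laws to [D]. *)
Lemma equivalence_of_ff_es : full -> faithful -> ess_surj -> is_equivalence F.
Proof.
move=> fu fa es.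
have [G0 hG] : exists G0 : cob D -> cob C, forall Y, exists i : chom (F (G0 Y)) Y, is_iso i.
  exists (fun Y => proj1_sig (constructive_indefinite_description _ (es Y))) => Y.
  exact: proj2_sig (constructive_indefinite_description _ (es Y)).
pose i Y := proj1_sig (constructive_indefinite_description _ (hG Y)).
have hi Y : is_iso (i Y) := proj2_sig (constructive_indefinite_description _ (hG Y)).
pose j Y := proj1_sig (constructive_indefinite_description _ (hi Y)).
have ij Y : ccomp (i Y) (j Y) = cid _ by case:
  (proj2_sig (constructive_indefinite_description _ (hi Y))).
have ji Y : ccomp (j Y) (i Y) = cid _ by case:
  (proj2_sig (constructive_indefinite_description _ (hi Y))).
pose lift X Y (g : chom (F X) (F Y)) := proj1_sig (constructive_indefinite_description _
  (fu X Y g)).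
have liftP X Y (g : chom (F X) (F Y)) : fun_hom F (lift X Y g) = g.
  exact: proj2_sig (constructive_indefinite_description _ (fu X Y g)).
pose Gh Y Y' (g : chom Y Y') : chom (G0 Y) (G0 Y') := lift _ _ (ccomp (i Y) (ccomp g (j Y'))).
have Gid Y : Gh Y Y (cid Y) = cid _.
  by apply: fa; rewrite liftP fun_id ccomp1l ij.
have Gcomp X Y Z (f : chom X Y) (g : chom Y Z) : Gh _ _ (ccomp f g) = ccomp (Gh _ _ f) (Gh _ _ g).
  apply: fa; rewrite fun_comp !liftP !ccompA; congr (ccomp _ (ccomp _ _)).
  by rewrite -[in RHS]ccompA ji ccomp1l.
pose G := @Functor D C G0 Gh Gid Gcomp.
exists G; split.
- exists (fun X => lift _ _ (j (F X))); split.
  + move=> X Y f /=; apply: fa; rewrite !fun_comp !liftP.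
    by rewrite -ccompA ji ccomp1l.
  + move=> X; exists (lift _ _ (i (F X))); split; apply: fa; rewrite fun_comp !liftP fun_id;
      [exact: ji | exact: ij].
- exists i; split=> // X Y f /=.
  by rewrite liftP !ccompA ji ccomp1r.
Qed.
End Equivalence.

Lemma full_comp (C D E : category) (F : functor C D) (G : functor D E) :
  full F -> full G -> full (comp_functor F G).
Proof. by move=> hF hG X Y g; have [h <-] := hG _ _ g; have [f <-] := hF _ _ h; exists f. Qed.

Lemma faithful_comp (C D E : category) (F : functor C D) (G : functor D E) :
  faithful F -> faithful G -> faithful (comp_functor F G).
Proof. by move=> hF hG X Y f f' /hG /hF. Qed.

Section InverseVst.
Variables (A B : double_category) (F G : psfunctor A B) (t : hcell A -> sq B).
Hypothesis ht : is_vst F G (fun x => vid (pob F x)) t.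
Hypothesis hg : forall f, inv_globular (ph F f) (ph G f) (t f).

Let ob_eq x : pob G x = pob F x.
Proof. by rewrite -(vst_tgt ht) vtgt_vid. Qed.
Let t_boundary f : boundary (t f) (ph F f) (ph G f) (vid (pob F (hsrc f))) (vid (pob F (htgt f))).
Proof. by have := boundary_ig (hg f); rewrite ph_src ph_tgt. Qed.
Let v_boundary f : boundary (vinv (t f)) (ph G f) (ph F f) (vid (pob F (hsrc f)))
  (vid (pob F (htgt f))).
Proof. by have [_ [_ h]] := vinvP (hg f); have := boundary_ig h; rewrite ph_src ph_tgt !ob_eq. Qed.
Ltac ob_step ::= rewrite ob_eq.
Ltac typ_atom ::= first [apply t_boundary | apply v_boundary].
Let vt f : vinv (t f) </> t f = Idh (ph G f).
Proof. by case: (vinvP (hg f)) => _ []. Qed.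
Let tv f : t f </> vinv (t f) = Idh (ph F f).
Proof. by case: (vinvP (hg f)). Qed.

(** Each law is checked after pasting [t] below, where it becomes the corresponding law of [t].
    Identity components at objects make [F] and [G] agree on objects. *)
Lemma vinv_vst : is_vst G F (fun x => vid (pob G x)) (fun f => vinv (t f)).
Proof.
split.
- by move=> x; rewrite vsrc_vid.
- by move=> x; rewrite vtgt_vid.
- by move=> f; case: (v_boundary f).
- by move=> f; case: (v_boundary f) => _ [].
- by move=> f; case: (v_boundary f) => _ [_ [-> _]]; rewrite ob_eq.
- by move=> f; case: (v_boundary f) => _ [_ [_ ->]]; rewrite ob_eq.
- move=> u; have := vst_nat_v ht u.
  rewrite (vid_compr (u := pv F u)) ?pv_tgt // (vid_compl (u := pv G u)) ?pv_src ?ob_eq // => ->.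
  by rewrite vid_compr ?vid_compl ?pv_src ?pv_tgt ?ob_eq.
- move=> f g e; apply: (vinv_cancel (hg (f ;h g))); try bd.
  rewrite sqvA ?vt; try bd.
  rewrite sqvA ?(vst_comp ht e); try bd.
  rewrite -sqvA; try bd.
  rewrite interchange; try bd.
  rewrite !vt -sq_id1h_hcomp; try bd.
  by rewrite sqv_idh ?idh_sqv; bd.
- move=> x; apply: (vinv_cancel (hg (hid x))); try bd.
  rewrite sqvA ?vt; try bd.
  rewrite sqvA ?(vst_unit ht); try bd.
  rewrite !sq_id1v_vid sqv_idh; try bd.
  by rewrite !idh_sqv; bd.
- move=> a; apply: (vinv_cancel (hg (bot a))); try bd.
  rewrite sqvA ?vt; try bd.
  rewrite sqvA ?(vst_nat_sq ht); try bd.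
  rewrite -sqvA ?vt; try bd.
  by rewrite sqv_idh ?idh_sqv; bd.
Qed.

Lemma vst_is_iso : @is_iso (Ps_vst A B) F G (Vst ht).
Proof.
exists (Vst vinv_vst); split; apply: vst_eq => x /=; rewrite ?ob_eq ?vid_vcomp ?vt ?tv //.
Qed.
End InverseVst.

Section Faithful.
Variables (A B E : double_category) (F F' : ob B -> psfunctor A E) (G G' : ob A -> psfunctor B E).
Variables (H : quasi2 F G) (H' : quasi2 F' G').
Variables (r0 : ob A -> ob B -> vcell E) (s : hcell A -> ob B -> sq E) (t : ob A -> hcell B ->
  sq E).
Hypothesis hs : forall y, is_vst (F y) (F' y) (fun x => r0 x y) (fun K => s K y).
Hypothesis ht : forall x, is_vst (G x) (G' x) (fun y => r0 x y) (fun k => t x k).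
Let r0_src x y : vsrc (r0 x y) = pob (G x) y. Proof. exact: (vst_src (ht x) y). Qed.
Let r0_tgt x y : vtgt (r0 x y) = pob (G' x) y. Proof. exact: (vst_tgt (ht x) y). Qed.
Let s_boundary K y : boundary (s K y) (ph (F y) K) (ph (F' y) K) (r0 (hsrc K) y) (r0 (htgt K) y).
Proof. exact: (boundary_vst (hs y) K). Qed.
Let t_boundary x k : boundary (t x k) (ph (G x) k) (ph (G' x) k) (r0 x (hsrc k)) (r0 x (htgt k)).
Proof. exact: (boundary_vst (ht x) k). Qed.
Ltac ob_step ::= first [rewrite (q_ob H) | rewrite (q_ob H') | rewrite r0_src | rewrite r0_tgt].
Ltac typ_atom ::= first [apply s_boundary | apply t_boundary | apply (inF_boundary H) | apply
  (inF_boundary H') | apply (inG_boundary H)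
  | apply (inG_boundary H') | apply (vinF_boundary H') | apply (vinG_boundary H')].
Let st (f : hcell (A ** B)) := s (fst f) (hsrc (snd f)) <|> t (htgt (fst f)) (snd f).

(** By [vst_unit] the factor [t (htgt K) (hid y)] is absorbed into the unitor of [inF]. So
    restriction is a retraction of gluing, which gives faithfulness. *)
Lemma resF_glue K y : resF F F' G G' st K y = s K y.
Proof.
have [e _] := vinvP (inF_glob H' K y).
rewrite /resF /st /= hsrc_hid.
rewrite -[RHS](@sqv_idh _ (ph (F' y) K)); try bd.
rewrite -e -[RHS]sqvA; try bd.
congr (_ </> _).
rewrite /inF !interchange; try bd.
rewrite (vst_unit (ht (htgt K)) y) idh_sqv ?sqv_idh; try bd.
transitivity ((s K y <|> Idv (r0 (htgt K) y)) </> (Idh (ph (F' y) K) <|> punit (G' (htgt K)) y)).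
  by rewrite interchange ?sqv_idh; bd.
by rewrite sqh_idv; bd.
Qed.

Lemma resG_glue x k : resG F F' G G' st x k = t x k.
Proof.
have [e _] := vinvP (inG_glob H' x k).
rewrite /resG /st /= htgt_hid.
rewrite -[RHS](@sqv_idh _ (ph (G' x) k)); try bd.
rewrite -e -[RHS]sqvA; try bd.
congr (_ </> _).
rewrite /inG !interchange; try bd.
rewrite (vst_unit (hs (hsrc k)) x) idh_sqv ?sqv_idh; try bd.
transitivity ((Idv (r0 x (hsrc k)) <|> t x k) </> (punit (F' (hsrc k)) x <|> Idh (ph (G' x) k))).
  by rewrite interchange ?sqv_idh; bd.
by rewrite idv_sqh; bd.
Qed.
End Faithful.

Section Glue3.
Variables (A B C E : double_category).

Definition glue3_ob (H : quasi3 A B C E) : psfunctor (A ** B ** C) E := glue (curry (tern123 H)).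

Definition glue12_vst (H H' : quasi3 A B C E) (t : quasi3_vst H H') z :
  is_vst (glue (tern12 H z)) (glue (tern12 H' z)) (fun xy => q3v_ob t (fst xy) (snd xy) z)
    (fun f => q3v_h1 t (fst f) (hsrc (snd f)) z <|> q3v_h2 t (htgt (fst f)) (snd f) z) :=
  glue_vst (fun y => q3v_1 (q3v_ax t) y z) (fun x => q3v_2 (q3v_ax t) x z) (q3v_12 (q3v_ax t) z).

Definition curry123_vst (H H' : quasi3 A B C E) (t : quasi3_vst H H') :
  quasi2_vst (curry (tern123 H)) (curry (tern123 H'))
   (fun f z => q3v_h1 t (fst f) (hsrc (snd f)) z <|> q3v_h2 t (htgt (fst f)) (snd f) z)
   (fun xy h => q3v_h3 t (fst xy) (snd xy) h) :=
  curry_vst (tern123 H) (tern123 H') (q3v_1 (q3v_ax t)) (q3v_2 (q3v_ax t)) (q3v_3 (q3v_ax t))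
    (q3v_13 (q3v_ax t)) (q3v_23 (q3v_ax t)).

Definition glue3_hom (H H' : quasi3 A B C E) (t : quasi3_vst H H') :
  vst (glue3_ob H) (glue3_ob H') :=
  Vst (glue_vst (r0 := fun (xy : ob (A ** B)) z => q3v_ob t (fst xy) (snd xy) z) (glue12_vst t)
        (fun xy => q3v_3 (q3v_ax t) (fst xy) (snd xy)) (curry123_vst t)).

Definition glue3 : functor (q3Ps A B C E) (Ps_vst (A ** B ** C) E).
Proof.
refine (@Functor (q3Ps A B C E) (Ps_vst (A ** B ** C) E) glue3_ob glue3_hom _ _).
- move=> H; apply: vst_eq; first by [].
  move=> [[f g] h] /=.
  have [e1 e2] := (q3_ob1 (tern13 H), q3_ob2 (tern23 H)).
  rewrite -!sq_id1h_hcomp ?ph_src ?ph_tgt ?e1 ?e2 //.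
  by rewrite htgt_hcomp ?ph_src ?ph_tgt ?e1 ?e2.
- move=> H H' H'' s t; apply: vst_eq; first by [].
  move=> [[f g] h] /=.
  case: (q3v_ax s) (q3v_ax t) => s1 s2 s3 _ _ _ [t1 t2 t3 _ _ _].
  have eqs f0 g0 z : rgt (q3v_h1 s f0 (hsrc g0) z) = lft (q3v_h2 s (htgt f0) g0 z).
    by rewrite (vst_rgt (s1 _ _)) (vst_lft (s2 _ _)).
  have eqt f0 g0 z : rgt (q3v_h1 t f0 (hsrc g0) z) = lft (q3v_h2 t (htgt f0) g0 z).
    by rewrite (vst_rgt (t1 _ _)) (vst_lft (t2 _ _)).
  have eb f0 y z : bot (q3v_h1 s f0 y z) = top (q3v_h1 t f0 y z).
    by rewrite (vst_bot (s1 _ _)) (vst_top (t1 _ _)).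
  have eb2 x g0 z : bot (q3v_h2 s x g0 z) = top (q3v_h2 t x g0 z).
    by rewrite (vst_bot (s2 _ _)) (vst_top (t2 _ _)).
  have eb3 x y h0 : bot (q3v_h3 s x y h0) = top (q3v_h3 t x y h0).
    by rewrite (vst_bot (s3 _ _)) (vst_top (t3 _ _)).
  rewrite -!interchange ?rgt_sqh ?bot_sqh ?top_sqh ?eb ?eb2 //.
  + by rewrite (vst_rgt (s2 _ _)) (vst_lft (s3 _ _)).
  + by rewrite (vst_rgt (t2 _ _)) (vst_lft (t3 _ _)).
Defined.

Lemma glue3_faithful : faithful glue3.
Proof.
move=> H H' s t e'; have e : glue3_hom s = glue3_hom t := e'.
have e0 x y z : q3v_ob s x y z = q3v_ob t x y z.
  have h : vst_ob (glue3_hom s) ((x, y), z) = vst_ob (glue3_hom t) ((x, y), z) by rewrite e.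
  exact: h.
have e1 := f_equal (@vst_h _ _ _ _) e.
(* The outer layer, on [A ** B] and [C], is unglued first. Restricting once more separates [A] from
   [B]; as [resF] takes a whole family of squares, [e12'] restates the equality for families. *)
have e12 z (f : hcell (A ** B)) : q3v_h1 s (fst f) (hsrc (snd f)) z <|>
  q3v_h2 s (htgt (fst f)) (snd f) z
    = q3v_h1 t (fst f) (hsrc (snd f)) z <|> q3v_h2 t (htgt (fst f)) (snd f) z.
  rewrite -(resF_glue (curry (tern123 H)) (curry (tern123 H')) (r0 := fun (xy : ob (A ** B)) z =>
    q3v_ob s (fst xy) (snd xy) z)
    (glue12_vst s) (fun xy => q3v_3 (q3v_ax s) (fst xy) (snd xy)) f z).
  rewrite -[RHS](resF_glue (curry (tern123 H)) (curry (tern123 H')) (r0 :=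
    fun (xy : ob (A ** B)) z => q3v_ob t (fst xy) (snd xy) z)
    (glue12_vst t) (fun xy => q3v_3 (q3v_ax t) (fst xy) (snd xy)) f z).
  by congr (resF _ _ _ _ _ f z).
have e12' z : (fun f : hcell (A ** B) => q3v_h1 s (fst f) (hsrc (snd f)) z <|>
  q3v_h2 s (htgt (fst f)) (snd f) z)
    = (fun f => q3v_h1 t (fst f) (hsrc (snd f)) z <|> q3v_h2 t (htgt (fst f)) (snd f) z).
  by apply: functional_extensionality => f.
apply: quasi3_vst_eq => //.
- move=> f y z.
  rewrite -(resF_glue (tern12 H z) (tern12 H' z) (fun y => q3v_1 (q3v_ax s) y z) (fun x =>
    q3v_2 (q3v_ax s) x z) f y).
  rewrite -[RHS](resF_glue (tern12 H z) (tern12 H' z) (fun y => q3v_1 (q3v_ax t) y z) (fun x =>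
    q3v_2 (q3v_ax t) x z) f y).
  by rewrite e12'.
- move=> x g z.
  rewrite -(resG_glue (tern12 H z) (tern12 H' z) (fun y => q3v_1 (q3v_ax s) y z) (fun x =>
    q3v_2 (q3v_ax s) x z) x g).
  rewrite -[RHS](resG_glue (tern12 H z) (tern12 H' z) (fun y => q3v_1 (q3v_ax t) y z) (fun x =>
    q3v_2 (q3v_ax t) x z) x g).
  by rewrite e12'.
- move=> x y h.
  have h1 := resG_glue (curry (tern123 H)) (curry (tern123 H')) (r0 := fun (xy : ob (A ** B)) z =>
    q3v_ob s (fst xy) (snd xy) z)
    (glue12_vst s) (fun xy => q3v_3 (q3v_ax s) (fst xy) (snd xy)) (x, y) h.
  have h2 := resG_glue (curry (tern123 H)) (curry (tern123 H')) (r0 := fun (xy : ob (A ** B)) z =>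
    q3v_ob t (fst xy) (snd xy) z)
    (glue12_vst t) (fun xy => q3v_3 (q3v_ax t) (fst xy) (snd xy)) (x, y) h.
  rewrite /= in h1 h2; rewrite -h1 -h2.
  by congr (resG _ _ _ _ _ _ h).
Qed.

Lemma glue3_full : full glue3.
Proof.
move=> H H' th.
have v := vst_ax th.
(* The transformation is restricted twice: to the slots [A ** B] and [C], and then from [A ** B] to
   [A] and [B]. Two uses of [res_hh] rebuild it at the end. *)
pose s z f := resF (fun z => glue (tern12 H z)) (fun z => glue (tern12 H' z))
  (fun xy => tern3 H (fst xy) (snd xy)) (fun xy => tern3 H' (fst xy) (snd xy)) (vst_h th) f z.
pose t := resG (fun z => glue (tern12 H z)) (fun z => glue (tern12 H' z))
  (fun xy => tern3 H (fst xy) (snd xy)) (fun xy => tern3 H' (fst xy) (snd xy)) (vst_h th).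
have hs z : is_vst (glue (tern12 H z)) (glue (tern12 H' z)) (fun xy => vst_ob th (xy, z)) (s z).
  exact: (resF_vst v z).
have ht (xy : ob (A ** B)) : is_vst (tern3 H (fst xy) (snd xy)) (tern3 H' (fst xy) (snd xy))
    (fun z => vst_ob th (xy, z)) (t xy).
  exact: (resG_vst v xy).
have hq : quasi2_vst (curry (tern123 H)) (curry (tern123 H')) (fun f z => s z f) t.
  exact: (res_quasi2 v).
have ax : is_quasi3_vst H H' (fun x y z => vst_ob th ((x, y), z))
  (fun f y z => resF (fun y => tern1 H y z) (fun y => tern1 H' y z) (fun x =>
    tern2 H x z) (fun x => tern2 H' x z) (s z) f y)
  (fun x g z => resG (fun y => tern1 H y z) (fun y => tern1 H' y z) (fun x =>
    tern2 H x z) (fun x => tern2 H' x z) (s z) x g)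
  (fun x y h => t (x, y) h).
  split.
  - move=> y z; exact: (resF_vst (hs z) y).
  - move=> x z; exact: (resG_vst (hs z) x).
  - move=> x y; exact: (ht (x, y)).
  - move=> z; exact: (res_quasi2 (hs z)).
  - move=> y; exact: (curry_res13 hs ht hq y).
  - move=> x; exact: (curry_res23 hs ht hq x).
exists (Quasi3Vst ax); apply: vst_eq.
- by move=> [[x y] z].
- move=> [[f g] h] /=.
  rewrite (res_hh (hs (hsrc h))).
  exact: (res_hh v).
Qed.
End Glue3.

(** * From four variables to three *)

Section QuadCurry.
Variables (A B C D E : double_category).

Definition quad_curry_ob (H : quasi4 A B C D E) : quasi3 (A ** B) C D E :=
  Quasi3 (curry4_ax (quat123 H) (quat124 H) (quat134 H) (quat234 H)).

Lemma quad_curry_hom_ax (H H' : quasi4 A B C D E) (t : quasi4_vst H H') :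
  is_quasi3_vst (quad_curry_ob H) (quad_curry_ob H')
    (fun xy z w => q4v_ob t (fst xy) (snd xy) z w)
    (fun f z w => q4v_h1 t (fst f) (hsrc (snd f)) z w <|> q4v_h2 t (htgt (fst f)) (snd f) z w)
    (fun xy h w => q4v_h3 t (fst xy) (snd xy) h w)
    (fun xy z k => q4v_h4 t (fst xy) (snd xy) z k).
Proof.
case: (q4v_ax t) => t123 t124 t134 t234; split.
- move=> z w; exact: (glue12_vst (Quasi3Vst (t123 w)) z).
- move=> [x y] w; exact: (q3v_3 (t123 w) x y).
- move=> [x y] z; exact: (q3v_3 (t124 z) x y).
- move=> w; exact: (curry123_vst (Quasi3Vst (t123 w))).
- move=> z; exact: (curry123_vst (Quasi3Vst (t124 z))).
(* The compatibility of slots 3 and 4 is the last pair of [t134], with slots 1 and 2 fixed at [x]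
   and [y]. *)
- move=> [x y]; exact: (q3v_23 (t134 y) x).
Qed.

Definition quad_curry_hom (H H' : quasi4 A B C D E) (t : quasi4_vst H H') :
  quasi3_vst (quad_curry_ob H) (quad_curry_ob H') :=
  Quasi3Vst (quad_curry_hom_ax t).

Definition quad_curry : functor (q4Ps A B C D E) (q3Ps (A ** B) C D E).
Proof.
refine (@Functor (q4Ps A B C D E) (q3Ps (A ** B) C D E) quad_curry_ob quad_curry_hom _ _).
- move=> H; apply: quasi3_vst_eq => //= [[f g] z w].
  have [e1 e2] := (q4_ob1 (quat14 H), q4_ob2 (quat24 H)).
  by rewrite -!sq_id1h_hcomp ?ph_src ?ph_tgt ?e1 ?e2.
- move=> H H' H'' s t; apply: quasi3_vst_eq => //= [[f g] z w].
  case: (q4v_ax s) (q4v_ax t) => s123 _ _ _ [t123 _ _ _].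
  have [s1 s2 _ _ _ _] := s123 w; have [t1 t2 _ _ _ _] := t123 w.
  rewrite -interchange //=.
  + exact: (eq_trans (vst_rgt (s1 _ _) _) (eq_sym (vst_lft (s2 _ _) _))).
  + exact: (eq_trans (vst_rgt (t1 _ _) _) (eq_sym (vst_lft (t2 _ _) _))).
  + exact: (eq_trans (vst_bot (s1 _ _) _) (eq_sym (vst_top (t1 _ _) _))).
  + exact: (eq_trans (vst_bot (s2 _ _) _) (eq_sym (vst_top (t2 _ _) _))).
Defined.

Lemma quad_curry_faithful : faithful quad_curry.
Proof.
move=> H H' s t e'; have e : quad_curry_hom s = quad_curry_hom t := e'.
have e0 x y z w : q4v_ob s x y z w = q4v_ob t x y z w.
  have h0 : (fun v : quasi3_vst (quad_curry_ob H) (quad_curry_ob H') =>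
    q3v_ob v (x, y) z w) (quad_curry_hom s) =
    (fun v : quasi3_vst (quad_curry_ob H) (quad_curry_ob H') =>
      q3v_ob v (x, y) z w) (quad_curry_hom t) by rewrite e.
  exact: h0.
have e1 z w : (fun f : hcell (A ** B) => q4v_h1 s (fst f) (hsrc (snd f)) z w <|>
  q4v_h2 s (htgt (fst f)) (snd f) z w)
   = (fun f => q4v_h1 t (fst f) (hsrc (snd f)) z w <|> q4v_h2 t (htgt (fst f)) (snd f) z w).
  apply: functional_extensionality => f; have h0 :
    (fun v : quasi3_vst (quad_curry_ob H) (quad_curry_ob H') => q3v_h1 v f z w) (quad_curry_hom s) =
    (fun v : quasi3_vst (quad_curry_ob H) (quad_curry_ob H') => q3v_h1 v f z w) (quad_curry_hom t)
      by rewrite e.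
  exact: h0.
apply: quasi4_vst_eq => //.
- move=> f y z w.
  have s1 := q4v_123 (q4v_ax s) w; have t1 := q4v_123 (q4v_ax t) w.
  rewrite -(resF_glue (quat12 H z w) (quat12 H' z w) (fun y => q3v_1 s1 y z) (fun x =>
    q3v_2 s1 x z) f y).
  rewrite -[RHS](resF_glue (quat12 H z w) (quat12 H' z w) (fun y => q3v_1 t1 y z) (fun x =>
    q3v_2 t1 x z) f y).
  by rewrite e1.
- move=> x g z w.
  have s1 := q4v_123 (q4v_ax s) w; have t1 := q4v_123 (q4v_ax t) w.
  rewrite -(resG_glue (quat12 H z w) (quat12 H' z w) (fun y => q3v_1 s1 y z) (fun x =>
    q3v_2 s1 x z) x g).
  rewrite -[RHS](resG_glue (quat12 H z w) (quat12 H' z w) (fun y => q3v_1 t1 y z) (fun x =>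
    q3v_2 t1 x z) x g).
  by rewrite e1.
- move=> x y h w; have h0 : (fun v : quasi3_vst (quad_curry_ob H) (quad_curry_ob H') =>
    q3v_h2 v (x, y) h w) (quad_curry_hom s) =
    (fun v : quasi3_vst (quad_curry_ob H) (quad_curry_ob H') =>
      q3v_h2 v (x, y) h w) (quad_curry_hom t) by rewrite e.
  exact: h0.
- move=> x y z k; have h0 : (fun v : quasi3_vst (quad_curry_ob H) (quad_curry_ob H') =>
    q3v_h3 v (x, y) z k) (quad_curry_hom s) =
    (fun v : quasi3_vst (quad_curry_ob H) (quad_curry_ob H') =>
      q3v_h3 v (x, y) z k) (quad_curry_hom t) by rewrite e.
  exact: h0.
Qed.

Lemma quad_curry_full : full quad_curry.
Proof.
move=> H H' th; have [v1 v2 v3 v12 v13 v23] := q3v_ax th.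
pose r1 f y z w := resF (fun y => quat1 H y z w) (fun y => quat1 H' y z w) (fun x => quat2 H x z w)
  (fun x => quat2 H' x z w) (fun f => q3v_h1 th f z w) f y.
pose r2 x g z w := resG (fun y => quat1 H y z w) (fun y => quat1 H' y z w) (fun x => quat2 H x z w)
  (fun x => quat2 H' x z w) (fun f => q3v_h1 th f z w) x g.
have w1 y z w : is_vst (quat1 H y z w) (quat1 H' y z w) (fun x => q3v_ob th (x, y) z w) (fun f =>
  r1 f y z w).
  exact: (resF_vst (v1 z w) y).
have w2 x z w : is_vst (quat2 H x z w) (quat2 H' x z w) (fun y => q3v_ob th (x, y) z w) (fun g =>
  r2 x g z w).
  exact: (resG_vst (v1 z w) x).
have w3 x y w : is_vst (quat3 H x y w) (quat3 H' x y w) (fun z => q3v_ob th (x, y) z w) (fun h =>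
  q3v_h2 th (x, y) h w).
  exact: (v2 (x, y) w).
have w4 x y z : is_vst (quat4 H x y z) (quat4 H' x y z) (fun w => q3v_ob th (x, y) z w) (fun k =>
  q3v_h3 th (x, y) z k).
  exact: (v3 (x, y) z).
have w12 z w : quasi2_vst (quat12 H z w) (quat12 H' z w) (fun f y => r1 f y z w) (fun x g =>
  r2 x g z w).
  exact: (res_quasi2 (v1 z w)).
(* The pairs of slots 1 and 2 with slot 3 are restrictions of [v12]; their pairs with slot 4 are
   restrictions of [v13]. *)
have w13 y w : quasi2_vst (quat13 H y w) (quat13 H' y w) (fun f z => r1 f y z w) (fun x h =>
  q3v_h2 th (x, y) h w).
  exact: (curry_res13 (fun z => v1 z w) (fun xy => v2 xy w) (v12 w) y).
have w23 x w : quasi2_vst (quat23 H x w) (quat23 H' x w) (fun g z => r2 x g z w) (fun y h =>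
  q3v_h2 th (x, y) h w).
  exact: (curry_res23 (fun z => v1 z w) (fun xy => v2 xy w) (v12 w) x).
have w14 y z : quasi2_vst (quat14 H y z) (quat14 H' y z) (fun f w => r1 f y z w) (fun x k =>
  q3v_h3 th (x, y) z k).
  exact: (curry_res13 (fun w => v1 z w) (fun xy => v3 xy z) (v13 z) y).
have w24 x z : quasi2_vst (quat24 H x z) (quat24 H' x z) (fun g w => r2 x g z w) (fun y k =>
  q3v_h3 th (x, y) z k).
  exact: (curry_res23 (fun w => v1 z w) (fun xy => v3 xy z) (v13 z) x).
have w34 x y : quasi2_vst (quat34 H x y) (quat34 H' x y) (fun h w =>
  q3v_h2 th (x, y) h w) (fun z k => q3v_h3 th (x, y) z k).
  exact: (v23 (x, y)).
have ax : is_quasi4_vst H H' (fun x y z w => q3v_ob th (x, y) z w) r1 r2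
  (fun x y h w => q3v_h2 th (x, y) h w) (fun x y z k => q3v_h3 th (x, y) z k).
  (* Each of the four ternary conditions concerns single slots and pairs of slots only, so the ten
     facts above cover them all. *)
  by split=> ?; split=> *; first [exact: w1 | exact: w2 | exact: w3 | exact: w4 | exact:
    w12 | exact: w13
    | exact: w14 | exact: w23 | exact: w24 | exact: w34].
exists (Quasi4Vst ax); apply: quasi3_vst_eq => /=.
- by move=> [x y].
- move=> [f g] z w; exact: (res_hh (v1 z w) f g).
- by move=> [x y].
- by move=> [x y].
Qed.
End QuadCurry.

Lemma glue3_ess_surj (A B C E : double_category) : ess_surj (glue3 A B C E).
Proof.
move=> P; exists (restr3 P).
have [l o] := restr3_over P.
exists (Vst (counit_vst o)); exact: (vst_is_iso (counit_vst o) (counit_glob o)).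
Qed.

Definition glue4 (A B C D E : double_category) :
  functor (q4Ps A B C D E) (Ps_vst (A ** B ** C ** D) E) :=
  comp_functor (quad_curry A B C D E) (glue3 (A ** B) C D E).

(** Going through [quad_curry] would require splitting the slot [A ** B] of an arbitrary ternary
    quasi-functor; restricting [P] to its four slots avoids this, since [glue4] of [restr4 P]
    computes to the functor in [restr4_over]. *)
Lemma glue4_ess_surj (A B C D E : double_category) : ess_surj (glue4 A B C D E).
Proof.
move=> P; exists (restr4 P).
have [l o] := restr4_over P.
exists (Vst (counit_vst o)); exact: (vst_is_iso (counit_vst o) (counit_glob o)).
Qed.

Theorem theorem7p5 (B : double_category) :
  (exists F3 : functor (q3Ps B B B B) (Ps_vst (B ** B ** B)%dbl B),
      is_equivalence F3) /\
  (exists F4 : functor (q4Ps B B B B B) (Ps_vst (B ** B ** B ** B)%dbl B),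
      is_equivalence F4).
Proof.
split.
- exists (glue3 B B B B); apply: equivalence_of_ff_es.
  + exact: glue3_full.
  + exact: glue3_faithful.
  + exact: glue3_ess_surj.
- exists (glue4 B B B B B); apply: equivalence_of_ff_es.
  + apply: full_comp; [exact: quad_curry_full | exact: glue3_full].
  + apply: faithful_comp; [exact: quad_curry_faithful | exact: glue3_faithful].
  + exact: glue4_ess_surj.
Qed.
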